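(* Let $1<p<\infty$ and $p\neq 2$. Let $\psi \in \mathcal{S}(\mathbb{R}^n)$ satisfy $\psi \ge c>0$ on $\{2^{-1/2}\le|\xi|\le 2^{1/2}\}$ for some constant $c$ and $\operatorname{supp}\psi \subset \{2^{-1}\le|\xi|\le 2\}$. Then there exists a Fourier multiplier $m\in\mathcal{S}'(\mathbb{R}^n)$ such that, with $m_j(\xi)=\psi(\xi)\,m(2^j\xi)$ for $j\in\mathbb{Z}$, $$\sup_{j\in\mathbb{Z}}\|m_j\|_{M^{2,1}_0}<\infty,$$ but $m(D)$ is not bounded on $L^p(\mathbb{R}^n)$.
   Context: $\mathcal{S}(\mathbb{R}^n)$ and $\mathcal{S}'(\mathbb{R}^n)$ are the Schwartz space and the space of tempered distributions. Fourier transform: $\mathcal{F}f(\xi)=\widehat{f}(\xi)=\int_{\mathbb{R}^n}e^{-i\xi\cdot x}f(x)\,dx$, $\mathcal{F}^{-1}f(x)=(2\pi)^{-n}\int_{\mathbb{R}^n}e^{ix\cdot\xi}f(\xi)\,d\xi$, extended to $\mathcal{S}'(\mathbb{R}^n)$. For $m\in\mathcal{S}'(\mathbb{R}^n)$, the Fourier multiplier operator is $m(D)f=\mathcal{F}^{-1}[m\,\widehat{f}]$ for $f\in\mathcal{S}(\mathbb{R}^n)$; the dilation $m(2^j\cdot)$ and the product with $\psi$ are taken in the sense of distributions. Modulation spaces: let $\varphi\in\mathcal{S}(\mathbb{R}^n)$ satisfy $\operatorname{supp}\varphi\subset[-1,1]^n$ and $\sum_{k\in\mathbb{Z}^n}\varphi(\xi-k)=1$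 for all $\xi\in\mathbb{R}^n$, and write $\varphi(D-k)f=\mathcal{F}^{-1}[\varphi(\cdot-k)\widehat{f}]$. For $1\le p,q\le\infty$ and $s\in\mathbb{R}$, $M^{p,q}_s(\mathbb{R}^n)$ is the space of all $f\in\mathcal{S}'(\mathbb{R}^n)$ with $$\|f\|_{M^{p,q}_s}=\Big(\sum_{k\in\mathbb{Z}^n}(1+|k|)^{sq}\|\varphi(D-k)f\|_{L^p}^q\Big)^{1/q}<\infty$$ (usual modification for $q=\infty$); different choices of $\varphi$ give equivalent norms. ''$m(D)$ is bounded on $X$'' means that there is a constant $C$ with $\|m(D)f\|_X\le C\|f\|_X$ for all $f\in\mathcal{S}(\mathbb{R}^n)\cap X$. *)

(* Defs.v *)
From HB Require Import structures.
From mathcomp Require Import all_boot all_order all_algebra.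
From mathcomp Require Import all_classical all_reals all_analysis.
From mathcomp Require Import complex.

Set Implicit Arguments.
Unset Strict Implicit.
Unset Printing Implicit Defensive.
Import Order.TTheory GRing.Theory Num.Theory.
Import numFieldNormedType.Exports.
Local Open Scope classical_set_scope.
Local Open Scope ring_scope.

(* R^n is 'rV[R]_n, here with its product (= Borel) sigma-algebra. Pitfall:
   `|x| is the sup norm on 'rV[R]_n; the Euclidean norm is [enorm] below. *)
Section measurable_rV.
Context (R : realType) (n : nat).

Let coor (i : 'I_n) (x : 'rV[R]_n) : measurableTypeR R := x ord0 i.

Let rV_set0 : g_sigma_preimage coor set0.
Proof. exact: sigma_algebra0. Qed.

Let rV_setC A : g_sigma_preimage coor A -> g_sigma_preimage coor (~` A).
Proof. exact: sigma_algebraC. Qed.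

Let rV_bigcup (F : (set 'rV[R]_n)^nat) :
  (forall i, g_sigma_preimage coor (F i)) ->
  g_sigma_preimage coor (\bigcup_i (F i)).
Proof. exact: sigma_algebra_bigcup. Qed.

HB.instance Definition _ := @isMeasurable.Build default_measure_display
  'rV[R]_n (g_sigma_preimage coor) rV_set0 rV_setC rV_bigcup.

Lemma measurable_coor (i : 'I_n) :
  measurable_fun setT (fun x : 'rV[R]_n => x ord0 i : measurableTypeR R).
Proof.
move=> _ Y mY; rewrite setTI; apply: sub_sigma_algebra => /=.
rewrite -bigcup_seq/=; exists i => /=; first by rewrite mem_index_enum.
by exists Y => //; rewrite setTI.
Qed.

Lemma measurable_fun_rVP d (T : measurableType d) (f : T -> 'rV[R]_n) :
  (forall i, measurable_fun setT (fun t => f t ord0 i : measurableTypeR R)) ->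
  measurable_fun setT f.
Proof.
move=> mf _ A mA; rewrite setTI.
suff: g_sigma_preimage coor `<=` [set B | measurable (f @^-1` B)].
  by apply.
apply: smallest_sub.
  split => /=.
  - by rewrite preimage_set0.
  - by move=> B mB; rewrite setTD preimage_setC; exact: measurableC.
  - by move=> F mF; rewrite preimage_bigcup; exact: bigcup_measurable.
rewrite -bigcup_seq => B [i _] [Y mY <-] /=.
have := mf i measurableT Y mY.
by rewrite !setTI.
Qed.

End measurable_rV.

Section sigma_finite_measure_of.
Context d (T : measurableType d) (R : realType).
Variable mu : {measure set T -> \bar R}.

Definition sigma_finite_copy (_ : sigma_finite setT mu) : set T -> \bar R := mu.

Hypothesis smu : sigma_finite setT mu.

HB.instance Definition _ := Measure.on (sigma_finite_copy smu).

HB.instance Definition _ :=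
  Measure_isSigmaFinite.Build _ _ _ (sigma_finite_copy smu) smu.

Lemma sigma_finite_measure_of :
  exists nu : {sigma_finite_measure set T -> \bar R}, mu = nu :> (_ -> _).
Proof. by exists (sigma_finite_copy smu). Qed.

End sigma_finite_measure_of.

Section lebesgue_rV.
Context (R : realType).

Definition cons_rV n (z : measurableTypeR R * 'rV[R]_n) : 'rV[R]_n.+1 :=
  \row_i (if unlift ord0 i is Some j then z.2 ord0 j else z.1).

Lemma measurable_cons_rV n : measurable_fun setT (@cons_rV n).
Proof.
apply: measurable_fun_rVP => i; rewrite /cons_rV.
case: (unliftP ord0 i) => [j|] ->.
  under eq_fun do rewrite mxE liftK.
  apply: (measurableT_comp (measurable_coor j)); exact: measurable_snd.
under eq_fun do rewrite mxE unlift_none.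
exact: measurable_fst.
Qed.

(* n-dimensional Lebesgue measure, as an iterated product measure *)
Fixpoint lebesgue_rV n : set 'rV[R]_n -> \bar R :=
  match n with
  | 0%N => \d_ (0 : 'rV[R]_0)
  | k.+1 => pushforward (lebesgue_measure \x @lebesgue_rV k)%E (@cons_rV k)
  end.

Let uncons_rV n (x : 'rV[R]_n.+1) : measurableTypeR R * 'rV[R]_n :=
  (x ord0 ord0, \row_j x ord0 (lift ord0 j)).

Let measurable_uncons_rV n : measurable_fun setT (@uncons_rV n).
Proof.
apply: measurable_fun_pair; first exact: measurable_coor.
apply: measurable_fun_rVP => j; under eq_fun do rewrite mxE.
exact: measurable_coor.
Qed.

Let cons_rVK n : cancel (@cons_rV n) (@uncons_rV n).
Proof.
move=> [x t]; rewrite /uncons_rV /cons_rV mxE unlift_none; congr pair.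
by apply/rowP => j; rewrite !mxE liftK.
Qed.

Lemma lebesgue_rV_sigma_finite_measure n :
  exists mu : {sigma_finite_measure set 'rV[R]_n -> \bar R},
    @lebesgue_rV n = mu.
Proof.
elim: n => [|n [mu IH]]; first by exists (\d_ (0 : 'rV[R]_0)).
rewrite /= IH.
pose nu : {measure set _ -> \bar R} := (lebesgue_measure \x mu)%E.
have mc := @measurable_cons_rV n.
pose rho : {measure set 'rV[R]_n.+1 -> \bar R} :=
  measure_function_pushforward__canonical__measure_function_Measure nu mc.
have sf : sigma_finite setT rho.
  have /sigma_finiteP[F [FT ndF Foo]] := sigma_finiteT (@lebesgue_measure R).
  have /sigma_finiteP[G [GT ndG Goo]] := sigma_finiteT mu.
  exists (fun k => @uncons_rV n @^-1` (F k `*` G k)) => [|k].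
    rewrite -preimage_bigcup (_ : \bigcup_k _ = setT) ?preimage_setT//.
    rewrite -subTset => -[x y] _ /=.
    have [i _ Fx] : (\bigcup_i F i) x by rewrite -FT.
    have [j _ Gy] : (\bigcup_i G i) y by rewrite -GT.
    exists (maxn i j) => //; split => /=.
    - by move: x Fx; exact/subsetPset/ndF/leq_maxl.
    - by move: y Gy; exact/subsetPset/ndG/leq_maxr.
  have [mF Fk] := Foo k; have [mG Gk] := Goo k.
  have mFG : measurable (F k `*` G k) by exact: measurableX.
  split; first by rewrite -[X in measurable X]setTI; exact: measurable_uncons_rV.
  rewrite /= /pushforward -comp_preimage.
  rewrite (_ : _ \o _ = id) ?preimage_id; last first.
    by apply/funext => z; exact: cons_rVK.
  by rewrite /nu/= product_measure1E// lte_mul_pinfty// ge0_fin_numE.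
exact: sigma_finite_measure_of sf.
Qed.

Let lebesgue_rV0 n : @lebesgue_rV n set0 = 0%E.
Proof. by have [mu ->] := lebesgue_rV_sigma_finite_measure n. Qed.

Let lebesgue_rV_ge0 n A : (0 <= @lebesgue_rV n A)%E.
Proof. by have [mu ->] := lebesgue_rV_sigma_finite_measure n. Qed.

Let lebesgue_rV_semi_sigma_additive n : semi_sigma_additive (@lebesgue_rV n).
Proof.
have [mu ->] := lebesgue_rV_sigma_finite_measure n.
exact: measure_semi_sigma_additive.
Qed.

HB.instance Definition _ n := isMeasure.Build _ _ _ (@lebesgue_rV n)
  (@lebesgue_rV0 n) (@lebesgue_rV_ge0 n) (@lebesgue_rV_semi_sigma_additive n).

Let lebesgue_rV_sigma_finite n : sigma_finite setT (@lebesgue_rV n).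
Proof.
by have [mu ->] := lebesgue_rV_sigma_finite_measure n; exact: sigma_finiteT.
Qed.

HB.instance Definition _ n := Measure_isSigmaFinite.Build _ _ _
  (@lebesgue_rV n) (@lebesgue_rV_sigma_finite n).

End lebesgue_rV.
Arguments lebesgue_rV {R n}.

Section fourier.
Context (R : realType) (n : nat).
Local Open Scope complex_scope.
Implicit Types (x y xi : 'rV[R]_n) (f g h : 'rV[R]_n -> R[i]).

Definition dotv x y : R := \sum_i x ord0 i * y ord0 i.

Definition enorm x : R := Num.sqrt (dotv x x).

Definition intv (k : 'rV[int]_n) : 'rV[R]_n := map_mx intr k.

Definition cintegral f : R[i] :=
  (\int[lebesgue_rV]_x complex.Re (f x)) +i* (\int[lebesgue_rV]_x complex.Im (f x)).

Definition expi (t : R) : R[i] := cos t +i* sin t.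

Definition fourier f xi : R[i] :=
  cintegral (fun x => expi (- dotv xi x) * f x).

Definition inv_fourier f x : R[i] :=
  ((2 * pi) ^- n)%:C * cintegral (fun xi => expi (dotv x xi) * f xi).

Definition supp f : set 'rV[R]_n := closure [set x | f x != 0].

Definition pderiv (i : 'I_n) f x : R[i] :=
  'D_(delta_mx ord0 i) (fun y => complex.Re (f y)) x +i*
  'D_(delta_mx ord0 i) (fun y => complex.Im (f y)) x.

(* the multi-index is given as the list of the directions of derivation *)
Definition pderivs (s : seq 'I_n) f : 'rV[R]_n -> R[i] := foldr pderiv f s.

Definition smooth f := forall (s : seq 'I_n) x,
  differentiable (fun y => complex.Re (pderivs s f y)) x /\
  differentiable (fun y => complex.Im (pderivs s f y)) x.

Definition schwartz_seminorm (N : nat) f : \bar R :=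
  ereal_sup [set z | exists (s : seq 'I_n) x, (size s <= N)%N /\
    z = ((1 + enorm x) ^+ N * Normc.normc (pderivs s f x))%:E].

Definition schwartz f :=
  smooth f /\ forall N, (schwartz_seminorm N f < +oo)%E.

(* Tempered distributions are functionals on all functions of which only the
   values at Schwartz functions are meaningful: this avoids having to bundle
   the operations on test functions with proofs of stability. *)
Definition distr := ('rV[R]_n -> R[i]) -> R[i].
Implicit Types u m : distr.

Definition tempered u :=
  (forall (a : R[i]) f g, schwartz f -> schwartz g ->
    u (fun x => a * f x + g x) = a * u f + u g) /\
  (exists (N : nat) (C : R), forall f, schwartz f ->
    ((Normc.normc (u f))%:E <= C%:E * schwartz_seminorm N f)%E).

Definition distr_of_fun h : distr := fun g => cintegral (fun x => h x * g x).

Definition mul_distr f u : distr := fun g => u (fun x => f x * g x).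

(* u(lambda .) for lambda > 0 *)
Definition dilate_distr (lambda : R) u : distr := fun g =>
  (lambda ^- n)%:C * u (fun x => g (lambda^-1 *: x)).

Definition fourier_distr u : distr := fun g => u (fourier g).

Definition inv_fourier_distr u : distr := fun g => u (inv_fourier g).

(* m(D) f *)
Definition multiplier m f : distr :=
  inv_fourier_distr (mul_distr (fourier f) m).

(* a(D) u for a function a and a distribution u *)
Definition fmultiplier (a : 'rV[R]_n -> R[i]) u : distr :=
  inv_fourier_distr (mul_distr a (fourier_distr u)).

Definition Lp_norm_fun (p : \bar R) h : \bar R :=
  Lnorm lebesgue_rV p (fun x => (Normc.normc (h x))%:E).

Definition Lp_representative (p : \bar R) u h :=
  [/\ measurable_fun setT (fun x => complex.Re (h x)),
      measurable_fun setT (fun x => complex.Im (h x)),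
      (Lp_norm_fun p h < +oo)%E &
      forall g, schwartz g -> u g = distr_of_fun h g].

(* +oo if u is not a function in L^p; representatives are equal a.e. *)
Definition Lp_norm (p : \bar R) u : \bar R :=
  ereal_inf [set Lp_norm_fun p h | h in Lp_representative p u].

Definition unity_partition (phi : 'rV[R]_n -> R[i]) :=
  [/\ schwartz phi,
      supp phi `<=` [set x | forall i, -1 <= x ord0 i <= 1] &
      forall x, \sum_(k \in [set: 'rV[int]_n]) phi (x - intv k) = 1].

Definition modulation_norm (phi : 'rV[R]_n -> R[i]) (p q : \bar R) (s : R) u :
    \bar R :=
  let block k := Lp_norm p (fmultiplier (fun xi => phi (xi - intv k)) u) in
  let weight k (t : R) := ((1 + enorm (intv k)) `^ t)%:E in
  match q with
  | r%:E => ((\esum_(k in [set: 'rV[int]_n])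
      (weight k (s * r)%R * block k `^ r)) `^ r^-1)%E
  | _ => ereal_sup [set (weight k s * block k)%E | k in [set: 'rV[int]_n]]
  end.

(* boundedness of m(D) on the space of tempered distributions of finite
   norm X *)
Definition bounded_multiplier (X : distr -> \bar R) m :=
  exists C : R, forall f, schwartz f -> (X (distr_of_fun f) < +oo)%E ->
    (X (multiplier m f) <= C%:E * X (distr_of_fun f))%E.

End fourier.

(* Main.v *)
(* The multiplier is m(xi) = sum_t e^{i a_t . xi} psi(xi / lambda_t), with sparse
   dyadic scales lambda_t and spread-out translations a_t.  By sparseness, each
   psi(xi) m(2^j xi) is either 0 or a modulation e^{i b . xi} of one of finitely
   many fixed Schwartz functions.  A modulation merely translates the Fourier
   transform, which decays rapidly, so the L^2 norms of the blocks phi(D - k)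
   have a sum over k bounded independently of b, hence uniformly in j.
   On the other hand m(D) translates a wave packet of frequency lambda_t by a_t.
   It thus turns N coinciding packets into N separated ones, or conversely.  The
   L^r norm of N separated packets is O(N^{1/r}), while for r <= 2 that of N
   coinciding packets is O(N^{1/2}) by almost orthogonality.  Pairing the image
   of one family with the other family gives at least a multiple of N, which for
   p <> 2 contradicts Hoelder's inequality if m(D) is bounded on L^p. *)
From HB Require Import structures.
Require Import Defs.
From mathcomp Require Import all_boot all_order all_algebra.
From mathcomp Require Import all_classical all_reals all_analysis.
From mathcomp Require Import measurable_realfun complex.
From mathcomp Require Import zify ring lra.
Import Order.TTheory GRing.Theory Num.Theory.
Import numFieldNormedType.Exports.
Set Implicit Arguments.
Unset Strict Implicit.
Unset Printing Implicit Defensive.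
Local Open Scope classical_set_scope.
Local Open Scope ring_scope.
Local Open Scope complex_scope.

(** * Lebesgue measure on row vectors *)

(** The multiplier depends only on [psi] and a coordinate direction, so one [m] serves every [p] and
    every [phi]. All decay is measured by one function, [weight], the product of the
    $(1+x_i^2)^{-1}$: its integral factors, it changes by at most $3^n$ under unit displacements,
    and its reciprocal is the symbol of $\prod_i(1-\partial_i^2)$. Plancherel's identity is replaced
    by an inequality. A kernel $e(x/m)$ is inserted in the $L^2$ integral, the multiplication
    formula bounds the weighted integral by the $L^1$ norm of the transform of the kernel, which
    dilation does not change, and Fatou's lemma removes the kernel. The obstacle in the lower bound
    is that packets of compact support have transforms with tails, so every packet meets every term
    of the multiplier. The error for the pair $(j,k)$ carries a factor $2^{-j-k}$, whose double sum
    is bounded independently of $N$; the errors thus cost a constant against a main term linear in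
    $N$. With $1/p+1/q=1$, boundedness would make $N$ at most of order $N^{1/p+1/2}$ if $p>2$ and
    $N^{1/2+1/q}$ if $p<2$. *)

Section lebesgue_rV_integration.
Context (R : realType).
Local Notation leb := (@lebesgue_measure R).

Lemma measurable_affine (c b : R) :
  measurable_fun setT (fun x : R => c * x + b : measurableTypeR R).
Proof. by apply: measurable_funD => //; exact: measurable_funM. Qed.

(** Lebesgue measure is characterised by its values on half-open intervals, and $c$ times its image
    under $x\mapsto cx+b$ has the same values there. *)
Lemma ge0_integral_affine (c b : R) (f : R -> \bar R) : 0 < c ->
  measurable_fun setT f -> (forall x, 0 <= f x)%E ->
  (c%:E * \int[leb]_x f (c * x + b)%R = \int[leb]_x f x)%E.
Proof.
move=> c0 mf f0.
pose phi : R -> measurableTypeR R := fun x => c * x + b.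
have mphi : measurable_fun setT phi := measurable_affine c b.
pose nu : {measure set _ -> \bar R} :=
  measure_function_pushforward__canonical__measure_function_Measure leb mphi.
pose mu : {measure set _ -> \bar R} := mscale (NngNum (ltW c0)) nu.
have lebE : forall A, measurable A -> leb A = mu A.
  apply: lebesgue_measure_unique => _ [[u v] /= _ <-].
  rewrite /mu /mscale /= /nu /= /pushforward.
  rewrite (_ : phi @^-1` _ = `]((u - b) / c), ((v - b) / c)]%classic); last first.
    apply/seteqP; split => x /=; rewrite !in_itv/= /phi;
      by rewrite ltr_pdivrMr// ler_pdivlMr// ltrBlDr lerBrDr mulrC.
  rewrite !lebesgue_measure_itv/= !lte_fin ltr_pM2r ?invr_gt0// ltrD2r.
  case: ifPn => uv; last by rewrite mule0.
  rewrite -!EFinD -EFinM; congr EFin; field; exact: lt0r_neq0.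
rewrite [RHS](@eq_measure_integral _ _ _ _ mu); last first.
  by move=> A mA _; exact: lebE.
rewrite ge0_integral_mscale//=; congr (_ * _)%E.
by rewrite ge0_integral_pushforward// => x _; rewrite f0.
Qed.

Lemma ge0_integral_rVS n (f : 'rV[R]_n.+1 -> \bar R) :
  measurable_fun setT f -> (forall x, 0 <= f x)%E ->
  (\int[lebesgue_rV]_x f x
   = \int[leb]_t \int[lebesgue_rV]_y f (cons_rV (t, y)))%E.
Proof.
move=> mf f0; have mc := @measurable_cons_rV R n.
pose nu : {measure set _ -> \bar R} :=
  (leb \x (@lebesgue_rV R n))%E.
pose rho : {measure set 'rV[R]_n.+1 -> \bar R} :=
  measure_function_pushforward__canonical__measure_function_Measure nu mc.
rewrite (@eq_measure_integral _ _ _ _ rho) //.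
rewrite ge0_integral_pushforward// preimage_setT.
rewrite (fubini_tonelli1 (f \o @cons_rV R n))//=.
exact: measurableT_comp.
Qed.

Lemma measurable_cons_rV_r n (t : R) :
  measurable_fun setT (fun y : 'rV[R]_n => cons_rV (t : measurableTypeR R, y)).
Proof.
apply: (measurableT_comp (@measurable_cons_rV R n)).
exact: measurable_fun_pair.
Qed.

Lemma measurable_affine_rV n (c : R) (b : 'rV[R]_n) :
  measurable_fun setT (fun x : 'rV[R]_n => c *: x + b).
Proof.
apply: measurable_fun_rVP => i; under eq_fun do rewrite !mxE.
by apply: (measurableT_comp (measurable_affine c (b ord0 i))); exact: measurable_coor.
Qed.

Lemma affine_cons_rV n (c t : R) (b : 'rV[R]_n.+1) (y : 'rV[R]_n) :
  c *: cons_rV (t : measurableTypeR R, y) + b =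
  cons_rV (c * t + b ord0 ord0 : measurableTypeR R,
    c *: y + \row_j b ord0 (lift ord0 j)).
Proof.
apply/rowP => i; rewrite !mxE; case: unliftP => [j|] -> //=.
by rewrite !mxE.
Qed.

Lemma ge0_integral_affine_rV n (c : R) (b : 'rV[R]_n) (f : 'rV[R]_n -> \bar R) :
  0 < c -> measurable_fun setT f -> (forall x, 0 <= f x)%E ->
  ((c ^+ n)%:E * \int[lebesgue_rV]_x f (c *: x + b)%R =
   \int[lebesgue_rV]_x f x)%E.
Proof.
move=> c0; elim: n b f => [|n IH] b f mf f0.
  rewrite expr0 mul1e; apply: eq_integral => x _; congr f.
  by apply/rowP => -[].
have mfc : measurable_fun setT (fun x : 'rV[R]_n.+1 => f (c *: x + b)).
  by apply: measurableT_comp => //; exact: measurable_affine_rV.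
rewrite !ge0_integral_rVS//.
pose F (t : R) := (\int[lebesgue_rV]_y f (cons_rV (t : measurableTypeR R, y)))%E.
have mF : measurable_fun setT F.
  apply: (measurable_fun_fubini_tonelli_F (f \o @cons_rV R n)) => //=.
  by apply: measurableT_comp => //; exact: measurable_cons_rV.
have F0 t : (0 <= F t)%E by apply: integral_ge0.
rewrite -/F -(ge0_integral_affine (b ord0 ord0) c0 mF F0).
rewrite exprS EFinM -muleA; congr (_ * _)%E.
rewrite -ge0_integralZl//; last 3 first.
- apply: (measurable_fun_fubini_tonelli_F (fun z => f (c *: (@cons_rV R n) z + b))) => //=.
  by apply: (measurableT_comp mfc); exact: measurable_cons_rV.
- by move=> t _; apply: integral_ge0.
- by rewrite lee_fin exprn_ge0// ltW.
apply: eq_integral => t _.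
rewrite /F -(IH (\row_j b ord0 (lift ord0 j)) (fun y => f (cons_rV (c * t + b ord0 ord0, y))))//.
- by congr (_ * _)%E; apply: eq_integral => y _; rewrite affine_cons_rV.
- apply: measurableT_comp => //; exact: measurable_cons_rV_r.
Qed.

Lemma ge0_integral_shift_rV n (b : 'rV[R]_n) (f : 'rV[R]_n -> \bar R) :
  measurable_fun setT f -> (forall x, 0 <= f x)%E ->
  (\int[lebesgue_rV]_x f (x + b)%R = \int[lebesgue_rV]_x f x)%E.
Proof.
move=> mf f0; rewrite -(@ge0_integral_affine_rV n 1 b f)// expr1n mul1e.
by apply: eq_integral => x _; rewrite scale1r.
Qed.

Lemma ge0_integral_prod_rV n (g : 'I_n -> R -> R) :
  (forall i, measurable_fun setT (g i)) -> (forall i x, 0 <= g i x) ->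
  (\int[lebesgue_rV]_x (\prod_(i < n) g i (x ord0 i))%:E
   = \prod_(i < n) \int[leb]_t (g i t)%:E)%E.
Proof.
elim: n g => [|n IH] g mg g0.
  under eq_integral do rewrite big_ord0.
  by rewrite big_ord0 /= integral_dirac// diracT mul1e.
have mp m (h : 'I_m -> R -> R) : (forall i, measurable_fun setT (h i)) ->
    measurable_fun setT (fun x : 'rV[R]_m => (\prod_(i < m) h i (x ord0 i))%:E).
  move=> mh; apply/measurable_EFinP.
  apply: (@measurable_prod _ _ _ _ _ _ (fun i (x : 'rV_m) => h i (x ord0 i))) => i _.
  by apply: (measurableT_comp (mh i)); exact: measurable_coor.
rewrite ge0_integral_rVS//; first last.
- by move=> x; rewrite lee_fin prodr_ge0.
- exact: mp.
have E t : (\int[lebesgue_rV]_y (\prod_(i < n.+1) g i (cons_rV (t : measurableTypeR R, y) ord0 i))%:E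
    = (g ord0 t)%:E * \prod_(i < n) \int[leb]_t (g (lift ord0 i) t)%:E)%E.
  rewrite -IH//.
  rewrite -ge0_integralZl//; first last.
  - by rewrite lee_fin.
  - by move=> x _; rewrite lee_fin prodr_ge0.
  - exact: (mp n (fun i => g (lift ord0 i))).
  apply: eq_integral => y _; rewrite -EFinM big_ord_recl; congr (_ * _)%:E.
    by rewrite mxE unlift_none.
  by under eq_bigr do rewrite mxE liftK.
under eq_integral do rewrite E.
rewrite big_ord_recl ge0_integralZr//.
- by apply/measurable_EFinP; exact: mg.
- by move=> t _; rewrite lee_fin.
- by apply: prode_ge0 => i _; apply: integral_ge0 => t _; rewrite lee_fin.
Qed.

End lebesgue_rV_integration.

(** * Measurability of continuous functions on row vectors *)

Section measurable_continuous_rV.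
Context (R : realType) (n : nat).
Implicit Types (x y : 'rV[R]_n).

Lemma norm_rV_le x (e : R) : 0 <= e -> (forall i, `|x ord0 i| <= e) -> `|x| <= e.
Proof.
move=> e0 xe; rewrite -[`|x|]/(mx_norm x).
have [->//|/mx_norm_neq0[[i j] /= ->]] := eqVneq (mx_norm x) 0.
by rewrite (ord1 i).
Qed.

Definition floor_rV x : 'rV[int]_n := \row_i Num.floor (x ord0 i).

Lemma measurable_floor_rV (S : set 'rV[int]_n) (m : R) :
  measurable [set x : 'rV[R]_n | S (floor_rV (m *: x))].
Proof.
have -> : [set x : 'rV[R]_n | S (floor_rV (m *: x))] =
    \bigcup_(k in setT) (if k \in S then \bigcap_(i in [set: 'I_n])
      [set x : 'rV[R]_n | Num.floor (m * x ord0 i) = k ord0 i] else set0).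
  apply/seteqP; split => x /=.
    move=> Sx; exists (floor_rV (m *: x)) => //; rewrite mem_set// => i _ /=.
    by rewrite !mxE.
  move=> [k _]; case: ifPn => // /set_mem Sk kx.
  rewrite (_ : floor_rV _ = k)//; apply/rowP => i; rewrite !mxE.
  exact: kx.
apply: countable_bigcupT_measurable => // k; case: ifPn => // _.
apply: fin_bigcap_measurable => // i _.
have -> : [set x : 'rV[R]_n | Num.floor (m * x ord0 i) = k ord0 i] =
    setT `&` (fun x : 'rV[R]_n => m * x ord0 i + 0 : measurableTypeR R) @^-1`
     `[(k ord0 i)%:~R, (k ord0 i + 1)%:~R[%classic.
  rewrite setTI; apply/seteqP; split => x /=; rewrite in_itv/= addr0.
    by move=> <-; exact: floor_itv.
  by move=> /floor_def.
exact: (measurableT_comp (measurable_affine m 0) (measurable_coor i)).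
Qed.

(** The sigma-algebra is generated by the coordinates, while continuity refers to the sup norm.
    Sampling [f] at the corners of a grid of mesh $1/(m+1)$ links the two: the sampled functions are
    constant on countably many measurable cubes and converge pointwise to [f]. *)
Lemma continuous_measurable_fun_rV (f : 'rV[R]_n -> R) :
  continuous f -> measurable_fun setT f.
Proof.
move=> cf.
pose g (m : nat) (x : 'rV[R]_n) : R :=
  f ((m.+1%:R)^-1 *: map_mx intr (floor_rV (m.+1%:R *: x))).
apply: (@measurable_fun_cvg _ _ _ _ g) => // [m|x _].
  move=> _ Y mY; rewrite setTI.
  exact: (measurable_floor_rV [set k | Y (f (m.+1%:R^-1 *: map_mx intr k))] m.+1%:R).
apply: (cvg_comp _ f _ (cf x)).
apply/cvgrPdist_le => /= e e0; near=> m.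
apply: norm_rV_le; first exact: ltW.
move=> i; rewrite !mxE.
have m0 : (0 < m.+1%:R :> R) by rewrite ltr0n.
have /andP[] := floor_itv (m.+1%:R * x ord0 i).
set k := Num.floor _; rewrite intrD => kx xk.
have me : m.+1%:R^-1 <= e.
  apply/ltW; near: m; exact: (near_infty_natSinv_lt (PosNum e0)).
apply: le_trans me.
rewrite ler_norml; apply/andP; split.
  rewrite lerBrDr -(ler_pM2l m0) mulrDr mulrN mulfV ?gt_eqF// mulrA mulfV ?gt_eqF//.
  rewrite mul1r; lra.
rewrite lerBlDr -(ler_pM2l m0) mulrDr mulfV ?gt_eqF// mulrA mulfV ?gt_eqF//.
rewrite mul1r; lra.
Unshelve. all: by end_near. Qed.

End measurable_continuous_rV.

(** * The integrable weight and its lattice sums *)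

Section weight.
Context (R : realType) (n : nat).
Implicit Types (x y b : 'rV[R]_n).

(** The product form is preferred to a power of $1+|x|$ because its integral reduces to one
    dimension and because its reciprocal is the symbol of a differential operator. *)
Definition weight x : R := \prod_(i < n) (1 + x ord0 i ^+ 2)^-1.

Lemma oneD_sqr_gt0 (t : R) : 0 < 1 + t ^+ 2.
Proof. by rewrite ltr_pwDl// sqr_ge0. Qed.

Lemma oneD_sqrV_ge0 (t : R) : 0 <= (1 + t ^+ 2)^-1.
Proof. by rewrite invr_ge0 ltW// oneD_sqr_gt0. Qed.

Lemma oneD_sqrV_le1 (t : R) : (1 + t ^+ 2)^-1 <= 1.
Proof. by rewrite invf_le1 ?oneD_sqr_gt0// lerDl sqr_ge0. Qed.

Lemma weight_gt0 x : 0 < weight x.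
Proof. by apply: prodr_gt0 => i _; rewrite invr_gt0 oneD_sqr_gt0. Qed.

Lemma weight_ge0 x : 0 <= weight x. Proof. exact/ltW/weight_gt0. Qed.

Lemma weight_le_coord x i : weight x <= (1 + x ord0 i ^+ 2)^-1.
Proof.
rewrite /weight (bigD1 i)//= ler_piMr ?oneD_sqrV_ge0//.
by apply: prodr_ile1 => j _; rewrite oneD_sqrV_ge0 oneD_sqrV_le1.
Qed.

Lemma weight_le1 x : weight x <= 1.
Proof. by apply: prodr_ile1 => j _; rewrite oneD_sqrV_ge0 oneD_sqrV_le1. Qed.

Lemma dotvvE x : dotv x x = \sum_i x ord0 i ^+ 2.
Proof. by apply: eq_bigr => i _; rewrite expr2. Qed.

Lemma dotvv_ge0 x : 0 <= dotv x x.
Proof. by apply: sumr_ge0 => i _; rewrite -expr2 sqr_ge0. Qed.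

Lemma enorm_ge0 x : 0 <= enorm x. Proof. exact: sqrtr_ge0. Qed.

Lemma sqr_enorm x : enorm x ^+ 2 = dotv x x.
Proof. by rewrite sqr_sqrtr// dotvv_ge0. Qed.

Lemma le_prod_oneD (I : Type) (s : seq I) (a : I -> R) : (forall i, 0 <= a i) ->
  1 + \sum_(i <- s) a i <= \prod_(i <- s) (1 + a i).
Proof.
move=> a0; elim: s => [|i s IH]; first by rewrite !big_nil addr0.
rewrite !big_cons mulrDl mul1r.
have S0 : 0 <= \sum_(i <- s) a i by apply: sumr_ge0.
have : a i * (1 + \sum_(i <- s) a i) <= a i * \prod_(i <- s) (1 + a i).
  exact: ler_wpM2l.
have := mulr_ge0 (a0 i) S0; nra.
Qed.

Lemma weight_le_enorm x : weight x <= (1 + enorm x ^+ 2)^-1.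
Proof.
rewrite sqr_enorm /weight prodfV lef_pV2 ?posrE ?prodr_gt0//; first last.
- by rewrite ltr_pwDl// dotvv_ge0.
- by move=> i _; exact: oneD_sqr_gt0.
rewrite dotvvE.
by apply: le_prod_oneD => i; exact: sqr_ge0.
Qed.

Lemma coord_le_enorm x i : `|x ord0 i| <= enorm x.
Proof.
rewrite -sqrtr_sqr /enorm ler_wsqrtr// /dotv (bigD1 i)//= -expr2 lerDl.
by apply: sumr_ge0 => j _; rewrite -expr2 sqr_ge0.
Qed.

(** Two powers for each coordinate. This is why Schwartz seminorms of order $2n$ are the ones used
    below. *)
Lemma weightV_le x : (weight x)^-1 <= (1 + enorm x) ^+ n.*2.
Proof.
rewrite /weight prodfV invrK.
rewrite (_ : _ ^+ _ = \prod_(i < n) (1 + enorm x) ^+ 2); last first.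
  by rewrite prodr_const card_ord -exprM mul2n.
apply: ler_prod => i _; rewrite ltW ?oneD_sqr_gt0//=.
have := coord_le_enorm x i; have := enorm_ge0 x.
rewrite -(real_normK (num_real (x ord0 i))).
have := normr_ge0 (x ord0 i); nra.
Qed.

Lemma weight_shift x y : (forall i, `|x ord0 i - y ord0 i| <= 1) ->
  weight x <= 3 ^+ n * weight y.
Proof.
move=> xy; rewrite /weight.
rewrite (_ : 3 ^+ n = \prod_(i < n) 3); last by rewrite prodr_const card_ord.
rewrite -big_split/=; apply: ler_prod => i _; rewrite oneD_sqrV_ge0/=.
rewrite ler_pdivlMr ?oneD_sqr_gt0// mulrC ler_pdivrMr ?oneD_sqr_gt0//.
have := xy i; rewrite ler_norml => /andP[xy1 xy2].
(* With $(x-y)^2\le 1$, the identity $2(x-y)^2=(2x-y)^2-2x^2+y^2$ gives $y^2\le 2x^2+2$, hence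
   $1+y^2\le 3(1+x^2)$. *)
have := sqr_ge0 (2 * x ord0 i - y ord0 i); have := sqr_ge0 (x ord0 i).
have : 0 <= (1 - (x ord0 i - y ord0 i)) * (1 + (x ord0 i - y ord0 i)).
  by apply: mulr_ge0; lra.
rewrite !expr2; lra.
Qed.

Lemma weightN x : weight (- x) = weight x.
Proof. by apply: eq_bigr => i _; rewrite mxE sqrrN. Qed.

Lemma measurable_oneD_sqrV :
  measurable_fun setT (fun t : R => (1 + t ^+ 2)^-1).
Proof.
apply: continuous_measurable_fun => t; apply: cvgV; first by rewrite gt_eqF// oneD_sqr_gt0.
by apply: cvgD; [exact: cvg_cst|exact: exprn_continuous].
Qed.

Lemma measurable_weight : measurable_fun setT weight.
Proof.
apply: (@measurable_prod _ _ _ _ _ _ (fun i (x : 'rV_n) => (1 + x ord0 i ^+ 2)^-1)) => i _.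
by apply: (measurableT_comp measurable_oneD_sqrV); exact: measurable_coor.
Qed.

Lemma integral_oneD_sqrV_lty :
  (\int[@lebesgue_measure R]_t ((1 + t ^+ 2)^-1)%:E < +oo)%E.
Proof.
have m1 : measurable_fun setT (fun t : R => ((1 + t ^+ 2)^-1)%:E).
  by apply/measurable_EFinP; exact: measurable_oneD_sqrV.
rewrite -(setUv `]-oo, 0]%classic) ge0_integral_setU//; first last.
- exact/disj_setPCl.
- by move=> x _; rewrite lee_fin oneD_sqrV_ge0.
- by rewrite setUv.
- exact: measurableC.
rewrite setCitvl lte_add_pinfty//.
  rewrite (_ : integral _ _ _ =
      \int[lebesgue_measure]_(t in `[0%R, +oo[) ((1 + t ^+ 2)^-1)%:E)%E.
    by rewrite integral0y_oneDsqr ltry.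
  rewrite (@ge0_integration_by_substitution0 R (fun t => ((1 + t ^+ 2)^-1)%:E))//.
    by apply: eq_integral => t _; rewrite sqrrN.
  by move=> r; rewrite lee_fin oneD_sqrV_ge0.
apply: (@le_lt_trans _ _ (pi / 2)%:E); last exact: ltry.
rewrite -integral0y_oneDsqr; apply: ge0_subset_integral => //.
- exact: measurable_funTS.
- by move=> x _; rewrite lee_fin oneD_sqrV_ge0.
- by apply: subset_itvr; rewrite bnd_simp.
Qed.

Lemma integral_weight_lty : (\int[lebesgue_rV]_x (weight x)%:E < +oo)%E.
Proof.
rewrite (@ge0_integral_prod_rV R n (fun _ t => (1 + t ^+ 2)^-1)).
- have I0 : (0 <= \int[@lebesgue_measure R]_t ((1 + t ^+ 2)^-1)%:E)%E.
    by apply: integral_ge0 => t _; rewrite lee_fin oneD_sqrV_ge0.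
  rewrite -ge0_fin_numE ?prode_ge0//.
  elim/big_ind : _ => // [x y|i _]; first exact: fin_numM.
  by rewrite ge0_fin_numE// integral_oneD_sqrV_lty.
- by move=> _; exact: measurable_oneD_sqrV.
- by move=> i x; exact: oneD_sqrV_ge0.
Qed.

End weight.

Section boxes.
Context (R : realType) (n : nat).
Implicit Types (x y b : 'rV[R]_n).

Lemma measurable_box (A : 'I_n -> set (measurableTypeR R)) :
  (forall i, measurable (A i)) ->
  measurable [set x : 'rV[R]_n | forall i, A i (x ord0 i)].
Proof.
move=> mA; rewrite (_ : [set x : 'rV[R]_n | _] = \bigcap_(i in [set: 'I_n])
    (setT `&` (fun x : 'rV[R]_n => x ord0 i : measurableTypeR R) @^-1` A i)).
  apply: fin_bigcap_measurable => // i _; exact: measurable_coor.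
apply/seteqP; split => x /= h i; first by move=> _; split => //; exact: h.
by have [] := h i I.
Qed.

Lemma lebesgue_rV_box (A : 'I_n -> set (measurableTypeR R)) :
  (forall i, measurable (A i)) ->
  lebesgue_rV [set x : 'rV[R]_n | forall i, A i (x ord0 i)] =
  (\prod_(i < n) lebesgue_measure (A i))%E.
Proof.
move=> mA; pose B := [set x : 'rV[R]_n | forall i, A i (x ord0 i)].
transitivity (\int[lebesgue_rV]_x (\1_B x : R)%:E)%E.
  by rewrite integral_indic ?setIT//; exact: measurable_box.
transitivity (\int[lebesgue_rV]_x (\prod_(i < n) (\1_(A i) (x ord0 i) : R))%:E)%E.
  apply: eq_integral => /= x _; congr EFin; rewrite indicE.
  have [/set_mem /= xA|/negP xA] := boolP (x \in _).
    by rewrite big1// => i _; rewrite indicE mem_set.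
  have [i xAi] : exists i, ~ A i (x ord0 i).
    by apply/existsNP => h; apply: xA; rewrite inE.
  by rewrite (bigD1 i)//= indicE memNset// mul0r.
rewrite (@ge0_integral_prod_rV R n (fun i => \1_(A i))).
- by apply: eq_bigr => i _; rewrite integral_indic// setIT.
- by move=> i; apply: measurable_indic; exact: mA.
- by move=> i x; rewrite indicE.
Qed.

Lemma measurable_cube (k : 'rV[int]_n) :
  measurable [set x : 'rV[R]_n | floor_rV x = k].
Proof.
have := @measurable_floor_rV R n [set k] 1.
by under eq_set do rewrite scale1r.
Qed.

Lemma lebesgue_rV_cube (k : 'rV[int]_n) :
  lebesgue_rV [set x : 'rV[R]_n | floor_rV x = k] = 1%E.
Proof.
pose A (i : 'I_n) : set (measurableTypeR R) :=
  `[(k ord0 i)%:~R, (k ord0 i + 1)%:~R[%classic.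
rewrite (_ : [set x | _] = [set x : 'rV[R]_n | forall i, A i (x ord0 i)]).
  have mA i : measurable (A i) by exact: measurable_itv.
  rewrite (lebesgue_rV_box mA) big1// => i _.
  rewrite lebesgue_measure_itv/= lte_fin ltr_int ltzD1 lexx.
  by rewrite -EFinB -intrB addrAC subrr add0r.
apply/seteqP; split => x /=.
  by move=> xk i; rewrite /A/= -xk !mxE in_itv/=; exact: floor_itv.
move=> h; apply/rowP => i; rewrite mxE; apply: floor_def.
have : x ord0 i \in `[(k ord0 i)%:~R, (k ord0 i + 1)%:~R[ := h i.
by rewrite in_itv.
Qed.

(** The unit cube with corner [k] has measure 1 and its points are within distance 1 of [k] in each
    coordinate, so [weight_shift] bounds each term by an integral over the cube; the cubes are
    disjoint. Translation invariance makes the bound independent of [b], which later gives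
    uniformity in the dyadic scale. *)
Lemma sum_weight_le (s : seq 'rV[int]_n) b : uniq s ->
  (\sum_(k <- s) (weight (intv R k - b))%:E <=
   (3 ^+ n)%:E * \int[@lebesgue_rV R n]_x (weight x)%:E)%E.
Proof.
move=> us.
pose Q (k : 'rV[int]_n) := [set x : 'rV[R]_n | floor_rV x = k].
have mW : measurable_fun setT (fun x : 'rV[R]_n => (3 ^+ n * weight (x - b))%:E).
  apply/measurable_EFinP; apply: measurable_funM => //.
  have := measurable_affine_rV 1 (- b).
  under eq_fun do rewrite scale1r.
  exact: (measurableT_comp (@measurable_weight R n)).
have W0 x : (0 <= (3 ^+ n * weight (x - b))%:E)%E.
  by rewrite lee_fin mulr_ge0 ?weight_ge0// exprn_ge0.
apply: (@le_trans _ _ (\sum_(k <- s) \int[lebesgue_rV]_(x in Q k) (3 ^+ n * weight (x - b))%:E)%E).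
  apply: lee_sum => k _.
  rewrite -[leLHS]mule1 -(lebesgue_rV_cube k) -integral_cst//; last exact: measurable_cube.
  apply: ge0_le_integral => //.
  - exact: measurable_cube.
  - by move=> x _; rewrite lee_fin weight_ge0.
  - exact: measurable_funTS.
  - move=> x /= <-; rewrite lee_fin; apply: weight_shift => i.
    rewrite !mxE opprB addrA subrK.
    have /andP[] := floor_itv (x ord0 i); rewrite intrD => h1 h2.
    by rewrite ler_norml; apply/andP; split; lra.
rewrite -ge0_integral_bigsetU//; first last.
- exact: measurable_funTS.
- by move=> i j _ _ [x [/= <- <-]].
- by move=> k; exact: measurable_cube.
apply: (@le_trans _ _ (\int[lebesgue_rV]_x (3 ^+ n * weight (x - b))%:E)%E).
  apply: ge0_subset_integral => //.
  by apply: bigsetU_measurable => k _; exact: measurable_cube.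
under eq_integral do rewrite EFinM.
rewrite ge0_integralZl//; first last.
- by move=> x _; rewrite lee_fin weight_ge0.
- apply/measurable_EFinP.
  have := measurable_affine_rV 1 (- b).
  under eq_fun do rewrite scale1r.
  exact: (measurableT_comp (@measurable_weight R n)).
rewrite (@ge0_integral_shift_rV R n (- b) (fun x : 'rV[R]_n => (weight x)%:E))//.
- by apply/measurable_EFinP; exact: measurable_weight.
- by move=> x; rewrite lee_fin weight_ge0.
Qed.

Lemma esum_weight_le (a : 'rV[int]_n -> \bar R) (C : R) b : 0 <= C ->
  (forall k, a k <= (C * weight (intv R k - b))%:E)%E ->
  (\esum_(k in [set: 'rV[int]_n]) a k <=
   C%:E * ((3 ^+ n)%:E * \int[@lebesgue_rV R n]_x (weight x)%:E))%E.
Proof.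
move=> C0 aC; apply: ge_ereal_sup => _ [F [finF _] <-].
rewrite fsbig_finite//=.
have us : uniq (finmap.enum_fset (fset_set F)) by exact: finmap.fset_uniq.
move: (finmap.enum_fset _) us => s us.
have h : (\sum_(k <- s) a k <= \sum_(k <- s) C%:E * (weight (intv R k - b))%:E)%E.
  by apply: lee_sum => k _; rewrite -EFinM.
apply: (le_trans h); rewrite -ge0_sume_distrr; last first.
  by move=> k _; rewrite lee_fin weight_ge0.
by apply: lee_wpmul2l; rewrite ?lee_fin// sum_weight_le.
Qed.

End boxes.

(** * Complex numbers and complex-valued integrals *)

Section complex_norm.
Context {R : rcfType}.
Implicit Types z w : R[i].

Lemma normc_ge0 z : 0 <= Normc.normc z.
Proof. by case: z => a b; exact: sqrtr_ge0. Qed.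

Lemma abs_Re_le z : `|complex.Re z| <= Normc.normc z.
Proof.
by case: z => a b /=; rewrite -sqrtr_sqr ler_wsqrtr// lerDl sqr_ge0.
Qed.

Lemma abs_Im_le z : `|complex.Im z| <= Normc.normc z.
Proof.
by case: z => a b /=; rewrite -sqrtr_sqr ler_wsqrtr// lerDr sqr_ge0.
Qed.

Lemma normcR (r : R) : Normc.normc r%:C = `|r|.
Proof. by rewrite /= expr0n addr0 sqrtr_sqr. Qed.

Lemma normc_conj z : Normc.normc (conjc z) = Normc.normc z.
Proof. by case: z => a b /=; rewrite sqrrN. Qed.

Lemma normc_sum (I : Type) (s : seq I) (F : I -> R[i]) :
  Normc.normc (\sum_(i <- s) F i) <= \sum_(i <- s) Normc.normc (F i).
Proof.
elim: s => [|i s IH]; first by rewrite !big_nil Normc.normc0.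
by rewrite !big_cons (le_trans (le_normcD _ _))// lerD2l.
Qed.

Lemma mul_conj_normc z : z * conjc z = (Normc.normc z ^+ 2)%:C.
Proof.
case: z => a b /=; rewrite sqr_sqrtr ?addr_ge0 ?sqr_ge0//.
by simpc; congr (_ +i* _); ring.
Qed.

Lemma conjcM z w : conjc (z * w) = conjc z * conjc w.
Proof. exact: rmorphM. Qed.

Lemma ReM z w : complex.Re (z * w) =
  complex.Re z * complex.Re w - complex.Im z * complex.Im w.
Proof. by case: z w => [a b] [c d]. Qed.

Lemma ImM z w : complex.Im (z * w) =
  complex.Re z * complex.Im w + complex.Im z * complex.Re w.
Proof. by case: z w => [a b] [c d]. Qed.

Lemma ReD z w : complex.Re (z + w) = complex.Re z + complex.Re w.
Proof. by case: z w => [a b] [c d]. Qed.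

Lemma ImD z w : complex.Im (z + w) = complex.Im z + complex.Im w.
Proof. by case: z w => [a b] [c d]. Qed.

Lemma Re_conj z : complex.Re (conjc z) = complex.Re z. Proof. by case: z. Qed.

Lemma Im_conj z : complex.Im (conjc z) = - complex.Im z. Proof. by case: z. Qed.

Lemma complex_eq z w : complex.Re z = complex.Re w ->
  complex.Im z = complex.Im w -> z = w.
Proof. by case: z w => [a b] [c d] /= -> ->. Qed.

End complex_norm.

Section cmeas.
Context {R : realType} d (T : measurableType d).
Implicit Types f g : T -> R[i].

Definition cmeas f := measurable_fun setT (fun x => complex.Re (f x)) /\
  measurable_fun setT (fun x => complex.Im (f x)).

Lemma cmeas_cst (c : R[i]) : cmeas (fun=> c).
Proof. by split; exact: measurable_cst. Qed.

Lemma cmeas_real (f : T -> R) : measurable_fun setT f -> cmeas (fun x => (f x)%:C).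
Proof. by move=> mf; split => //=; exact: measurable_cst. Qed.

Lemma cmeasD f g : cmeas f -> cmeas g -> cmeas (fun x => f x + g x).
Proof.
move=> [f1 f2] [g1 g2]; split.
  by under eq_fun do rewrite ReD; exact: measurable_funD.
by under eq_fun do rewrite ImD; exact: measurable_funD.
Qed.

Lemma cmeasM f g : cmeas f -> cmeas g -> cmeas (fun x => f x * g x).
Proof.
move=> [f1 f2] [g1 g2]; split.
  by under eq_fun do rewrite ReM; apply: measurable_funB; exact: measurable_funM.
by under eq_fun do rewrite ImM; apply: measurable_funD; exact: measurable_funM.
Qed.

Lemma cmeas_conj f : cmeas f -> cmeas (fun x => conjc (f x)).
Proof.
move=> [f1 f2]; split; first by under eq_fun do rewrite Re_conj.
by under eq_fun do rewrite Im_conj; exact: measurable_funN.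
Qed.

Lemma cmeas_sum (I : Type) (s : seq I) (f : I -> T -> R[i]) :
  (forall i, cmeas (f i)) -> cmeas (fun x => \sum_(i <- s) f i x).
Proof.
move=> mf; elim: s => [|i s IH].
  by under eq_fun do rewrite big_nil; exact: cmeas_cst.
by under eq_fun do rewrite big_cons; exact: cmeasD.
Qed.

Lemma measurable_normc f : cmeas f ->
  measurable_fun setT (fun x => Normc.normc (f x)).
Proof.
move=> [f1 f2]; rewrite (_ : (fun _ => _) =
    (fun x => (complex.Re (f x) ^+ 2 + complex.Im (f x) ^+ 2) `^ 2^-1)).
  apply: (measurableT_comp (measurable_powR 2^-1)).
  by apply: measurable_funD; exact: measurable_funX.
apply/funext => x; case: (f x) => a b /=.
by rewrite powR12_sqrt// addr_ge0// sqr_ge0.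
Qed.

Lemma measurable_enormc f : cmeas f ->
  measurable_fun setT (fun x => (Normc.normc (f x))%:E).
Proof. by move=> mf; apply/measurable_EFinP; exact: measurable_normc. Qed.

End cmeas.

Lemma cmeas_comp (R : realType) d d' (T : measurableType d)
    (T' : measurableType d') (f : T' -> R[i]) (h : T -> T') :
  cmeas f -> measurable_fun setT h -> cmeas (fun x => f (h x)).
Proof.
by move=> [f1 f2] mh; split;
  [exact: (measurableT_comp f1)|exact: (measurableT_comp f2)].
Qed.

Section cint.
Context {R : realType} d (T : measurableType d).
Variable mu : {measure set T -> \bar R}.
Implicit Types f g : T -> R[i].

Definition cint f : R[i] :=
  (\int[mu]_x complex.Re (f x)) +i* (\int[mu]_x complex.Im (f x)).

Definition cintegrable f :=
  cmeas f /\ (\int[mu]_x (Normc.normc (f x))%:E < +oo)%E.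

Lemma cintegrable_dom f (g : T -> \bar R) : cmeas f -> measurable_fun setT g ->
  (forall x, ((Normc.normc (f x))%:E <= g x)%E) ->
  (\int[mu]_x g x < +oo)%E -> cintegrable f.
Proof.
move=> mf mg fg gfin; split => //; apply: le_lt_trans gfin.
apply: ge0_le_integral => //.
- by move=> x _; rewrite lee_fin normc_ge0.
- exact: measurable_enormc.
Qed.

Lemma integrable_Re f : cintegrable f ->
  mu.-integrable setT (EFin \o (fun x => complex.Re (f x))).
Proof.
move=> [[f1 f2] fi]; apply/integrableP; split; first exact/measurable_EFinP.
apply: le_lt_trans fi; apply: ge0_le_integral => //.
- by apply: measurableT_comp => //; exact/measurable_EFinP.
- exact: measurable_enormc.
- by move=> x _; rewrite lee_fin abs_Re_le.
Qed.

Lemma integrable_Im f : cintegrable f ->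
  mu.-integrable setT (EFin \o (fun x => complex.Im (f x))).
Proof.
move=> [[f1 f2] fi]; apply/integrableP; split; first exact/measurable_EFinP.
apply: le_lt_trans fi; apply: ge0_le_integral => //.
- by apply: measurableT_comp => //; exact/measurable_EFinP.
- exact: measurable_enormc.
- by move=> x _; rewrite lee_fin abs_Im_le.
Qed.

Lemma integrable_normc f : cintegrable f ->
  mu.-integrable setT (EFin \o (fun x => Normc.normc (f x))).
Proof.
move=> [mf fi]; apply/integrableP; split; first exact: measurable_enormc.
apply: le_lt_trans fi; apply: ge0_le_integral => //.
- by apply: measurableT_comp => //; exact: measurable_enormc.
- exact: measurable_enormc.
- by move=> x _; rewrite lee_fin ger0_norm// normc_ge0.
Qed.

Lemma cintegrableD f g : cintegrable f -> cintegrable g ->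
  cintegrable (fun x => f x + g x).
Proof.
move=> [mf fi] [mg gi].
have h : measurable_fun setT
    (fun x => (Normc.normc (f x))%:E + (Normc.normc (g x))%:E)%E.
  by apply: emeasurable_funD; exact: measurable_enormc.
apply: (cintegrable_dom _ h) => //; first exact: cmeasD.
  by move=> x; rewrite -EFinD lee_fin le_normcD.
rewrite ge0_integralD//; first exact: lte_add_pinfty.
- by move=> x _; rewrite lee_fin normc_ge0.
- exact: measurable_enormc.
- by move=> x _; rewrite lee_fin normc_ge0.
- exact: measurable_enormc.
Qed.

Lemma cintegrableMbound (K : R) f g : cmeas g -> (forall x, Normc.normc (g x) <= K) ->
  cintegrable f -> cintegrable (fun x => g x * f x).
Proof.
move=> mg gK [mf fi].
have h : measurable_fun setT (fun x => K%:E * (Normc.normc (f x))%:E)%E.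
  by apply: emeasurable_funM => //; exact: measurable_enormc.
have K0 : 0 <= K by apply: le_trans (gK point); exact: normc_ge0.
apply: (cintegrable_dom _ h) => //; first exact: cmeasM.
  by move=> x; rewrite -EFinM lee_fin Normc.normcM ler_wpM2r// normc_ge0.
rewrite ge0_integralZl//.
- by rewrite lte_mul_pinfty.
- exact: measurable_enormc.
- by move=> x _; rewrite lee_fin normc_ge0.
Qed.

Lemma cintegrableZ (c : R[i]) f : cintegrable f -> cintegrable (fun x => c * f x).
Proof. by apply: (@cintegrableMbound (Normc.normc c)) => //; exact: cmeas_cst. Qed.

Lemma cintegrable0 : cintegrable (fun=> 0).
Proof.
split; first exact: cmeas_cst.
by rewrite Normc.normc0 integral0.
Qed.

Lemma cintegrable_sum (I : Type) (s : seq I) (f : I -> T -> R[i]) :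
  (forall i, cintegrable (f i)) -> cintegrable (fun x => \sum_(i <- s) f i x).
Proof.
move=> mf; elim: s => [|i s IH].
  by under eq_fun do rewrite big_nil; exact: cintegrable0.
by under eq_fun do rewrite big_cons; exact: cintegrableD.
Qed.

Lemma eq_cint f g : f =1 g -> cint f = cint g.
Proof. by move=> fg; rewrite /cint; congr (_ +i* _); apply: eq_Rintegral => x _; rewrite fg. Qed.

Lemma cintD f g : cintegrable f -> cintegrable g ->
  cint (fun x => f x + g x) = cint f + cint g.
Proof.
move=> fi gi; rewrite /cint.
under [X in X +i* _]eq_Rintegral do rewrite ReD.
under [X in _ +i* X]eq_Rintegral do rewrite ImD.
rewrite RintegralD//; [|exact: integrable_Re..].
by rewrite RintegralD//; exact: integrable_Im.
Qed.

Lemma cintZ (c : R[i]) f : cintegrable f -> cint (fun x => c * f x) = c * cint f.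
Proof.
move=> fi; case: c => a b; rewrite /cint.
have iRe := integrable_Re fi; have iIm := integrable_Im fi.
have iZ r h : mu.-integrable setT (EFin \o h) ->
    mu.-integrable setT (EFin \o (fun x : T => r * h x)).
  by move=> hi; exact: (@integrableZl _ _ _ mu setT measurableT r (EFin \o h)).
under [X in X +i* _]eq_Rintegral do rewrite ReM /=.
under [X in _ +i* X]eq_Rintegral do rewrite ImM /=.
rewrite RintegralB//; [|exact: iZ..].
rewrite RintegralD//; [|exact: iZ..].
by rewrite !RintegralZl.
Qed.

Lemma cint0 : cint (fun=> 0) = 0.
Proof. by rewrite /cint /= !Rintegral_cst//= !mul0r. Qed.

Lemma cint_sum (I : Type) (s : seq I) (f : I -> T -> R[i]) :
  (forall i, cintegrable (f i)) ->
  cint (fun x => \sum_(i <- s) f i x) = \sum_(i <- s) cint (f i).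
Proof.
move=> fi; elim: s => [|i s IH].
  by under eq_cint do rewrite big_nil; rewrite cint0 big_nil.
under eq_cint do rewrite big_cons.
by rewrite cintD ?IH ?big_cons//; exact: cintegrable_sum.
Qed.

Lemma cint_conj f : cintegrable f -> cint (fun x => conjc (f x)) = conjc (cint f).
Proof.
move=> fi; rewrite /cint /=.
under [X in X +i* _]eq_Rintegral do rewrite Re_conj.
under [X in _ +i* X]eq_Rintegral do rewrite Im_conj -mulN1r.
by rewrite RintegralZl ?mulN1r//; exact: integrable_Im.
Qed.

Lemma cint_real (f : T -> R) : cint (fun x => (f x)%:C) = (\int[mu]_x f x)%:C.
Proof. by rewrite /cint/= Rintegral_cst//= mul0r. Qed.

(** Multiplying [f] by the conjugate of its integral makes the integral equal to the real number
    $|\int f|^2$, to which monotonicity of the real integral applies. *)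
Lemma normc_cint_le f : cintegrable f ->
  ((Normc.normc (cint f))%:E <= \int[mu]_x (Normc.normc (f x))%:E)%E.
Proof.
move=> fi; have [z0|z0] := eqVneq (Normc.normc (cint f)) 0.
  by rewrite z0 integral_ge0// => x _; rewrite lee_fin normc_ge0.
have N0 : 0 < Normc.normc (cint f) by rewrite lt_def z0 normc_ge0.
have fin : (\int[mu]_x (Normc.normc (f x))%:E)%E \is a fin_num.
  rewrite ge0_fin_numE; first by case: fi.
  by apply: integral_ge0 => x _; rewrite lee_fin normc_ge0.
rewrite -(fineK fin) lee_fin -/(Rintegral _ _ _).
rewrite -(ler_pM2l N0).
have -> : Normc.normc (cint f) * Normc.normc (cint f) =
    complex.Re (cint (fun x => conjc (cint f) * f x)).
  by rewrite cintZ// [X in complex.Re X]mulrC mul_conj_normc expr2.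
rewrite /cint/= -/(cint f) -RintegralZl//; last exact: integrable_normc.
apply: le_Rintegral => //.
- by apply: integrable_Re; exact: cintegrableZ.
- exact: (@integrableZl _ _ _ mu setT measurableT _ _ (integrable_normc fi)).
- move=> x _; apply: (le_trans (ler_norm _)).
  apply: (le_trans (abs_Re_le (conjc (cint f) * f x))).
  by rewrite Normc.normcM normc_conj.
Qed.

End cint.

Section cfubini.
Context {R : realType} d1 d2 (T1 : measurableType d1) (T2 : measurableType d2).
Variable m1 : {sigma_finite_measure set T1 -> \bar R}.
Variable m2 : {sigma_finite_measure set T2 -> \bar R}.
Variable f : T1 * T2 -> R[i].

Lemma cfubini : cintegrable (m1 \x m2)%E f ->
  (forall x, cintegrable m2 (fun y => f (x, y))) ->
  (forall y, cintegrable m1 (fun x => f (x, y))) ->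
  cint m1 (fun x => cint m2 (fun y => f (x, y))) =
  cint m2 (fun y => cint m1 (fun x => f (x, y))).
Proof.
move=> fi f1 f2; rewrite /cint /=.
have fubR (g : T1 * T2 -> R) : (m1 \x m2)%E.-integrable setT (EFin \o g) ->
   (forall x, m2.-integrable setT (fun y => (g (x, y))%:E)) ->
   (forall y, m1.-integrable setT (fun x => (g (x, y))%:E)) ->
   \int[m1]_x (\int[m2]_y g (x, y)) = \int[m2]_y (\int[m1]_x g (x, y)).
  move=> gi g1 g2; rewrite /Rintegral; congr fine.
  under eq_integral do rewrite fineK ?integrable_fin_num//.
  under [RHS]eq_integral do rewrite fineK ?integrable_fin_num//.
  exact: (Fubini gi).
congr (_ +i* _).
- apply: (fubR (fun z => complex.Re (f z))); first exact: integrable_Re.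
  + by move=> x; exact: integrable_Re (f1 x).
  + by move=> y; exact: integrable_Re (f2 y).
- apply: (fubR (fun z => complex.Im (f z))); first exact: integrable_Im.
  + by move=> x; exact: integrable_Im (f1 x).
  + by move=> y; exact: integrable_Im (f2 y).
Qed.

Lemma cmeas_cint : cintegrable (m1 \x m2)%E f -> cmeas (fun x => cint m2 (fun y => f (x, y))).
Proof.
move=> fi; split => /=; apply: (measurableT_comp (@fine_measurable R setT measurableT)).
- exact: (measurable_fubini_F (integrable_Re fi)).
- exact: (measurable_fubini_F (integrable_Im fi)).
Qed.

End cfubini.

Lemma cintegralE (R : realType) n (f : 'rV[R]_n -> R[i]) :
  cintegral f = cint lebesgue_rV f.
Proof. by []. Qed.

(** * Partial derivatives and Schwartz functions *)

Section partial_derivatives.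
Context (R : realType) (n : nat).
Implicit Types (x y xi b v : 'rV[R]_n) (f g : 'rV[R]_n -> R[i]).

Definition cdiff f := forall x,
  differentiable (fun y => complex.Re (f y)) x /\
  differentiable (fun y => complex.Im (f y)) x.

Lemma cdiff_cst (c : R[i]) : cdiff (fun=> c).
Proof. by split; exact: differentiable_cst. Qed.

Lemma pderiv_cst i (c : R[i]) : pderiv i (fun=> c) = (fun=> 0) :> ('rV[R]_n -> R[i]).
Proof. by apply/funext => x; rewrite /pderiv !derive_cst. Qed.

Lemma cdiffD f g : cdiff f -> cdiff g -> cdiff (fun x => f x + g x).
Proof.
move=> df dg x; have [f1 f2] := df x; have [g1 g2] := dg x; split.
  by under eq_fun do rewrite ReD; exact: differentiableD.
by under eq_fun do rewrite ImD; exact: differentiableD.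
Qed.

Lemma pderivD i f g : cdiff f -> cdiff g ->
  pderiv i (fun x => f x + g x) = (fun x => pderiv i f x + pderiv i g x).
Proof.
move=> df dg; apply/funext => x; have [f1 f2] := df x; have [g1 g2] := dg x.
rewrite /pderiv; apply: complex_eq; rewrite ?ReD ?ImD /=.
  by under eq_fun do rewrite ReD; rewrite deriveD//; exact: diff_derivable.
by under eq_fun do rewrite ImD; rewrite deriveD//; exact: diff_derivable.
Qed.

Lemma cdiffM f g : cdiff f -> cdiff g -> cdiff (fun x => f x * g x).
Proof.
move=> df dg x; have [f1 f2] := df x; have [g1 g2] := dg x; split.
  under eq_fun do rewrite ReM.
  by apply: differentiableB; exact: differentiableM.
under eq_fun do rewrite ImM.
by apply: differentiableD; exact: differentiableM.
Qed.

Lemma pderivM i f g : cdiff f -> cdiff g ->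
  pderiv i (fun x => f x * g x) = (fun x => pderiv i f x * g x + f x * pderiv i g x).
Proof.
move=> df dg; apply/funext => x; have [f1 f2] := df x; have [g1 g2] := dg x.
move: f1 f2 g1 g2 => /diff_derivable f1 /diff_derivable f2.
move=> /diff_derivable g1 /diff_derivable g2.
have d (u v : 'rV[R]_n -> R) w : derivable u x w -> derivable v x w ->
    derivable (fun y => u y * v y) x w by exact: derivableM.
have e (u v : 'rV[R]_n -> R) w : derivable u x w -> derivable v x w ->
    'D_w (fun y => u y * v y) x = u x * 'D_w v x + v x * 'D_w u x.
  by move=> du dv; rewrite (deriveM du dv).
rewrite /pderiv; apply: complex_eq; rewrite ?ReD ?ImD ?ReM ?ImM /=.
  under eq_fun do rewrite ReM.
  rewrite deriveB; [|exact: d..].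
  by rewrite !e//; ring.
under eq_fun do rewrite ImM.
rewrite deriveD; [|exact: d..].
by rewrite !e//; ring.
Qed.

Lemma cdiff_conj f : cdiff f -> cdiff (fun x => conjc (f x)).
Proof.
move=> df x; have [f1 f2] := df x; split.
  by under eq_fun do rewrite Re_conj.
by under eq_fun do rewrite Im_conj; exact: differentiableN.
Qed.

Lemma pderiv_conj i f : cdiff f ->
  pderiv i (fun x => conjc (f x)) = (fun x => conjc (pderiv i f x)).
Proof.
move=> df; apply/funext => x; have [f1 f2] := df x.
rewrite /pderiv /=; congr (_ +i* _).
  by under eq_fun do rewrite Re_conj.
by under eq_fun do rewrite Im_conj; rewrite deriveN//; exact: diff_derivable.
Qed.

Lemma is_diff_affine (c : R) b x :
  is_diff x (fun y : 'rV[R]_n => c *: y + b) (fun v => c *: v).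
Proof.
have -> : (fun v : 'rV[R]_n => c *: v) = (c *: id) \+ (fun=> 0).
  by apply/funext => v; rewrite /= addr0.
exact: is_diffD.
Qed.

Lemma differentiable_affine (g : 'rV[R]_n -> R) (c : R) b x :
  differentiable g (c *: x + b) -> differentiable (fun y => g (c *: y + b)) x.
Proof.
move=> dg; apply: (differentiable_comp (f := fun y : 'rV[R]_n => c *: y + b)) => //.
Qed.

Lemma derive_affine (g : 'rV[R]_n -> R) (c : R) b x v :
  differentiable g (c *: x + b) ->
  'D_v (fun y => g (c *: y + b)) x = c * 'D_v g (c *: x + b).
Proof.
move=> dg; rewrite deriveE; last exact: differentiable_affine.
have [da dE] := is_diff_affine c b x.
rewrite (diff_comp (f := fun y : 'rV[R]_n => c *: y + b))//=.
by rewrite dE linearZ/= deriveE.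
Qed.

Lemma cdiff_affine f (c : R) b : cdiff f -> cdiff (fun x => f (c *: x + b)).
Proof.
move=> df x; have [f1 f2] := df (c *: x + b).
by split; [exact: (differentiable_affine f1)|exact: (differentiable_affine f2)].
Qed.

Lemma pderiv_affine i f (c : R) b : cdiff f ->
  pderiv i (fun x => f (c *: x + b)) = (fun x => c%:C * pderiv i f (c *: x + b)).
Proof.
move=> df; apply/funext => x; have [f1 f2] := df (c *: x + b).
apply: complex_eq; rewrite ?ReM ?ImM /= mul0r ?subr0 ?addr0.
  exact: (derive_affine _ f1).
exact: (derive_affine _ f2).
Qed.

Lemma dotv_is_scalar xi : scalar (dotv xi).
Proof.
move=> a y z; rewrite /dotv mulr_sumr -big_split/=.
by apply: eq_bigr => i _; rewrite !mxE; ring.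
Qed.

HB.instance Definition _ xi :=
  GRing.isLinear.Build R 'rV[R]_n R _ (dotv xi) (dotv_is_scalar xi).

Lemma continuous_dotv xi : continuous (dotv xi).
Proof.
apply: continuous_big => [|i _ x].
  exact: add_continuous.
apply: (@continuous_comp _ _ _ (fun y : 'rV[R]_n => y ord0 i) ( *%R (xi ord0 i))).
  exact: coord_continuous.
exact: mulrl_continuous.
Qed.

Lemma is_diff_dotv xi x : is_diff x (dotv xi) (dotv xi).
Proof.
apply: DiffDef; first exact/linear_differentiable/continuous_dotv.
exact/diff_lin/continuous_dotv.
Qed.

Lemma differentiable_dotv xi x (h : R -> R) :
  derivable h (dotv xi x) 1 -> differentiable (fun y => h (dotv xi y)) x.
Proof.
move=> /derivable1_diffP dh; apply: (differentiable_comp (f := dotv xi)) => //.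
by have [] := is_diff_dotv xi x.
Qed.

Lemma derive_dotv xi x (h : R -> R) i dh :
  is_derive (dotv xi x) 1 h dh ->
  'D_(delta_mx ord0 i) (fun y => h (dotv xi y)) x = xi ord0 i * dh.
Proof.
move=> [h1 h2].
rewrite deriveE; last exact: differentiable_dotv.
have [da dE] := is_diff_dotv xi x.
have /derivable1_diffP dh1 := h1.
rewrite (diff_comp (f := dotv xi))//= dE.
rewrite deriv1E//= derive1E h2 /= /dotv (bigD1 i)//= big1 => [|j ji].
  by rewrite addr0 mxE !eqxx mulr1.
by rewrite mxE (negbTE ji) andbF mulr0.
Qed.

Lemma cdiff_expi xi : cdiff (fun x => expi (dotv xi x)).
Proof.
move=> x; split; apply: differentiable_dotv; last exact: ex_derive.
exact: derivable_cos.
Qed.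

Lemma pderiv_expi i xi : pderiv i (fun x => expi (dotv xi x)) =
  (fun x => (0 +i* xi ord0 i) * expi (dotv xi x)).
Proof.
apply/funext => x; rewrite /pderiv /=.
rewrite (derive_dotv _ (is_derive_cos _)) (derive_dotv _ (is_derive_sin _)).
by apply: complex_eq; rewrite ?ReM ?ImM /=; ring.
Qed.

End partial_derivatives.

(** * Stability of the Schwartz class *)

Section schwartz_closure.
Context (R : realType) (n : nat).
Implicit Types (x y xi b : 'rV[R]_n) (f g h : 'rV[R]_n -> R[i]).

Definition decays h := forall N, exists C : R, forall x,
  (1 + enorm x) ^+ N * Normc.normc (h x) <= C.

Lemma oneD_enorm_ge1 x : 1 <= 1 + enorm x.
Proof. by rewrite lerDl enorm_ge0. Qed.

(** One index [N] bounds both the power of $1+|x|$ and the number of derivatives. The two are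
    separated by taking a maximum in one direction, and by summing constants over the finitely many
    lists of at most [N] directions in the other. *)
Lemma schwartzP f : schwartz f <-> smooth f /\ forall s, decays (pderivs s f).
Proof.
split=> -[sf df]; split => //.
  move=> s N.
  pose K := maxn N (size s); have Kfin := df K.
  have le_semi x : (((1 + enorm x) ^+ K * Normc.normc (pderivs s f x))%:E <=
      schwartz_seminorm K f)%E.
    by apply: ereal_sup_ubound; exists s, x; rewrite leq_maxr.
  have fin : schwartz_seminorm K f \is a fin_num.
    by rewrite fin_numElt Kfin andbT (lt_le_trans _ (le_semi 0))// ltNyr.
  exists (fine (schwartz_seminorm K f)) => x.
  rewrite -lee_fin fineK//; apply: le_trans (le_semi x); rewrite lee_fin.
  by rewrite ler_wpM2r ?normc_ge0// ler_weXn2l ?oneD_enorm_ge1// leq_maxl.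
move=> N; have [C CP] := choice (fun s => df s N).
pose D := \sum_(k < N.+1) \sum_(t : k.-tuple 'I_n) `|C t|.
apply: (@le_lt_trans _ _ D%:E); last exact: ltry.
apply: ge_ereal_sup => _ [s [x [sN ->]]]; rewrite lee_fin.
apply: (le_trans (CP s x)); apply: (le_trans (ler_norm _)).
rewrite /D (bigD1 (Ordinal (sN : (size s < N.+1)%N)))//= (bigD1 (in_tuple s))//=.
by rewrite -addrA lerDl addr_ge0 ?sumr_ge0// => k _; rewrite sumr_ge0.
Qed.

Lemma stable_pderivs (P : ('rV[R]_n -> R[i]) -> Prop) f :
  (forall h, P h -> cdiff h /\ forall i, P (pderiv i h)) -> P f ->
  smooth f /\ forall s, P (pderivs s f).
Proof.
move=> Pst Pf; have Ps s : P (pderivs s f).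
  by elim: s => [//|i s /Pst[_]]; exact.
by split => // s; have [] := Pst _ (Ps s).
Qed.

(** A coinductive criterion: it suffices to place [f] in some class of decaying differentiable
    functions that is stable under each $\partial_i$. Each closure property below chooses a class in
    which one derivation is easy to compute. *)
Lemma stable_schwartz (P : ('rV[R]_n -> R[i]) -> Prop) f :
  (forall h, P h -> [/\ cdiff h, decays h & forall i, P (pderiv i h)]) -> P f ->
  schwartz f.
Proof.
move=> Pst Pf; have Pst' h : P h -> cdiff h /\ forall i, P (pderiv i h).
  by case/Pst.
have [sf Psf] := stable_pderivs Pst' Pf.
by apply/schwartzP; split => // s; have [] := Pst _ (Psf s).
Qed.

Lemma smooth_pderivs f s : smooth f -> cdiff (pderivs s f).
Proof. by move=> sf x; exact: sf. Qed.

Lemma schwartz_cdiff f : schwartz f -> cdiff f.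
Proof. by move=> [sf _]; exact: (@smooth_pderivs f [::]). Qed.

Lemma schwartz_decays f s : schwartz f -> decays (pderivs s f).
Proof. by move/schwartzP => []. Qed.

Lemma schwartz_smooth f : schwartz f -> smooth f.
Proof. by case. Qed.

Lemma decaysD f g : decays f -> decays g -> decays (fun x => f x + g x).
Proof.
move=> df dg N; have [C CP] := df N; have [D DP] := dg N.
exists (C + D) => x; apply: le_trans (lerD (CP x) (DP x)).
rewrite -mulrDr ler_wpM2l ?le_normcD// exprn_ge0//.
by rewrite (le_trans ler01)// oneD_enorm_ge1.
Qed.

Lemma schwartz_pderivs f s : schwartz f -> schwartz (pderivs s f).
Proof.
move=> sf; apply: (@stable_schwartz (fun h => exists s, h = pderivs s f)); last by exists s.
move=> _ [t ->]; split; [exact/smooth_pderivs/schwartz_smooth|exact: schwartz_decays|].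
by move=> i; exists (i :: t).
Qed.

Lemma schwartz_pderiv f i : schwartz f -> schwartz (pderiv i f).
Proof. exact: (@schwartz_pderivs f [:: i]). Qed.

Lemma schwartz0 : schwartz (fun _ : 'rV[R]_n => 0 : R[i]).
Proof.
apply: (@stable_schwartz (eq^~ (fun=> 0))) => // h ->; split.
- exact: cdiff_cst.
- by move=> N; exists 0 => x; rewrite Normc.normc0 mulr0.
- by move=> i; rewrite pderiv_cst.
Qed.

Lemma schwartzD f g : schwartz f -> schwartz g -> schwartz (fun x => f x + g x).
Proof.
move=> sf sg; apply: (@stable_schwartz (fun h => exists s,
  h = fun x => pderivs s f x + pderivs s g x)); last by exists [::].
move=> _ [s ->]; have ds := smooth_pderivs s (schwartz_smooth sf).
have dg := smooth_pderivs s (schwartz_smooth sg); split.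
- exact: cdiffD.
- by apply: decaysD; exact: schwartz_decays.
- by move=> i; exists (i :: s); rewrite pderivD.
Qed.

Lemma schwartz_sum (I : Type) (s : seq I) (F : I -> 'rV[R]_n -> R[i]) :
  (forall i, schwartz (F i)) -> schwartz (fun x => \sum_(i <- s) F i x).
Proof.
move=> sF; elim: s => [|i s IH].
  by under eq_fun do rewrite big_nil; exact: schwartz0.
by under eq_fun do rewrite big_cons; exact: schwartzD.
Qed.

Lemma schwartz_conj f : schwartz f -> schwartz (fun x => conjc (f x)).
Proof.
move=> sf; apply: (@stable_schwartz (fun h => exists s,
  h = fun x => conjc (pderivs s f x))); last by exists [::].
move=> _ [s ->]; have ds := smooth_pderivs s (schwartz_smooth sf); split.
- exact: cdiff_conj.
- move=> N; have [C CP] := schwartz_decays s sf N.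
  by exists C => x; rewrite normc_conj.
- by move=> i; exists (i :: s); rewrite pderiv_conj.
Qed.

Lemma dotv_le x y : dotv x y <= enorm x * enorm y.
Proof.
have z u v : enorm u = 0 -> dotv u v = 0.
  move=> u0; apply: big1 => i _; suff -> : u ord0 i = 0 by rewrite mul0r.
  by apply/eqP; rewrite -normr_le0 -u0 coord_le_enorm.
have [x0|x0] := eqVneq (enorm x) 0; first by rewrite z// x0 mul0r.
have [y0|y0] := eqVneq (enorm y) 0.
  by rewrite /dotv; under eq_bigr do rewrite mulrC; rewrite -/(dotv y x) z// y0 mulr0.
have xy0 : 0 < enorm x * enorm y by rewrite mulr_gt0// lt_def ?x0 ?y0 enorm_ge0.
have := dotvv_ge0 (enorm y *: x - enorm x *: y).
have -> : dotv (enorm y *: x - enorm x *: y) (enorm y *: x - enorm x *: y) =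
    enorm y ^+ 2 * dotv x x - (enorm x * enorm y) * dotv x y *+ 2 +
    enorm x ^+ 2 * dotv y y.
  rewrite /dotv !mulr_sumr -sumrMnl -sumrN -!big_split/=.
  by apply: eq_bigr => i _; rewrite !mxE; ring.
rewrite -!sqr_enorm => h; rewrite -subr_ge0 -(pmulr_rge0 _ xy0).
move: h; set a := enorm x; set c := enorm y; set d := dotv x y.
have -> : c ^+ 2 * a ^+ 2 - a * c * d *+ 2 + a ^+ 2 * c ^+ 2 =
  2 * (a * c * (a * c - d)) by ring.
by rewrite !pmulr_rge0.
Qed.

Lemma enormD x y : enorm (x + y) <= enorm x + enorm y.
Proof.
rewrite -(@ler_pXn2r _ 2)// ?nnegrE; [|exact: enorm_ge0|by rewrite addr_ge0// enorm_ge0].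
rewrite sqrrD !sqr_enorm.
have -> : dotv (x + y) (x + y) = dotv x x + dotv x y *+ 2 + dotv y y.
  rewrite /dotv -sumrMnl -!big_split/=.
  by apply: eq_bigr => i _; rewrite !mxE; ring.
by rewrite lerD2r lerD2l lerMn2r/= dotv_le.
Qed.

Lemma enormZ (c : R) x : enorm (c *: x) = `|c| * enorm x.
Proof.
rewrite /enorm -sqrtr_sqr -sqrtrM ?sqr_ge0//; congr Num.sqrt.
by rewrite /dotv mulr_sumr; apply: eq_bigr => i _; rewrite !mxE; ring.
Qed.

(** The point is $1+|x|\le K(1+|cx+b|)$, from $|x|\le |c|^{-1}(|cx+b|+|b|)$. *)
Lemma decays_affine f (c : R) b : c != 0 -> decays f ->
  decays (fun x => f (c *: x + b)).
Proof.
move=> c0 df N; have [C CP] := df N.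
pose K := 1 + `|c|^-1 + `|c|^-1 * enorm b.
have cp : 0 < `|c| by rewrite normr_gt0.
have i0 : 0 < `|c|^-1 by rewrite invr_gt0.
have bc0 := mulr_ge0 (ltW i0) (enorm_ge0 b).
have K0 : 0 <= K by rewrite /K; lra.
have hK x : 1 + enorm x <= K * (1 + enorm (c *: x + b)).
  have : enorm x <= `|c|^-1 * (enorm (c *: x + b) + enorm b).
    rewrite ler_pdivlMl// -enormZ -{1}(addrK b (c *: x)).
    by rewrite (le_trans (enormD _ _))// lerD2l -scaleN1r enormZ normrN normr1 mul1r.
  have E0 := enorm_ge0 (c *: x + b).
  have := mulr_ge0 bc0 E0; rewrite /K mulrDr; lra.
exists (K ^+ N * C) => x.
apply: (le_trans _ (ler_wpM2l (exprn_ge0 N K0) (CP (c *: x + b)))).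
have E1 y : 0 <= 1 + enorm y by rewrite addr_ge0// enorm_ge0.
rewrite mulrA -exprMn ler_wpM2r ?normc_ge0//.
by apply: lerXn2r; rewrite ?nnegrE// mulr_ge0.
Qed.

Lemma schwartz_affine f (c : R) b : c != 0 -> schwartz f ->
  schwartz (fun x => f (c *: x + b)).
Proof.
move=> c0 sf; apply: (@stable_schwartz (fun h => exists s (a : R[i]),
  h = fun x => a * pderivs s f (c *: x + b))); last first.
  by exists [::], 1; apply/funext => x; rewrite mul1r.
move=> _ [s [a ->]]; have ds := smooth_pderivs s (schwartz_smooth sf); split.
- apply: cdiffM; [exact: cdiff_cst|exact: cdiff_affine].
- move=> N; have [C CP] := decays_affine b c0 (schwartz_decays s sf) N.
  exists (Normc.normc a * C) => x; rewrite Normc.normcM mulrCA.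
  by rewrite ler_wpM2l ?normc_ge0.
- move=> i; exists (i :: s), (a * c%:C).
  rewrite (pderivM i (cdiff_cst a) (cdiff_affine c b ds)) pderiv_cst pderiv_affine//.
  by apply/funext => x; rewrite mul0r add0r mulrA.
Qed.

(** A class of multipliers of the Schwartz space that contains both the characters and the Schwartz
    functions. *)
Definition bsmooth f := smooth f /\ forall s, exists C : R, forall x,
  Normc.normc (pderivs s f x) <= C.

Lemma schwartz_bsmooth f : schwartz f -> bsmooth f.
Proof.
move=> sf; split; first exact: schwartz_smooth.
move=> s; have [C CP] := schwartz_decays s sf 0.
by exists C => x; have := CP x; rewrite expr0 mul1r.
Qed.

Lemma bsmooth_expi xi : bsmooth (fun x => expi (dotv xi x)).
Proof.
have [||s1 s2] := @stable_pderivs (fun h => exists a, h = fun x => a * expi (dotv xi x))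
   (fun x => expi (dotv xi x)); last first.
- split => // s; have [a ->] := s2 s; exists (Normc.normc a) => x.
  by rewrite Normc.normcM /= cos2Dsin2 sqrtr1 mulr1.
- by exists 1; apply/funext => x; rewrite mul1r.
- move=> _ [a ->]; split; first by apply: cdiffM; [exact: cdiff_cst|exact: cdiff_expi].
  move=> i; exists (a * (0 +i* xi ord0 i)).
  rewrite (pderivM i (cdiff_cst a) (cdiff_expi xi)) pderiv_cst pderiv_expi.
  by apply/funext => x; rewrite mul0r add0r mulrA.
Qed.

(** The class for [stable_schwartz] in the case of a product: the product rule stays inside sums of
    products of iterated derivatives. *)
Inductive prodspan f g : ('rV[R]_n -> R[i]) -> Prop :=
| prodspan_base s t : prodspan f g (fun x => pderivs s f x * pderivs t g x)
| prodspan_add u v : prodspan f g u -> prodspan f g v ->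
    prodspan f g (fun x => u x + v x).

Lemma schwartzM f g : bsmooth f -> schwartz g -> schwartz (fun x => f x * g x).
Proof.
move=> [sf bf] sg; apply: (@stable_schwartz (prodspan f g)); last first.
  exact: (prodspan_base f g [::] [::]).
have df s := smooth_pderivs s sf.
have dg s := smooth_pderivs s (schwartz_smooth sg).
move=> h0; elim=> {h0} [s t|u v _ [du cu Pu] _ [dv cv Pv]]; split.
- exact: cdiffM.
- move=> N; have [C CP] := bf s; have [D DP] := schwartz_decays t sg N.
  exists (C * D) => x; rewrite Normc.normcM mulrCA.
  apply: ler_pM => //; first exact: normc_ge0.
  by rewrite mulr_ge0 ?normc_ge0// exprn_ge0// addr_ge0// enorm_ge0.
- move=> i; rewrite pderivM//; apply: prodspan_add.
    exact: (prodspan_base f g (i :: s) t).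
  exact: (prodspan_base f g s (i :: t)).
- exact: cdiffD.
- exact: decaysD.
- by move=> i; rewrite pderivD//; exact: prodspan_add.
Qed.

Lemma schwartz_weight f : schwartz f ->
  exists2 C : R, 0 <= C & forall x, Normc.normc (f x) <= C * weight x.
Proof.
move=> sf; have [C CP] := @schwartz_decays f [::] sf n.*2.
have fC x : Normc.normc (f x) <= C * weight x.
  rewrite -ler_pdivrMr ?weight_gt0//; apply: le_trans (CP x).
  by rewrite mulrC ler_wpM2r ?normc_ge0// weightV_le.
exists C => //; have := fC 0.
by move=> /(le_trans (normc_ge0 _)); rewrite pmulr_lge0// weight_gt0.
Qed.

Lemma cdiff_cmeas f : cdiff f -> cmeas f.
Proof.
move=> df; split; apply: continuous_measurable_fun_rV => x;
  by apply: differentiable_continuous; have [] := df x.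
Qed.

Lemma schwartz_cmeas f : schwartz f -> cmeas f.
Proof. by move/schwartz_cdiff/cdiff_cmeas. Qed.

Lemma weight_cintegrable f (C : R) b : cmeas f ->
  (forall x, Normc.normc (f x) <= C * weight (x - b)) -> cintegrable lebesgue_rV f.
Proof.
move=> mf fC.
have mW : measurable_fun setT (fun x : 'rV[R]_n => weight (x - b)).
  have := measurable_affine_rV 1 (- b).
  under eq_fun do rewrite scale1r.
  exact: (measurableT_comp (@measurable_weight R n)).
apply: (@cintegrable_dom _ _ _ _ _ (fun x => C%:E * (weight (x - b))%:E)%E) => //.
  by apply: emeasurable_funM => //; exact/measurable_EFinP.
have C0 : 0 <= C.
  by have := fC 0; move=> /(le_trans (normc_ge0 _)); rewrite pmulr_lge0// weight_gt0.
rewrite ge0_integralZl//.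
- rewrite (@ge0_integral_shift_rV R n (- b) (fun x => (weight x)%:E)).
  + by rewrite lte_mul_pinfty// integral_weight_lty.
  + by apply/measurable_EFinP; exact: measurable_weight.
  + by move=> x; rewrite lee_fin weight_ge0.
- exact/measurable_EFinP.
- by move=> x _; rewrite lee_fin weight_ge0.
Qed.

Lemma schwartz_cintegrable f : schwartz f -> cintegrable lebesgue_rV f.
Proof.
move=> sf; have [C C0 fC] := schwartz_weight sf.
apply: (@weight_cintegrable _ C 0); first exact: schwartz_cmeas.
by move=> x; rewrite subr0.
Qed.

End schwartz_closure.

(** * Changes of variables, and integrals of derivatives *)

Section change_of_variables.
Context (R : realType) (n : nat).
Implicit Types (x b : 'rV[R]_n).

Lemma Rintegral_affine_rV (c : R) b (g : 'rV[R]_n -> R) : 0 < c ->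
  (@lebesgue_rV R n).-integrable setT (EFin \o g) ->
  c ^+ n * \int[lebesgue_rV]_x g (c *: x + b) = \int[lebesgue_rV]_x g x.
Proof.
move=> c0 ig; have mg : measurable_fun setT (EFin \o g) := measurable_int _ ig.
have ma := measurable_affine_rV c b.
have cn0 : 0 < c ^+ n by rewrite exprn_gt0.
pose A := (\int[lebesgue_rV]_x ((EFin \o g)^\+ (c *: x + b)%R))%E.
pose B := (\int[lebesgue_rV]_x ((EFin \o g)^\- (c *: x + b)%R))%E.
have EA : ((c ^+ n)%:E * A = \int[lebesgue_rV]_x ((EFin \o g)^\+ x))%E.
  by apply: ge0_integral_affine_rV => //; exact: measurable_funepos.
have EB : ((c ^+ n)%:E * B = \int[lebesgue_rV]_x ((EFin \o g)^\- x))%E.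
  by apply: ge0_integral_affine_rV => //; exact: measurable_funeneg.
have fin X Y : ((c ^+ n)%:E * X = Y -> Y < +oo -> 0 <= X -> X \is a fin_num)%E.
  move=> XY Yoo X0; rewrite ge0_fin_numE//.
  have -> : X = ((c ^+ n)^-1%:E * Y)%E.
    by rewrite -XY muleA -EFinM mulVf ?mul1e// gt_eqF.
  by rewrite lte_mul_pinfty// ?lee_fin ?invr_ge0// ltW.
have finA : A \is a fin_num.
  by apply: (fin _ _ EA); [exact: integral_funepos_lt_pinfty|apply: integral_ge0].
have finB : B \is a fin_num.
  by apply: (fin _ _ EB); [exact: integral_funeneg_lt_pinfty|apply: integral_ge0].
rewrite /Rintegral integralE [in RHS]integralE -EA -EB.
transitivity (c ^+ n * fine (A - B)%E).
  congr (_ * fine (_ - _)%E); apply: eq_integral => x _.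
    by rewrite !funeposE.
  by rewrite !funenegE.
rewrite -(fineK finA) -(fineK finB) -!EFinM -!EFinB /=.
by rewrite mulrBr.
Qed.

Lemma cintegral_affine (c : R) b (f : 'rV[R]_n -> R[i]) : 0 < c ->
  cintegrable lebesgue_rV f ->
  (c ^+ n)%:C * cintegral (fun x => f (c *: x + b)) = cintegral f.
Proof.
move=> c0 fi; rewrite /cintegral.
rewrite -(Rintegral_affine_rV b c0 (integrable_Re fi)).
rewrite -(Rintegral_affine_rV b c0 (integrable_Im fi)).
by apply: complex_eq; rewrite ?ReM ?ImM /= mul0r ?subr0 ?addr0.
Qed.

Lemma cintegral_shift b (f : 'rV[R]_n -> R[i]) :
  cintegrable lebesgue_rV f ->
  cintegral (fun x => f (x + b)) = cintegral f.
Proof.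
move=> fi; rewrite -(cintegral_affine b ltr01 fi) expr1n mul1r.
by congr cintegral; apply/funext => x; rewrite scale1r.
Qed.

Lemma cmeas_shift b (f : 'rV[R]_n -> R[i]) : cmeas f -> cmeas (fun x => f (x + b)).
Proof.
move=> mf; have := measurable_affine_rV 1 b.
by under eq_fun do rewrite scale1r; exact: (cmeas_comp mf).
Qed.

Lemma cintegrable_shift b (f : 'rV[R]_n -> R[i]) :
  cintegrable lebesgue_rV f -> cintegrable lebesgue_rV (fun x => f (x + b)).
Proof.
move=> [mf fi]; split; first exact: cmeas_shift.
rewrite (@ge0_integral_shift_rV R n b (fun x => (Normc.normc (f x))%:E))//.
- exact: measurable_enormc.
- by move=> x; rewrite lee_fin normc_ge0.
Qed.

End change_of_variables.

Section integral_of_derivative.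
Context (R : realType) (n : nat).
Implicit Types (x b : 'rV[R]_n) (g : 'rV[R]_n -> R).

Lemma is_derive_line g x v (s : R) : (forall y, differentiable g y) ->
  is_derive s 1 (fun t : R => g (t *: v + x)) ('D_v g (s *: v + x)).
Proof.
move=> dg.
have [dl lE] : is_diff s (fun t : R => t *: v + x) (fun t => t *: v).
  have -> : (fun t : R => t *: v) = (fun t : R => t *: v) \+ (fun=> 0).
    by apply/funext => t; rewrite /= addr0.
  exact: is_diffD.
have dc : differentiable (fun t : R => g (t *: v + x)) s.
  by apply: (differentiable_comp (f := fun t : R => t *: v + x)).
apply: DeriveDef; first exact/derivable1_diffP.
rewrite deriveE//.
rewrite (diff_comp (f := fun t : R => t *: v + x))//=.
by rewrite lE scale1r deriveE.
Qed.

(** By the mean value theorem the quotient is a derivative at a point displaced by at most 1 along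
    one axis, where [weight] has changed by a factor at most $3^n$. This is the domination needed in
    [Rintegral_derive0]. *)
Lemma diff_quotient_le g (C t : R) i x : (forall y, differentiable g y) ->
  (forall y, `|'D_(delta_mx ord0 i) g y| <= C * weight y) -> 0 < t <= 1 ->
  `|t^-1 * (g (t *: delta_mx ord0 i + x) - g x)| <= C * 3 ^+ n * weight x.
Proof.
move=> dg gC /andP[t0 t1].
pose e : 'rV[R]_n := delta_mx ord0 i.
have C0 : 0 <= C.
  by have := gC 0; move=> /(le_trans (normr_ge0 _)); rewrite pmulr_lge0// weight_gt0.
have [|s] := @MVT_segment R (fun t : R => g (t *: e + x))
    (fun s => 'D_e g (s *: e + x)) 0 t (ltW t0) (fun s _ => is_derive_line x e s dg).
  apply: continuous_subspaceT => s.
  apply: differentiable_continuous; apply/derivable1_diffP.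
  by have [] := is_derive_line x e s dg.
rewrite in_itv/= => /andP[s0 st]; rewrite scale0r add0r subr0 => ->.
rewrite mulrCA mulVf ?gt_eqF// mulr1 (le_trans (gC _))// -mulrA ler_wpM2l//.
apply: weight_shift => j; rewrite !mxE addrK.
rewrite normrM ger0_norm//; have s1 := le_trans st t1.
by case: (_ && _); rewrite /= ?normr1 ?normr0 ?mulr0 ?mulr1.
Qed.

(** Translation invariance makes every difference quotient integrate to zero; dominated convergence
    with step $1/(m+1)$ carries this to the derivative. *)
Lemma Rintegral_derive0 g (C D : R) i : (forall y, differentiable g y) ->
  measurable_fun setT (fun y => 'D_(delta_mx ord0 i) g y) ->
  (forall y, `|g y| <= D * weight y) ->
  (forall y, `|'D_(delta_mx ord0 i) g y| <= C * weight y) ->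
  \int[lebesgue_rV]_x ('D_(delta_mx ord0 i) g x) = 0.
Proof.
move=> dg mD gD gC.
pose e : 'rV[R]_n := delta_mx ord0 i.
pose t (m : nat) : R := m.+1%:R^-1.
have t01 m : 0 < t m <= 1.
  by rewrite /t invr_gt0 ltr0n/= invf_le1 ?ltr0n// ler1n.
have mg : measurable_fun setT g.
  by apply: continuous_measurable_fun_rV => y; exact: differentiable_continuous.
have msh b (h : 'rV[R]_n -> R) : measurable_fun setT h -> measurable_fun setT (fun x => h (b + x)).
  move=> mh; have := measurable_affine_rV 1 b.
  by under eq_fun do rewrite scale1r addrC; exact: (measurableT_comp mh).
pose q (m : nat) (x : 'rV[R]_n) : \bar R := ((t m)^-1 * (g (t m *: e + x) - g x))%:E.
have mq m : measurable_fun setT (q m).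
  apply/measurable_EFinP; apply: measurable_funM => //.
  by apply: measurable_funB => //; exact: msh.
have iW (K : R) : (@lebesgue_rV R n).-integrable setT (fun x => (K * weight x)%:E).
  apply: (@integrableZl _ _ _ _ _ measurableT K (fun x => (weight x)%:E)).
  apply/integrableP; split; first by apply/measurable_EFinP; exact: measurable_weight.
  under eq_integral do rewrite gee0_abs ?lee_fin ?weight_ge0//.
  exact: integral_weight_lty.
have ig : (@lebesgue_rV R n).-integrable setT (EFin \o g).
  apply: (le_integrable measurableT _ _ (iW D)); first exact/measurable_EFinP.
  by move=> x _ /=; rewrite lee_fin (le_trans (gD x))// ler_norm.
have igs b : (@lebesgue_rV R n).-integrable setT (fun x => (g (b + x))%:E).
  apply/integrableP; split; first by apply/measurable_EFinP; exact: msh.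
  have /integrableP[_] := ig.
  rewrite -(@ge0_integral_shift_rV R n b (fun x => `|(EFin \o g) x|%E))//; last first.
    by apply: measurableT_comp => //; exact/measurable_EFinP.
  by under eq_integral do rewrite addrC.
have q0 m : (\int[lebesgue_rV]_x q m x = 0)%E.
  rewrite /q; under eq_integral do rewrite EFinM EFinB.
  rewrite integralZl//; last by apply: integrableB => //; exact: igs.
  rewrite (integralB measurableT (igs (t m *: e)) ig).
  have fin := integrable_fin_num measurableT ig.
  have := Rintegral_affine_rV (t m *: e) ltr01 ig.
  rewrite expr1n mul1r; under eq_Rintegral do rewrite scale1r addrC.
  move=> E; rewrite -(fineK fin) -(fineK (integrable_fin_num measurableT (igs (t m *: e)))).
  by rewrite -/(Rintegral _ _ _) -[X in (_ - X%:E)%E]/(Rintegral _ _ _) E -EFinB subrr mule0.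
have [] := @dominated_convergence _ _ _ (@lebesgue_rV R n) setT measurableT q
   (fun x => ('D_e g x)%:E) (fun x => (C * 3 ^+ n * weight x)%:E) mq _ _ (iW _).
- exact/measurable_EFinP.
- apply/nearW => x _; apply/cvg_EFin; first exact: nearW.
  have /cvgr_dnbhsP/(_ t) : (h^-1 *: ((g \o shift x) (h *: e) - g x)) @[h --> 0^'] --> 'D_e g x.
    exact: (diff_derivable (dg x)).
  apply; split; first by move=> m; rewrite gt_eqF//; have /andP[] := t01 m.
  exact: cvg_harmonic.
- apply/nearW => x m _; rewrite lee_fin; exact: diff_quotient_le.
- move=> _ _; rewrite [X in X @ _ --> _](_ : _ = cst 0%E); last first.
    by apply/funext => m /=; rewrite q0.
  by move=> /cvg_lim h; rewrite /Rintegral -h// (cvg_lim _ (cvg_cst _)).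
Qed.

Lemma cintegral_pderiv0 (f : 'rV[R]_n -> R[i]) i : schwartz f ->
  cintegral (pderiv i f) = 0.
Proof.
move=> sf; have df := schwartz_cdiff sf.
have [C C0 fC] := schwartz_weight sf.
have [D D0 fD] := schwartz_weight (schwartz_pderiv i sf).
have [m1 m2] := schwartz_cmeas (schwartz_pderiv i sf).
rewrite /cintegral; apply: complex_eq => /=.
- apply: (@Rintegral_derive0 _ D C) => // y; first by have [] := df y.
    by rewrite (le_trans (abs_Re_le _)).
  by rewrite (le_trans (abs_Re_le (pderiv i f y))).
- apply: (@Rintegral_derive0 _ D C) => // y; first by have [] := df y.
    by rewrite (le_trans (abs_Im_le _)).
  by rewrite (le_trans (abs_Im_le (pderiv i f y))).
Qed.

End integral_of_derivative.

(** * Fourier transform *)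

Section expi.
Context (R : realType).
Implicit Types s t : R.

Lemma normc_expi t : Normc.normc (expi t) = 1.
Proof. by rewrite /= cos2Dsin2 sqrtr1. Qed.

Lemma expiD s t : expi (s + t) = expi s * expi t.
Proof.
apply: complex_eq; rewrite ?ReM ?ImM /=; first exact: cosD.
by rewrite sinD addrC.
Qed.

Lemma expi0 : expi (0 : R) = 1.
Proof. by rewrite /expi cos0 sin0. Qed.

Lemma conj_expi t : conjc (expi t) = expi (- t).
Proof. by rewrite /expi /= cosN sinN. Qed.

End expi.

Section dotv.
Context (R : realType) (n : nat).
Implicit Types x y z : 'rV[R]_n.

Lemma dotvC x y : dotv x y = dotv y x.
Proof. by apply: eq_bigr => i _; rewrite mulrC. Qed.

Lemma dotvDr x y z : dotv x (y + z) = dotv x y + dotv x z.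
Proof. by rewrite linearD. Qed.

Lemma dotvNr x y : dotv x (- y) = - dotv x y.
Proof. by rewrite linearN. Qed.

Lemma dotvBr x y z : dotv x (y - z) = dotv x y - dotv x z.
Proof. by rewrite linearB. Qed.

Lemma dotvZr (c : R) x y : dotv x (c *: y) = c * dotv x y.
Proof. by rewrite linearZ. Qed.

Lemma dotvDl x y z : dotv (x + y) z = dotv x z + dotv y z.
Proof. by rewrite dotvC dotvDr !(dotvC z). Qed.

Lemma dotvNl x y : dotv (- x) y = - dotv x y.
Proof. by rewrite dotvC dotvNr dotvC. Qed.

Lemma dotvBl x y z : dotv (x - y) z = dotv x z - dotv y z.
Proof. by rewrite dotvDl dotvNl. Qed.

Lemma dotvZl (c : R) x y : dotv (c *: x) y = c * dotv x y.
Proof. by rewrite dotvC dotvZr dotvC. Qed.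

End dotv.

Section tensor.
Context {R : realType} d1 d2 (T1 : measurableType d1) (T2 : measurableType d2).
Variable m1 : {sigma_finite_measure set T1 -> \bar R}.
Variable m2 : {sigma_finite_measure set T2 -> \bar R}.

Lemma cintegrable_tensor (K : T1 * T2 -> R[i]) (f : T1 -> R[i]) (g : T2 -> R[i]) :
  cmeas K -> (forall z, Normc.normc (K z) <= 1) ->
  cintegrable m1 f -> cintegrable m2 g ->
  cintegrable (m1 \x m2)%E (fun z => K z * (f z.1 * g z.2)).
Proof.
move=> mK K1 [mf fi] [mg gi].
have mfg : cmeas (fun z : T1 * T2 => f z.1 * g z.2).
  by apply: cmeasM; [exact: cmeas_comp mf measurable_fst|exact: cmeas_comp mg measurable_snd].
apply: (cintegrableMbound mK K1).
split => //.
rewrite (fubini_tonelli1 (fun z : T1 * T2 => (Normc.normc (f z.1 * g z.2))%:E))//=; first last.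
- by move=> z; rewrite lee_fin normc_ge0.
- exact: measurable_enormc.
have E x : (\int[m2]_y (Normc.normc (f x * g y))%:E =
    (Normc.normc (f x))%:E * \int[m2]_y (Normc.normc (g y))%:E)%E.
  under eq_integral do rewrite Normc.normcM EFinM.
  rewrite ge0_integralZl//.
  - exact: measurable_enormc.
  - by move=> y _; rewrite lee_fin normc_ge0.
  - by rewrite lee_fin normc_ge0.
rewrite /fubini_F/=; under eq_integral do rewrite E.
rewrite ge0_integralZr//; first last.
- by apply: integral_ge0 => y _; rewrite lee_fin normc_ge0.
- by move=> x _; rewrite lee_fin normc_ge0.
- exact: measurable_enormc.
rewrite lte_mul_pinfty//.
- by apply: integral_ge0 => y _; rewrite lee_fin normc_ge0.
- rewrite ge0_fin_numE//.
  by apply: integral_ge0 => y _; rewrite lee_fin normc_ge0.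
Qed.

End tensor.

(** * Fourier integrals of integrable functions *)

Section oscillatory.
Context (R : realType) (n : nat).
Implicit Types (x y xi b : 'rV[R]_n) (f g : 'rV[R]_n -> R[i]) (s : R).

(* [s = -1] gives the Fourier transform and, up to a constant, [s = 1] gives
   its inverse. *)
Definition osc s f xi : R[i] := cintegral (fun x => expi (s * dotv xi x) * f x).

Definition two_pi_n : R := (2 * pi) ^- n.

Lemma fourierE f : fourier f = osc (-1) f.
Proof.
apply/funext => xi; rewrite /fourier /osc; congr cintegral.
by apply/funext => x; rewrite mulN1r.
Qed.

Lemma inv_fourierE f : inv_fourier f = fun x => two_pi_n%:C * osc 1 f x.
Proof.
apply/funext => x; rewrite /inv_fourier /osc; congr (_ * cintegral _).
by apply/funext => xi; rewrite mul1r.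
Qed.

Lemma cmeas_expi2 s :
  cmeas (fun z : 'rV[R]_n * 'rV[R]_n => expi (s * dotv z.1 z.2)).
Proof.
have md : measurable_fun setT (fun z : 'rV[R]_n * 'rV[R]_n => s * dotv z.1 z.2).
  apply: measurable_funM => //.
  apply: measurable_sum => i; apply: measurable_funM.
    exact: (measurableT_comp (measurable_coor i) measurable_fst).
  exact: (measurableT_comp (measurable_coor i) measurable_snd).
split.
  apply: (measurableT_comp _ md); apply: continuous_measurable_fun.
  exact: continuous_cos.
apply: (measurableT_comp _ md); apply: continuous_measurable_fun.
exact: continuous_sin.
Qed.

Lemma cmeas_expi s xi : cmeas (fun x => expi (s * dotv xi x)).
Proof. exact: (cmeas_comp (cmeas_expi2 s) (measurable_pair1 xi)). Qed.

Lemma normc_expi_le1 (t : R) : Normc.normc (expi t) <= 1.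
Proof. by rewrite normc_expi. Qed.

Lemma cintegrable_osc s f xi : cintegrable lebesgue_rV f ->
  cintegrable lebesgue_rV (fun x => expi (s * dotv xi x) * f x).
Proof.
move=> fi; apply: (@cintegrableMbound _ _ _ _ 1) => //; first exact: cmeas_expi.
by move=> x; rewrite normc_expi.
Qed.

Lemma normc_osc_le s f xi : cintegrable lebesgue_rV f ->
  ((Normc.normc (osc s f xi))%:E <= \int[lebesgue_rV]_x (Normc.normc (f x))%:E)%E.
Proof.
move=> fi; apply: le_trans (normc_cint_le (cintegrable_osc s xi fi)) _.
by under eq_integral do rewrite Normc.normcM normc_expi mul1r.
Qed.

Lemma osc_bounded s f : cintegrable lebesgue_rV f ->
  exists2 C : R, 0 <= C & forall xi, Normc.normc (osc s f xi) <= C.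
Proof.
move=> fi; have I0 : (0 <= \int[@lebesgue_rV R n]_x (Normc.normc (f x))%:E)%E.
  by apply: integral_ge0 => x _; rewrite lee_fin normc_ge0.
have fin : (\int[@lebesgue_rV R n]_x (Normc.normc (f x))%:E)%E \is a fin_num.
  by rewrite ge0_fin_numE//; case: fi.
exists (fine (\int[lebesgue_rV]_x (Normc.normc (f x))%:E)); first exact: fine_ge0.
by move=> xi; rewrite -lee_fin fineK// normc_osc_le.
Qed.

Lemma weight_real_cintegrable :
  cintegrable lebesgue_rV (fun x : 'rV[R]_n => (weight x)%:C).
Proof.
apply: (@weight_cintegrable _ _ _ 1 0).
  by apply: cmeas_real; exact: measurable_weight.
by move=> x; rewrite normcR ger0_norm ?weight_ge0// mul1r subr0.
Qed.

(** Measurability of a parametrised integral comes from integrability on the product space, which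
    $e^{is\,x\cdot y}f(y)$ alone does not have. Multiplying by [weight x] provides it, and the
    factor is divided out afterwards. *)
Lemma cmeas_osc s f : cintegrable lebesgue_rV f -> cmeas (osc s f).
Proof.
move=> fi.
have := @cmeas_cint R _ _ _ _ (@lebesgue_rV R n) (@lebesgue_rV R n) _
  (@cintegrable_tensor R _ _ _ _ (@lebesgue_rV R n) (@lebesgue_rV R n) _ _ _
  (cmeas_expi2 s) (fun z => normc_expi_le1 _) weight_real_cintegrable fi).
have E x : cint (@lebesgue_rV R n) (fun y => expi (s * dotv x y) * ((weight x)%:C * f y)) =
    (weight x)%:C * osc s f x.
  rewrite /osc cintegralE -cintZ; last exact: cintegrable_osc.
  by apply: eq_cint => y; rewrite mulrCA.
under eq_fun do rewrite E.
have mWV : cmeas (fun x : 'rV[R]_n => ((weight x)^-1)%:C).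
  apply: cmeas_real.
  rewrite (_ : (fun _ => _) = (fun x : 'rV[R]_n => \prod_i (1 + x ord0 i ^+ 2))).
    apply: measurable_prod => i _; apply: measurable_funD => //.
    by apply: measurable_funX; exact: measurable_coor.
  by apply/funext => x; rewrite /weight prodfV invrK.
move=> /(cmeasM mWV).
rewrite (_ : (fun _ => _ * (_ * _)) = osc s f)//; apply/funext => x.
by rewrite mulrA -rmorphM/= mulVf ?mul1r// gt_eqF// weight_gt0.
Qed.

(** The multiplication formula: Fubini's theorem for a bounded kernel that is symmetric in its two
    variables. *)
Lemma osc_mul s f g : cintegrable lebesgue_rV f -> cintegrable lebesgue_rV g ->
  cintegral (fun x => f x * osc s g x) = cintegral (fun x => osc s f x * g x).
Proof.
move=> fi gi.
have ti := @cintegrable_tensor R _ _ _ _ (@lebesgue_rV R n) (@lebesgue_rV R n) _ _ _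
  (cmeas_expi2 s) (fun z => normc_expi_le1 _) fi gi.
have := cfubini ti => /=.
have E1 x : cint (@lebesgue_rV R n) (fun y => expi (s * dotv x y) * (f x * g y)) =
    f x * osc s g x.
  rewrite /osc cintegralE -cintZ; last exact: cintegrable_osc.
  by apply: eq_cint => y; rewrite mulrCA.
have E2 y : cint (@lebesgue_rV R n) (fun x => expi (s * dotv x y) * (f x * g y)) =
    osc s f y * g y.
  rewrite /osc cintegralE mulrC -cintZ; last exact: cintegrable_osc.
  by apply: eq_cint => x; rewrite dotvC mulrA mulrC.
rewrite (eq_cint _ E1) (eq_cint _ E2) !cintegralE => -> //.
- move=> x; have := cintegrableZ (f x) (cintegrable_osc s x gi).
  by under eq_fun do rewrite mulrCA.
- move=> y; have := cintegrableZ (g y) (cintegrable_osc s y fi).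
  by under eq_fun do rewrite dotvC mulrC -mulrA.
Qed.

End oscillatory.

(** * Decay of Fourier transforms, and wave packets *)

Section fourier_decay.
Context (R : realType) (n : nat).
Implicit Types (x y xi b : 'rV[R]_n) (f g : 'rV[R]_n -> R[i]).

Lemma bsmooth_cst (c : R[i]) : bsmooth (fun _ : 'rV[R]_n => c).
Proof.
have [||s1 s2] := @stable_pderivs R n (fun h => exists a, h = fun=> a) (fun=> c); last first.
- by split => // s; have [a ->] := s2 s; exists (Normc.normc a).
- by exists c.
- by move=> _ [a ->]; split; [exact: cdiff_cst|move=> i; exists 0; exact: pderiv_cst].
Qed.

Lemma schwartzZ (c : R[i]) f : schwartz f -> schwartz (fun x => c * f x).
Proof. exact/schwartzM/bsmooth_cst. Qed.

(** The derivative of $e^{-i\xi\cdot x}f(x)$ in direction [i] has integral zero; the product rule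
    does the rest. *)
Lemma fourier_pderiv f i xi : schwartz f ->
  fourier (pderiv i f) xi = (0 +i* xi ord0 i) * fourier f xi.
Proof.
move=> sf; have := cintegral_pderiv0 i (schwartzM (bsmooth_expi (- xi)) sf).
rewrite pderivM; [|exact: cdiff_expi|exact: schwartz_cdiff].
rewrite pderiv_expi cintegralE.
have h1 : cintegrable lebesgue_rV (fun x => expi (dotv (- xi) x) * f x).
  exact/schwartz_cintegrable/schwartzM/sf/bsmooth_expi.
have h2 : cintegrable lebesgue_rV (fun x => expi (dotv (- xi) x) * pderiv i f x).
  exact/schwartz_cintegrable/schwartzM/schwartz_pderiv/sf/bsmooth_expi.
rewrite (@eq_cint _ _ _ _ _ (fun x => (0 +i* (- xi) ord0 i) * (expi (dotv (- xi) x) * f x) +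
   expi (dotv (- xi) x) * pderiv i f x)); last by move=> x; rewrite mulrA.
rewrite cintD//; last exact: cintegrableZ.
rewrite cintZ// => /eqP; rewrite addrC addr_eq0 => /eqP.
rewrite /fourier !cintegralE.
under eq_cint do rewrite dotvNl; move=> ->.
under [in RHS]eq_cint do rewrite -dotvNl.
rewrite -mulNr; congr (_ * _).
by apply: complex_eq; rewrite /= ?oppr0// mxE opprK.
Qed.

(** The operator $1-\partial_i^2$ in the single direction [i]; its symbol $1+\xi_i^2$ is one factor
    of the reciprocal of [weight]. *)
Definition oneDlap (i : 'I_n) f x : R[i] := f x + (-1) * pderiv i (pderiv i f) x.

Lemma schwartz_oneDlap i f : schwartz f -> schwartz (oneDlap i f).
Proof.
by move=> sf; apply: schwartzD => //; exact/schwartzZ/schwartz_pderiv/schwartz_pderiv.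
Qed.

Lemma fourier_oneDlap i f xi : schwartz f ->
  fourier (oneDlap i f) xi = (1 + xi ord0 i ^+ 2)%:C * fourier f xi.
Proof.
move=> sf; have s2 := schwartz_pderiv i (schwartz_pderiv i sf).
have e h : schwartz h -> cintegrable lebesgue_rV (fun x => expi (- dotv xi x) * h x).
  move=> sh; under eq_fun do rewrite -dotvNl.
  exact/schwartz_cintegrable/schwartzM/sh/bsmooth_expi.
have -> : fourier (oneDlap i f) xi = fourier f xi - fourier (pderiv i (pderiv i f)) xi.
  rewrite /fourier !cintegralE -mulN1r -cintZ; last exact: e.
  rewrite -cintD; [|exact: e|exact/cintegrableZ/e].
  by apply: eq_cint => x; rewrite /oneDlap; ring.
rewrite (fourier_pderiv i xi (schwartz_pderiv i sf)) (fourier_pderiv i xi sf).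
rewrite mulrA -[X in X - _]mul1r -mulrBl; congr (_ * _).
by apply: complex_eq; rewrite ?ReD ?ImD /= ; ring.
Qed.

(** Applying $1-\partial_i^2$ once for every [i] multiplies the transform by the reciprocal of
    [weight], and the result is the transform of an integrable function, hence bounded. *)
Lemma fourier_decay f : schwartz f ->
  exists2 C : R, 0 <= C & forall xi, Normc.normc (fourier f xi) <= C * weight xi.
Proof.
move=> sf; pose g := foldr oneDlap f (index_enum 'I_n).
have [sg gE] : schwartz g /\ forall xi, fourier g xi =
    (\prod_i (1 + xi ord0 i ^+ 2))%:C * fourier f xi.
  rewrite /g; elim: (index_enum _) => [|i s [sg IH]] /=.
    by split => // xi; rewrite big_nil mul1r.
  split; first exact: schwartz_oneDlap.
  by move=> xi; rewrite fourier_oneDlap// IH big_cons rmorphM/= mulrA.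
have [C C0 gC] := osc_bounded (-1) (schwartz_cintegrable sg).
exists C => // xi; rewrite -ler_pdivrMr ?weight_gt0//.
apply: le_trans (gC xi); rewrite -fourierE gE Normc.normcM normcR mulrC.
rewrite /weight prodfV invrK ger0_norm//.
by apply: prodr_ge0 => i _; rewrite ltW// oneD_sqr_gt0.
Qed.

Definition wave_packet (eta : 'rV[R]_n -> R[i]) (lam b x : 'rV[R]_n) : R[i] :=
  expi (dotv lam (x - b)) * eta (x - b).

Lemma schwartz_wave_packet eta lam b : schwartz eta ->
  schwartz (wave_packet eta lam b).
Proof.
move=> se; have := schwartz_affine (- b) (oner_neq0 R) (schwartzM (bsmooth_expi lam) se).
by under eq_fun do rewrite scale1r.
Qed.

Lemma fourier_wave_packet eta lam b xi : schwartz eta ->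
  fourier (wave_packet eta lam b) xi =
  expi (- dotv xi b) * fourier eta (xi - lam).
Proof.
move=> se.
have h : cintegrable lebesgue_rV (fun x => expi (- dotv xi x) * wave_packet eta lam b x).
  under eq_fun do rewrite -dotvNl.
  exact/schwartz_cintegrable/schwartzM/schwartz_wave_packet/se/bsmooth_expi.
rewrite /fourier -(cintegral_shift b h) !cintegralE -cintZ; last first.
  under eq_fun do rewrite -dotvNl.
  exact/schwartz_cintegrable/schwartzM/se/bsmooth_expi.
apply: eq_cint => x; rewrite /wave_packet addrK !mulrA -!expiD.
by congr (expi _ * _); rewrite dotvDr dotvBl; ring.
Qed.

End fourier_decay.

(** * A weighted $L^2$ bound for Fourier integrals *)

Section bessel.
Context (R : realType) (n : nat).
Implicit Types (x y z b : 'rV[R]_n) (f w : 'rV[R]_n -> R[i]).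

Lemma cintegrable_affine (c : R) b f : 0 < c -> cintegrable lebesgue_rV f ->
  cintegrable lebesgue_rV (fun x => f (c *: x + b)).
Proof.
move=> c0 [mf fi]; split.
  exact: (cmeas_comp mf (measurable_affine_rV c b)).
have cn0 : 0 < c ^+ n by rewrite exprn_gt0.
have E := ge0_integral_affine_rV b c0 (measurable_enormc mf)
  (fun x => normc_ge0 (f x) : (0 <= (Normc.normc (f x))%:E)%E).
rewrite (_ : integral _ _ _ =
    (c ^+ n)^-1%:E * \int[lebesgue_rV]_x (Normc.normc (f x))%:E)%E.
  by rewrite lte_mul_pinfty// lee_fin invr_ge0 ltW.
by rewrite -E muleA -EFinM mulVf ?mul1e// gt_eqF.
Qed.

Lemma osc_dilate (s c : R) f y : 0 < c -> cintegrable lebesgue_rV f ->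
  osc s (fun x => f (c^-1 *: x)) y = (c ^+ n)%:C * osc s f (c *: y).
Proof.
move=> c0 fi; rewrite /osc.
have c'0 : 0 < c^-1 by rewrite invr_gt0.
have h : cintegrable lebesgue_rV (fun x => expi (s * dotv y x) * f (c^-1 *: x)).
  apply: cintegrable_osc; have := cintegrable_affine 0 c'0 fi.
  by under eq_fun do rewrite addr0.
rewrite -(cintegral_affine 0 c0 h); congr (_ * cintegral _).
apply/funext => x; rewrite addr0 scalerA mulVf ?gt_eqF// scale1r.
by rewrite dotvZr -dotvZl.
Qed.

Lemma ge0_integral_dilate (c : R) (g : 'rV[R]_n -> \bar R) : 0 < c ->
  measurable_fun setT g -> (forall x, 0 <= g x)%E ->
  ((c ^+ n)%:E * \int[lebesgue_rV]_x g (c *: x) = \int[lebesgue_rV]_x g x)%E.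
Proof.
move=> c0 mg g0; rewrite -(ge0_integral_affine_rV 0 c0 mg g0).
by under [in RHS]eq_integral do rewrite addr0.
Qed.

Lemma cintegrable_indic (Q : set 'rV[R]_n) (A : R) w : measurable Q ->
  (lebesgue_rV Q < +oo)%E -> 0 <= A -> cmeas w ->
  (forall y, Normc.normc (w y) <= A * \1_Q y) -> cintegrable lebesgue_rV w.
Proof.
move=> mQ Qoo A0 mw wA.
have mI : measurable_fun setT (fun y : 'rV[R]_n => (\1_Q y : R)%:E).
  by apply/measurable_EFinP; exact: measurable_indic.
apply: (@cintegrable_dom _ _ _ _ _ (fun y => A%:E * (\1_Q y)%:E)%E) => //.
  by apply: emeasurable_funM.
rewrite ge0_integralZl//.
by rewrite integral_indic// setIT lte_mul_pinfty.
Qed.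

Lemma osc_conj s w x : cintegrable lebesgue_rV w ->
  conjc (osc s w x) = osc (- s) (fun y => conjc (w y)) x.
Proof.
move=> wi; rewrite /osc !cintegralE -cint_conj; last exact: cintegrable_osc.
by apply: eq_cint => y; rewrite conjcM conj_expi mulNr.
Qed.

Lemma normc_cintegral_shift_le f w (A : R) y : cintegrable lebesgue_rV f ->
  cmeas w -> (forall z, Normc.normc (w z) <= A) ->
  ((Normc.normc (cintegral (fun z => f (z - y) * w z)))%:E <=
   A%:E * \int[lebesgue_rV]_z (Normc.normc (f z))%:E)%E.
Proof.
move=> fi mw wA; have fyi := cintegrable_shift (- y) fi.
have mf := fi.1; have mfy := fyi.1.
have A0 : 0 <= A := le_trans (normc_ge0 _) (wA 0).
have i : cintegrable lebesgue_rV (fun z => f (z - y) * w z).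
  by under eq_fun do rewrite mulrC; exact: (cintegrableMbound mw wA fyi).
apply: (le_trans (normc_cint_le i)).
rewrite -(@ge0_integral_shift_rV R n (- y) (fun z => (Normc.normc (f z))%:E)
  (measurable_enormc mf)); last by move=> x; rewrite lee_fin normc_ge0.
rewrite -ge0_integralZl//; first last.
- by move=> x _; rewrite lee_fin normc_ge0.
- exact: measurable_enormc mfy.
apply: ge0_le_integral => //.
- by move=> x _; rewrite lee_fin normc_ge0.
- exact: measurable_enormc i.1.
- by apply: emeasurable_funM => //; exact: measurable_enormc mfy.
- move=> z _; rewrite -EFinM lee_fin Normc.normcM mulrC.
  by rewrite ler_wpM2r ?normc_ge0.
Qed.

(** The transform of a product as a convolution: after the multiplication formula, the phase
    $e^{iy\cdot x}$ translates the transform of [K] by [y]. *)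
Lemma osc_conj_osc K w y : cintegrable lebesgue_rV K -> cintegrable lebesgue_rV w ->
  osc 1 (fun x => conjc (osc 1 w x) * K x) y =
  cintegral (fun z => osc (-1) K (z - y) * conjc (w z)).
Proof.
move=> Ki wi; have cwi : cintegrable lebesgue_rV (fun z => conjc (w z)).
  split; first exact: cmeas_conj wi.1.
  by under eq_integral do rewrite normc_conj; exact: wi.2.
have Kyi := cintegrable_osc 1 y Ki.
transitivity (cintegral (fun x => (expi (1 * dotv y x) * K x) *
    osc (-1) (fun z => conjc (w z)) x)).
  rewrite {1}/osc; congr cintegral; apply/funext => x.
  by rewrite (osc_conj 1 x wi) mulrA mulrAC.
rewrite (osc_mul (-1) Kyi cwi); congr cintegral; apply/funext => z; congr (_ * _).
congr cintegral; apply/funext => x; rewrite mulrA -expiD; congr (expi _ * _).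
by rewrite dotvBl; ring.
Qed.

(** Let $F$ be the transform of [w]. Writing $k|F|^2=(k\overline F)F$, the multiplication formula
    moves the transform onto $k\overline F$. By [osc_conj_osc] the result is a convolution of the
    transform of [k] with $\overline w$, bounded by [A] times an $L^1$ norm; integrating it against
    [w] gives the second factor. *)
Lemma osc_weighted_L2 (k : 'rV[R]_n -> R) (Q : set 'rV[R]_n) (A : R) w :
  (forall x, 0 <= k x) -> cintegrable lebesgue_rV (fun x => (k x)%:C) ->
  cintegrable lebesgue_rV (osc (-1) (fun x => (k x)%:C)) ->
  measurable Q -> (lebesgue_rV Q < +oo)%E -> 0 <= A -> cmeas w ->
  (forall y, Normc.normc (w y) <= A * \1_Q y) ->
  (\int[lebesgue_rV]_x (k x * Normc.normc (osc 1 w x) ^+ 2)%:E <=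
   A%:E * \int[lebesgue_rV]_z (Normc.normc (osc (-1) (fun x => (k x)%:C) z))%:E *
   (A%:E * lebesgue_rV Q))%E.
Proof.
move=> k0 ki kio mQ Qoo A0 mw wA.
have wi := cintegrable_indic mQ Qoo A0 mw wA.
have wA1 z : Normc.normc (conjc (w z)) <= A.
  by rewrite normc_conj (le_trans (wA z))// ler_piMr// indicE lern1 leq_b1.
have PL y := normc_cintegral_shift_le y kio (cmeas_conj mw) wA1.
have [F FE] : exists F, F = osc 1 w by exists (osc 1 w).
have mF : cmeas F by rewrite FE; exact: cmeas_osc.
have [B B0 FB] := osc_bounded 1 wi; rewrite -FE in FB.
pose h x : R[i] := conjc (F x) * (k x)%:C.
have hi : cintegrable lebesgue_rV h.
  apply: (cintegrableMbound (cmeas_conj mF) _ ki) => x.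
  by rewrite normc_conj; exact: FB.
have PE y : osc 1 h y = cintegral (fun z => osc (-1) (fun x => (k x)%:C) (z - y) * conjc (w z)).
  by rewrite /h FE osc_conj_osc.
have mP : cmeas (osc 1 h) := cmeas_osc 1 hi.
have I0 : (0 <= \int[lebesgue_rV]_z (Normc.normc (osc (-1) (fun x => (k x)%:C) z))%:E)%E.
  by apply: integral_ge0 => x _; rewrite lee_fin normc_ge0.
have Ifin : (\int[lebesgue_rV]_z (Normc.normc (osc (-1) (fun x => (k x)%:C) z))%:E)%E \is a fin_num.
  by rewrite ge0_fin_numE//; exact: kio.2.
move: PL => PL; rewrite -(fineK Ifin) in PL *.
move: (fine _) (fine_ge0 I0) PL => L L0 PL.
have Pb y : Normc.normc (osc 1 h y) <= A * L.
  by rewrite -lee_fin EFinM PE; exact: PL.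
have hFi : cintegrable lebesgue_rV (fun x => h x * F x).
  under eq_fun do rewrite mulrC.
  exact: (cintegrableMbound mF FB hi).
have hFE x : h x * F x = (k x * Normc.normc (F x) ^+ 2)%:C.
  by rewrite /h mulrAC [conjc _ * _]mulrC mul_conj_normc mulrC -rmorphM.
have kF0 x : 0 <= k x * Normc.normc (F x) ^+ 2 by rewrite mulr_ge0// exprn_ge0// normc_ge0.
have fin : (\int[@lebesgue_rV R n]_x (k x * Normc.normc (F x) ^+ 2)%:E)%E \is a fin_num.
  rewrite ge0_fin_numE; last by apply: integral_ge0 => x _; rewrite lee_fin.
  have [_] := hFi; under eq_integral do rewrite hFE normcR ger0_norm//.
  by [].
rewrite -FE -(fineK fin) -/(Rintegral _ _ _).
apply: (@le_trans _ _ (Normc.normc (cintegral (fun x => h x * F x)))%:E).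
  rewrite cintegralE (eq_cint _ hFE) cint_real normcR lee_fin; exact: ler_norm.
rewrite FE (osc_mul 1 hi wi).
have Pwi : cintegrable lebesgue_rV (fun y => osc 1 h y * w y).
  exact: (cintegrableMbound mP Pb wi).
apply: (le_trans (normc_cint_le Pwi)).
have mI : measurable_fun setT (fun y : 'rV[R]_n => (\1_Q y : R)%:E).
  by apply/measurable_EFinP; exact: measurable_indic.
rewrite -[leRHS]muleA.
rewrite -(_ : \int[lebesgue_rV]_y (A%:E * (L%:E * (A%:E * (\1_Q y)%:E))) =
   A%:E * (L%:E * (A%:E * lebesgue_rV Q)))%E; last first.
  have m1 : measurable_fun setT (fun y => (A%:E * (\1_Q y)%:E)%E) by exact: emeasurable_funM.
  have m2 : measurable_fun setT (fun y => (L%:E * (A%:E * (\1_Q y)%:E))%E) by exact: emeasurable_funM.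
  have g1 y : (0 <= A%:E * (\1_Q y)%:E)%E by rewrite -EFinM lee_fin mulr_ge0.
  have g2 y : (0 <= L%:E * (A%:E * (\1_Q y)%:E))%E by rewrite mule_ge0.
  rewrite ge0_integralZl// ge0_integralZl// ge0_integralZl//.
  by rewrite integral_indic// setIT.
apply: ge0_le_integral => //.
- by move=> x _; rewrite lee_fin normc_ge0.
- exact: measurable_enormc Pwi.1.
- by do 3 apply: emeasurable_funM => //.
- move=> y _; rewrite -!EFinM lee_fin Normc.normcM mulrA.
  by apply: ler_pM; rewrite ?normc_ge0.
Qed.

Lemma fourier_cintegrable f : schwartz f -> cintegrable lebesgue_rV (fourier f).
Proof.
move=> sf; have [C C0 fC] := fourier_decay sf.
apply: (@weight_cintegrable _ _ _ C 0).
  by rewrite fourierE; exact/cmeas_osc/schwartz_cintegrable.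
by move=> x; rewrite subr0.
Qed.

(** The $L^1$ norm of the transform is invariant under dilation of the function; this keeps the
    bound of [osc_weighted_L2] fixed while the kernel spreads out. *)
Lemma osc_dilate_integrable (e : 'rV[R]_n -> R) (c : R) : 0 < c ->
  schwartz (fun x => (e x)%:C) ->
  let G := osc (-1) (fun x => (e (c^-1 *: x))%:C) in
  cintegrable lebesgue_rV G /\
  (\int[lebesgue_rV]_z (Normc.normc (G z))%:E =
   \int[lebesgue_rV]_z (Normc.normc (fourier (fun x => (e x)%:C) z))%:E)%E.
Proof.
move=> c0 se G.
have GE : G = fun z => (c ^+ n)%:C * fourier (fun x => (e x)%:C) (c *: z).
  by apply/funext => z; rewrite fourierE -(osc_dilate _ _ c0 (schwartz_cintegrable se)).
have cn0 : 0 <= c ^+ n by rewrite exprn_ge0// ltW.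
move: (fourier _) (fourier_cintegrable se) GE => g gi; move: G => G ->.
split.
  have := cintegrableZ (c ^+ n)%:C (cintegrable_affine 0 c0 gi).
  by under eq_fun do rewrite addr0.
rewrite -(ge0_integral_dilate c0 (measurable_enormc gi.1)); last first.
  by move=> z; rewrite lee_fin normc_ge0.
rewrite -ge0_integralZl//; first last.
- by move=> z _; rewrite lee_fin normc_ge0.
- have := measurable_affine_rV c (0 : 'rV[R]_n).
  under eq_fun do rewrite addr0.
  exact: (measurableT_comp (measurable_enormc gi.1)).
by apply: eq_integral => z _; rewrite Normc.normcM normcR ger0_norm.
Qed.

End bessel.

(** * Modulation norms and the lacunary multiplier *)

Section Lp_norms.
Context (R : realType) (n : nat).
Implicit Types (h : 'rV[R]_n -> R[i]) (p r : R).

Lemma Lp_norm_funE p h : Lp_norm_fun p%:E h =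
  ((\int[lebesgue_rV]_x (Normc.normc (h x) `^ p)%:E) `^ p^-1)%E.
Proof.
rewrite /Lp_norm_fun Lnorm.unlock.
apply: (congr1 (fun z => poweR z _)); apply: eq_integral => x _.
by rewrite abse_EFin ger0_norm ?normc_ge0.
Qed.

Lemma le_poweR (x y : \bar R) r : 0 <= r -> (0 <= x)%E -> (x <= y)%E ->
  (x `^ r <= y `^ r)%E.
Proof.
move=> r0 x0 xy; apply: gt0_ler_poweR => //; rewrite in_itv/= ?leey ?andbT//.
exact: le_trans xy.
Qed.

Lemma Lp_norm_fun_le p h (B : R) : 0 < p ->
  (\int[lebesgue_rV]_x (Normc.normc (h x) `^ p)%:E <= B%:E)%E ->
  (Lp_norm_fun p%:E h <= (B `^ p^-1)%:E)%E.
Proof.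
move=> p0 hB; rewrite Lp_norm_funE -poweR_EFin; apply: le_poweR => //.
  by rewrite invr_ge0 ltW.
by apply: integral_ge0 => x _; rewrite lee_fin powR_ge0.
Qed.

Lemma limn_einf_le (u : (\bar R)^nat) (B : \bar R) :
  (forall m, u m <= B)%E -> (limn_einf u <= B)%E.
Proof.
move=> uB; rewrite limn_einf_lim; apply: lime_le; first exact: is_cvg_einfs.
apply: nearW => m; apply: le_trans (uB m); apply: ereal_inf_lbound.
by exists m => //=.
Qed.

End Lp_norms.

(** * The $L^2$ norm of one frequency block *)

Section modulation_block.
Context (R : realType) (n : nat).
Implicit Types (x y b : 'rV[R]_n) (f w h : 'rV[R]_n -> R[i]).

(** The kernels $e(x/(m+1))$ converge pointwise to the constant $e(0)$, and [osc_weighted_L2] bounds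
    the integrals weighted by them uniformly in [m]. Fatou's lemma gives the unweighted integral. *)
Lemma osc_L2 (e : 'rV[R]_n -> R) (Q : set 'rV[R]_n) (A : R) w :
  schwartz (fun x => (e x)%:C) -> (forall x, 0 <= e x) ->
  measurable Q -> (lebesgue_rV Q < +oo)%E -> 0 <= A -> cmeas w ->
  (forall y, Normc.normc (w y) <= A * \1_Q y) ->
  ((e 0)%:E * \int[lebesgue_rV]_x (Normc.normc (osc 1 w x) ^+ 2)%:E <=
   A%:E * \int[lebesgue_rV]_z (Normc.normc (fourier (fun x => (e x)%:C) z))%:E *
   (A%:E * lebesgue_rV Q))%E.
Proof.
move=> se e0 mQ Qoo A0 mw wA.
have wi := cintegrable_indic mQ Qoo A0 mw wA.
have mF := cmeas_osc 1 wi; move E : (osc 1 w) => F; rewrite E in mF.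
have mF2 : measurable_fun setT (fun x => Normc.normc (F x) ^+ 2).
  by apply: measurable_funX; exact: measurable_normc.
have F20 x : 0 <= Normc.normc (F x) ^+ 2 by rewrite exprn_ge0// normc_ge0.
have [me _] := schwartz_cmeas se.
have msc (c : R) : measurable_fun setT (fun x => e (c *: x)).
  have := measurable_affine_rV c (0 : 'rV[R]_n).
  by under eq_fun do rewrite addr0; exact: (measurableT_comp me).
pose g (m : nat) x := (e (m.+1%:R^-1 *: x) * Normc.normc (F x) ^+ 2)%:E.
have mg m : measurable_fun setT (g m).
  by apply/measurable_EFinP; exact: measurable_funM.
have g0 m x : (0 <= g m x)%E by rewrite lee_fin mulr_ge0.
have ce : {for 0, continuous e}.
  by have [/differentiable_continuous] := schwartz_cdiff se 0.
have gcvg x : limn_einf (g^~ x) = ((e 0)%:E * (Normc.normc (F x) ^+ 2)%:E)%E.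
  apply: (cvg_limn_einf_sup _).1; rewrite -EFinM; apply/cvg_EFin; first exact: nearW.
  apply: cvgMr_tmp.
  apply: (cvg_comp (fun m : nat => m.+1%:R^-1 *: x) e); last exact: ce.
  rewrite -(scale0r x); apply: cvgZr_tmp; exact: cvg_harmonic.
have mF2E : measurable_fun setT (fun x => (Normc.normc (F x) ^+ 2)%:E).
  exact/measurable_EFinP.
have F20E x : (0 <= (Normc.normc (F x) ^+ 2)%:E)%E by rewrite lee_fin.
rewrite -ge0_integralZl//; last by rewrite lee_fin.
under eq_integral do rewrite -gcvg.
apply: le_trans (fatou _ measurableT mg (fun m x _ => g0 m x)) _.
apply: limn_einf_le => m.
have c0 : 0 < m.+1%:R :> R by rewrite ltr0n.
have [kio <-] := osc_dilate_integrable c0 se.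
rewrite /g -E; apply: osc_weighted_L2 => //.
have c'0 : 0 < m.+1%:R^-1 :> R by rewrite invr_gt0.
have := cintegrable_affine 0 c'0 (schwartz_cintegrable se).
by under eq_fun do rewrite addr0.
Qed.

Lemma measurable_unit_box b : measurable [set x : 'rV[R]_n | forall i, -1 <= (x - b) ord0 i <= 1].
Proof.
have := @measurable_box R n (fun i => `[b ord0 i - 1, b ord0 i + 1]%classic) (fun i => measurable_itv _).
congr (measurable _); apply/seteqP; split => x /= h i; have := h i;
  by rewrite /= in_itv/= !mxE => /andP[h1 h2]; apply/andP; split; lra.
Qed.

Lemma lebesgue_unit_box b :
  lebesgue_rV [set x : 'rV[R]_n | forall i, -1 <= (x - b) ord0 i <= 1] = (2 ^+ n)%:E.
Proof.
have := @lebesgue_rV_box R n (fun i => `[b ord0 i - 1, b ord0 i + 1]%classic) (fun i => measurable_itv _).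
rewrite (_ : [set x : 'rV[R]_n | _] = [set x : 'rV[R]_n | forall i, -1 <= (x - b) ord0 i <= 1]).
  move=> ->; under eq_bigr => i _.
    rewrite lebesgue_measure_itv/= lte_fin ltrD2l gtrN// -EFinB.
    rewrite (_ : _ - _ = 2); last by ring.
    over.
  by rewrite prodEFin prodr_const card_ord.
apply/seteqP; split => x /= h i; have := h i;
  by rewrite /= in_itv/= !mxE => /andP[h1 h2]; apply/andP; split; lra.
Qed.

(** The block is represented by the inverse transform of $a\widehat h$, which is supported in a cube
    of volume $2^n$ and bounded by [A], so [osc_L2] applies. The assumption on [u] ranges over
    bounded measurable functions because [fmultiplier] evaluates [u] at the transform of [a] times
    an inverse transform, of which exactly these two properties are derived. *)
Lemma Lp_norm_block (e : 'rV[R]_n -> R) (a h : 'rV[R]_n -> R[i]) (u : distr R n) (A : R) b :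
  schwartz (fun x => (e x)%:C) -> (forall x, 0 <= e x) -> 0 < e 0 ->
  cmeas a -> (exists B : R, forall x, Normc.normc (a x) <= B) ->
  (forall x, a x != 0 -> forall i, -1 <= (x - b) ord0 i <= 1) ->
  cintegrable lebesgue_rV h ->
  (forall G, cmeas G -> (exists B : R, forall x, Normc.normc (G x) <= B) ->
    u G = distr_of_fun h G) ->
  0 <= A -> (forall y, Normc.normc (a y * fourier h y) <= A) ->
  (Lp_norm 2%:E (fmultiplier a u) <=
   ((two_pi_n R n ^+ 2 * (fine (\int[lebesgue_rV]_z (Normc.normc (fourier (fun x => (e x)%:C) z))%:E)
     * 2 ^+ n / e 0)) `^ 2^-1 * A)%:E)%E.
Proof.
move=> se e_ge0 e0 ma [B aB] asupp hi uh A0 ahA.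
pose Q := [set x : 'rV[R]_n | forall i, -1 <= (x - b) ord0 i <= 1].
have mQ : measurable Q := measurable_unit_box b.
have muQ : lebesgue_rV Q = (2 ^+ n)%:E := lebesgue_unit_box b.
have Qoo : (lebesgue_rV Q < +oo)%E by rewrite muQ ltry.
have B0 : 0 <= B := le_trans (normc_ge0 _) (aB 0).
have aQ x : x \notin Q -> a x = 0.
  move=> xQ; apply/eqP; apply: contraNT xQ => /asupp xQ; rewrite inE; exact: xQ.
have ai : cintegrable lebesgue_rV a.
  apply: (cintegrable_indic mQ Qoo B0 ma) => x; rewrite indicE.
  by have [xQ|/aQ ->] := boolP (x \in Q); rewrite ?mulr1// Normc.normc0 mulr0.
have mfh : cmeas (fourier h) by rewrite fourierE; exact: cmeas_osc.
have [D D0 hD] := osc_bounded (-1) hi; rewrite -fourierE in hD.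
pose w x := a x * fourier h x.
have mw : cmeas w := cmeasM ma mfh.
have wA y : Normc.normc (w y) <= A * \1_Q y.
  rewrite indicE; have [yQ|/aQ ay] := boolP (y \in Q); first by rewrite mulr1; exact: ahA.
  by rewrite /w ay mul0r Normc.normc0 mulr0.
have wi := cintegrable_indic mQ Qoo A0 mw wA.
have := osc_L2 se e_ge0 mQ Qoo A0 mw wA; rewrite muQ.
set L := (\int[lebesgue_rV]_z (Normc.normc (fourier _ z))%:E)%E.
have L0 : (0 <= L)%E by apply: integral_ge0 => x _; rewrite lee_fin normc_ge0.
have Lfin : L \is a fin_num.
  by rewrite ge0_fin_numE//; exact: (fourier_cintegrable se).2.
rewrite -(fineK Lfin) -!EFinM => HL.
pose H := inv_fourier w; have HE := inv_fourierE w.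
have mH : cmeas H.
  by rewrite /H HE; apply: cmeasM; [exact: cmeas_cst|exact: cmeas_osc].
have Hint : (\int[lebesgue_rV]_x (Normc.normc (H x) `^ 2)%:E <=
    (two_pi_n R n ^+ 2 * (fine L * 2 ^+ n / e 0) * A ^+ 2)%:E)%E.
  under eq_integral => x _.
    rewrite /H HE Normc.normcM normcR powR_mulrn ?mulr_ge0 ?normc_ge0//.
    rewrite exprMn real_normK ?num_real// EFinM.
    over.
  rewrite ge0_integralZl//; first last.
  - by rewrite lee_fin sqr_ge0.
  - by move=> x _; rewrite lee_fin sqr_ge0.
  - apply/measurable_EFinP/measurable_funX/measurable_normc; exact: cmeas_osc.
  rewrite -[X in (_ <= X%:E)%E]mulrA [leRHS]EFinM; apply: lee_wpmul2l.
    by rewrite lee_fin sqr_ge0.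
  rewrite -(@lee_pmul2l _ (e 0)%:E) ?lte_fin//; apply: le_trans HL _.
  rewrite -EFinM lee_fin le_eqVlt; apply/orP; left; apply/eqP.
  by field; rewrite gt_eqF.
apply: (@le_trans _ _ (Lp_norm_fun 2%:E H)).
  apply: ereal_inf_lbound; exists H => //; split.
  - exact: mH.1.
  - exact: mH.2.
  - by apply: le_lt_trans (Lp_norm_fun_le _ Hint) (ltry _).
  - move=> g sg; have gi := schwartz_cintegrable sg.
    rewrite /fmultiplier /inv_fourier_distr /mul_distr /fourier_distr.
    have mog := cmeas_osc 1 gi; have [K K0 gK] := osc_bounded 1 gi.
    have ifgE := inv_fourierE g.
    have mig : cmeas (inv_fourier g) by rewrite ifgE; apply: cmeasM => //; exact: cmeas_cst.
    have igK x : Normc.normc (inv_fourier g x) <= Normc.normc (two_pi_n R n)%:C * K.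
      by rewrite ifgE Normc.normcM ler_wpM2l// normc_ge0.
    have aigi : cintegrable lebesgue_rV (fun x => a x * inv_fourier g x).
      by under eq_fun do rewrite mulrC; exact: (cintegrableMbound mig igK ai).
    rewrite uh; first last.
    + by rewrite fourierE; have [K' _ ?] := osc_bounded (-1) aigi; exists K'.
    + by rewrite fourierE; exact: cmeas_osc.
    rewrite /distr_of_fun fourierE (osc_mul (-1) hi aigi) -fourierE.
    have woi : cintegrable lebesgue_rV (fun x => osc 1 g x * w x).
      exact: (cintegrableMbound mog gK wi).
    have wog : cintegrable lebesgue_rV (fun x => osc 1 w x * g x).
      have [K' _ wK'] := osc_bounded 1 wi.
      exact: (cintegrableMbound (cmeas_osc 1 wi) wK' gi).
    transitivity ((two_pi_n R n)%:C * cintegral (fun x => w x * osc 1 g x)).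
      rewrite !cintegralE -cintZ; last by under eq_fun do rewrite mulrC.
      by apply: eq_cint => x; rewrite ifgE /w; ring.
    rewrite (osc_mul 1 wi gi) !cintegralE -cintZ//.
    by apply: eq_cint => x; rewrite /H HE mulrA.
apply: le_trans (Lp_norm_fun_le _ Hint) _ => //.
rewrite lee_fin powRM ?sqr_ge0//; last first.
  by rewrite mulr_ge0 ?sqr_ge0// divr_ge0 ?(ltW e0)// mulr_ge0 ?fine_ge0//.
by rewrite (powR12_sqrt (sqr_ge0 A)) sqrtr_sqr ger0_norm.
Qed.

End modulation_block.

(** * Bounded functions as tempered distributions *)

Section bounded_functions_are_tempered.
Context (R : realType) (n : nat).
Implicit Types f g : 'rV[R]_n -> R[i].

Lemma schwartz_seminorm_weight f : schwartz f ->
  exists S : R, [/\ 0 <= S, schwartz_seminorm n.*2 f = S%:E &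
    forall x, Normc.normc (f x) <= S * weight x].
Proof.
move=> sf; have Sfin := sf.2 n.*2.
have le_semi x : (((1 + enorm x) ^+ n.*2 * Normc.normc (f x))%:E <=
    schwartz_seminorm n.*2 f)%E.
  by apply: ereal_sup_ubound; exists [::], x.
have S0 : (0 <= schwartz_seminorm n.*2 f)%E.
  apply: le_trans (le_semi 0); rewrite lee_fin mulr_ge0 ?normc_ge0//.
  by rewrite exprn_ge0// addr_ge0// enorm_ge0.
have fin : schwartz_seminorm n.*2 f \is a fin_num by rewrite ge0_fin_numE.
exists (fine (schwartz_seminorm n.*2 f)); split; [exact: fine_ge0|by rewrite fineK|].
move=> x; rewrite -ler_pdivrMr ?weight_gt0//.
have : (1 + enorm x) ^+ n.*2 * Normc.normc (f x) <= fine (schwartz_seminorm n.*2 f).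
  by rewrite -lee_fin fineK.
by apply: le_trans; rewrite mulrC ler_wpM2r ?normc_ge0// weightV_le.
Qed.

Lemma tempered_bounded (M : 'rV[R]_n -> R[i]) (B : R) : cmeas M ->
  (forall x, Normc.normc (M x) <= B) -> tempered (distr_of_fun M).
Proof.
move=> mM MB; have B0 : 0 <= B := le_trans (normc_ge0 _) (MB 0).
have Mi f : schwartz f -> cintegrable lebesgue_rV (fun x => M x * f x).
  by move=> /schwartz_cintegrable; exact: cintegrableMbound.
split=> [a f g sf sg|].
  rewrite /distr_of_fun !cintegralE -cintZ; last exact: Mi.
  rewrite -cintD; [|exact/cintegrableZ/Mi|exact: Mi].
  by apply: eq_cint => x; ring.
pose I := (\int[@lebesgue_rV R n]_x (weight x)%:E)%E.
have I0 : (0 <= I)%E by apply: integral_ge0 => x _; rewrite lee_fin weight_ge0.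
have Ifin : I \is a fin_num by rewrite ge0_fin_numE// integral_weight_lty.
exists n.*2, (B * fine I) => f sf.
have [S [S0 -> fS]] := schwartz_seminorm_weight sf.
apply: le_trans (normc_cint_le (Mi f sf)) _.
rewrite EFinM fineK// muleAC.
have mW : measurable_fun setT (fun x : 'rV[R]_n => (weight x)%:E).
  by apply/measurable_EFinP; exact: measurable_weight.
have W0 (x : 'rV[R]_n) : (0 <= (weight x)%:E)%E by rewrite lee_fin weight_ge0.
rewrite -EFinM -ge0_integralZl//; last by rewrite lee_fin mulr_ge0.
apply: ge0_le_integral => //.
- by move=> x _; rewrite lee_fin normc_ge0.
- by apply: measurable_enormc; exact: (Mi f sf).1.
- exact: emeasurable_funM.
- move=> x _; rewrite -EFinM lee_fin Normc.normcM -mulrA.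
  by apply: ler_pM; rewrite ?normc_ge0.
Qed.

End bounded_functions_are_tempered.

(** * The lacunary multiplier and its dyadic pieces *)

Section lacunary_multiplier.
Context (R : realType) (n : nat) (i0 : 'I_n) (psi : 'rV[R]_n -> R[i]).
Hypotheses (spsi : schwartz psi)
  (psi_supp : supp psi `<=` [set xi | 2^-1 <= enorm xi <= 2]).
Implicit Types (x y xi b : 'rV[R]_n) (t : nat) (j : int).

(** Consecutive frequencies have ratio 32. A piece at scale [2 ^ j] meets only terms whose frequency
    is within a factor 4 of [2 ^ j]; two such frequencies are within a factor 16, hence equal.
    Starting from 32 gives [t.+1 <= freq t / 2], on which the truncation in [lacunary] relies. *)
Definition freq t : R := 2 ^+ (5 * t.+1).

(** The spacing 5 exceeds 4, the side of the box $[-2,2]^n$ that contains the support of the bump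
    used for the packets. *)
Definition shift t : 'rV[R]_n := (5 * t)%:R *: delta_mx ord0 i0.

Definition lacunary_term t xi : R[i] :=
  expi (dotv (shift t) xi) * psi ((freq t)^-1 *: xi).

(* Only the terms with [freq t <= 2 * enorm xi] are nonzero at [xi], and
   [t < freq t / 2]. *)
Definition lacunary xi : R[i] :=
  \sum_(t < Num.truncn (enorm xi)) lacunary_term t xi.

Lemma freq_gt0 t : 0 < freq t. Proof. by rewrite exprn_gt0. Qed.

Lemma psi_neq0 x : psi x != 0 -> 2^-1 <= enorm x <= 2.
Proof. by move=> px; apply: psi_supp; exact: subset_closure. Qed.

Lemma psi_scaled_neq0 (c : R) x : 0 < c -> psi (c^-1 *: x) != 0 ->
  c / 2 <= enorm x <= 2 * c.
Proof.
move=> c0 /psi_neq0; rewrite enormZ gtr0_norm ?invr_gt0// => /andP[h1 h2].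
by rewrite -ler_pdivlMl// h1 mulrC -ler_pdivrMl ?h2.
Qed.

Lemma lacunary_term_neq0 t xi : lacunary_term t xi != 0 ->
  freq t / 2 <= enorm xi <= 2 * freq t.
Proof.
rewrite mulf_eq0 negb_or => /andP[_]; exact/psi_scaled_neq0/freq_gt0.
Qed.

Lemma freq_le t t' : freq t <= 16 * freq t' -> (t <= t')%N.
Proof.
rewrite (_ : 16 * freq t' = 2 ^+ (4 + 5 * t'.+1)); last first.
  by rewrite /freq exprD; congr (_ * _); rewrite -natrX.
rewrite /freq ler_eXn2l ?ltr1n// !mulnS; move: t t'; lia.
Qed.

Lemma lt_freq t : t.+1%:R <= freq t / 2.
Proof.
rewrite /freq ler_pdivlMr// -natrM -natrX ler_nat.
rewrite (_ : 5 * t.+1 = t.+1 + (4 * t.+1 - 1).+1)%N; last lia.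
by rewrite expnD leq_mul//; [exact/ltnW/ltn_expl|rewrite expnS leq_pmulr// expn_gt0].
Qed.

Lemma lacunaryE t xi : freq t / 2 <= enorm xi <= 2 * freq t ->
  lacunary xi = lacunary_term t xi.
Proof.
move=> /andP[h1 h2].
have tN : (t < Num.truncn (enorm xi))%N.
  rewrite -ltnS; have := Num.Theory.truncnS_gt (enorm xi); move: (lt_freq t) => h3 h4.
  have := le_lt_trans (le_trans h3 h1) h4; rewrite ltr_nat; exact.
rewrite /lacunary (bigD1 (Ordinal tN))//= big1 ?addr0// => i it.
apply/eqP; apply: contraNT it => /lacunary_term_neq0/andP[h3 h4].
apply/eqP/val_inj => /=; apply/eqP; rewrite eqn_leq; apply/andP; split.
  by apply: freq_le; move: h1 h2 h3 h4 (freq_gt0 t) (freq_gt0 i); lra.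
by apply: freq_le; move: h1 h2 h3 h4 (freq_gt0 t) (freq_gt0 i); lra.
Qed.

Lemma lacunary_neq0 xi : lacunary xi != 0 ->
  exists t, lacunary_term t xi != 0.
Proof.
move=> Mxi; apply: contrapT => /forallNP h; move/eqP: Mxi; apply.
by apply: big1 => t _; apply/eqP; move/negP: (h t); rewrite negbK.
Qed.

Lemma lacunary_bounded : exists2 B : R, 0 <= B & forall xi,
  Normc.normc (lacunary xi) <= B.
Proof.
have [B B0 pB] : exists2 B : R, 0 <= B & forall x, Normc.normc (psi x) <= B.
  have [C C0 pC] := schwartz_weight spsi; exists C => // x.
  by rewrite (le_trans (pC x))// ler_piMr// weight_le1.
exists B => // xi; have [->|/lacunary_neq0[t tn0]] := eqVneq (lacunary xi) 0.
  by rewrite Normc.normc0.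
rewrite (lacunaryE (lacunary_term_neq0 tn0)) Normc.normcM normc_expi mul1r.
exact: pB.
Qed.

(** The number of terms varies with [xi]. The sums with a fixed number of terms are measurable and,
    at each point, eventually equal to [lacunary]. *)
Lemma cmeas_lacunary : cmeas lacunary.
Proof.
have mt t : cmeas (lacunary_term t).
  apply: cmeasM; first by apply: cdiff_cmeas; exact: cdiff_expi.
  have := measurable_affine_rV (freq t)^-1 (0 : 'rV[R]_n).
  by under eq_fun do rewrite addr0; exact: (cmeas_comp (schwartz_cmeas spsi)).
pose MN N xi : R[i] := \sum_(t <- iota 0 N) lacunary_term t xi.
have mMN N : cmeas (MN N) by apply: cmeas_sum => t; exact: mt.
have MNE N xi : (Num.truncn (enorm xi) <= N)%N -> MN N xi = lacunary xi.
  move=> NT; rewrite /MN /lacunary -(big_mkord xpredT (fun t => lacunary_term t xi)).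
  rewrite -(subnKC NT) iotaD big_cat/= /index_iota subn0 addrC big1_seq ?add0r//.
  move=> t /andP[_]; rewrite mem_iota add0n => /andP[Tt _].
  apply/eqP; apply: contraTT Tt => /lacunary_term_neq0/andP[h1 _].
  rewrite -ltnNge -ltnS; have := Num.Theory.truncnS_gt (enorm xi) => h4.
  have := le_lt_trans (le_trans (lt_freq t) h1) h4; rewrite ltr_nat; exact.
split.
  apply: (@measurable_fun_cvg _ _ _ _ (fun N xi => complex.Re (MN N xi))) => [N|xi _].
    exact: (mMN N).1.
  apply: cvg_near_cst; exists (Num.truncn (enorm xi)) => // N /= NT.
  by rewrite MNE.
apply: (@measurable_fun_cvg _ _ _ _ (fun N xi => complex.Im (MN N xi))) => [N|xi _].
  exact: (mMN N).2.
apply: cvg_near_cst; exists (Num.truncn (enorm xi)) => // N /= NT.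
by rewrite MNE.
Qed.

Definition localized j x : R[i] := lacunary (2 ^ j *: x) * psi x.

Lemma localized_cintegrable j : cintegrable lebesgue_rV (localized j).
Proof.
have [B B0 MB] := lacunary_bounded.
apply: (cintegrableMbound _ (fun x => MB _) (schwartz_cintegrable spsi)).
have := measurable_affine_rV (2 ^ j) (0 : 'rV[R]_n).
by under eq_fun do rewrite addr0; exact: (cmeas_comp cmeas_lacunary).
Qed.

(** The change of variables $x\mapsto 2^jx$, for the class of test functions that [Lp_norm_block]
    requires. *)
Lemma dilated_lacunaryE j (G : 'rV[R]_n -> R[i]) : cmeas G ->
  (exists B : R, forall x, Normc.normc (G x) <= B) ->
  mul_distr psi (dilate_distr (2 ^ j) (distr_of_fun lacunary)) G =
  distr_of_fun (localized j) G.
Proof.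
move=> mG [B GB]; pose c : R := 2 ^ j.
have c0 : 0 < c by rewrite exprz_gt0.
have c'0 : 0 < c^-1 by rewrite invr_gt0.
have ki : cintegrable lebesgue_rV (fun x => G x * localized j x).
  exact: (cintegrableMbound mG GB (localized_cintegrable j)).
have := cintegrable_affine 0 c'0 ki.
under eq_fun do rewrite addr0.
move=> fi; have := cintegral_affine 0 c0 fi.
rewrite /mul_distr /dilate_distr /distr_of_fun -/c.
rewrite (_ : (fun x => _) = (fun x => localized j x * G x)); last first.
  by apply/funext => x; rewrite addr0 scalerA mulVf ?gt_eqF// scale1r mulrC.
rewrite (_ : (fun x => G _ * _) =
    (fun x => lacunary x * (psi (c^-1 *: x) * G (c^-1 *: x)))); last first.
  apply/funext => x; rewrite /localized -/c scalerA mulfV ?gt_eqF// scale1r.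
  by rewrite mulrC mulrA.
move=> <-; rewrite mulrA -rmorphM/= mulVf ?mul1r// gt_eqF// exprn_gt0//.
Qed.

(** If some point contributes, through the term [t], then $2^{-2}\le 2^j/\mathrm{freq}(t)\le 2^2$
    because [psi] lives on $1/2\le|x|\le 2$. The ratio is thus one of the five powers $2^{d-2}$ with
    $0\le d\le 4$, and the phase becomes that of [2 ^ j *: shift t]. *)
Lemma localizedE j : (forall x, localized j x = 0) \/
  exists b (d : 'I_5), forall x, localized j x =
    expi (dotv b x) * (psi ((2 ^ (d%:Z - 2)) *: x) * psi x).
Proof.
have c0 : 0 < 2 ^ j :> R by rewrite exprz_gt0.
have [h|/existsNP[x /eqP]] := pselect (forall x, localized j x = 0); [by left|].
rewrite mulf_eq0 negb_or => /andP[/lacunary_neq0[t tx] /psi_neq0/andP[x1 x2]].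
right; have := lacunary_term_neq0 tx; rewrite enormZ gtr0_norm// => /andP[h1 h2].
have f0 := freq_gt0 t.
have j1 : freq t <= 4 * 2 ^ j by nra.
have j2 : 2 ^ j <= 4 * freq t by nra.
pose d : int := j - (5 * t.+1)%:Z + 2.
have dE : 2 ^ (d - 2) = 2 ^ j / freq t :> R.
  by rewrite /d addrK expfzDr ?pnatr_eq0// -exprnN.
have [d0 d5] : 0 <= d /\ d < 5.
  have lo : 2 ^ (-2) <= 2 ^ (d - 2) :> R.
    have -> : 2 ^ (-2) = 4^-1 :> R.
      by rewrite (_ : -2 = - 2%:Z)// -exprnN -natrX.
    rewrite dE ler_pdivlMr//; lra.
  have hi : 2 ^ (d - 2) <= 2 ^ 2 :> R.
    have -> : 2 ^ 2 = 4 :> R by rewrite (_ : 2 = 2%:Z)// -exprnP -natrX.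
    by rewrite dE ler_pdivrMr.
  move: lo hi; rewrite !ler_eXz2l ?ltr1n//; lia.
have dk : (`|d| < 5)%N by lia.
exists (2 ^ j *: shift t), (Ordinal dk) => y.
have -> : 2 ^ ((Ordinal dk)%:Z - 2) = 2 ^ j / freq t :> R.
  by rewrite -dE /=; congr (2 ^ (_ - 2)); lia.
rewrite mulrA dotvZl -dotvZr.
rewrite [2 ^ j / _]mulrC -scalerA -/(lacunary_term t (2 ^ j *: y)) /localized.
have [->|/psi_neq0/andP[y1 y2]] := eqVneq (psi y) 0; first by rewrite !mulr0.
(* At another point [y], either the multiplier vanishes, and then so does its term [t], or some term
   [t'] is active; both frequencies are then within a factor 4 of [2 ^ j], which forces [t' = t]. *)
congr (_ * _); have [M0|/lacunary_neq0[t' t'y]] := eqVneq (lacunary (2 ^ j *: y)) 0.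
  rewrite M0; apply/esym/eqP; apply: contraTT isT => ty.
  by move: (ty); rewrite -(lacunaryE (lacunary_term_neq0 ty)) M0 eqxx.
have hy := lacunary_term_neq0 t'y; rewrite (lacunaryE hy); congr lacunary_term.
move: hy; rewrite enormZ gtr0_norm// => /andP[h3 h4].
have f'0 := freq_gt0 t'.
have j3 : freq t' <= 4 * 2 ^ j by nra.
have j4 : 2 ^ j <= 4 * freq t' by nra.
by apply/eqP; rewrite eqn_leq !freq_le//; lra.
Qed.

(** A modulation translates the transform, so only the centre [b] depends on [j]; [C] is the sum of
    the decay constants of the five possible profiles. *)
Lemma fourier_localized : exists2 C : R, 0 <= C & forall j, exists b, forall y,
  Normc.normc (fourier (localized j) y) <= C * weight (y - b).
Proof.
have sPsi (d : 'I_5) : schwartz (fun x => psi ((2 ^ (d%:Z - 2)) *: x) * psi x).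
  apply: schwartzM => //; apply: schwartz_bsmooth.
  have := @schwartz_affine R n psi (2 ^ (d%:Z - 2)) 0 _ spsi.
  under eq_fun do rewrite addr0; apply.
  by rewrite gt_eqF// exprz_gt0.
have /choice[C CP] : forall d : 'I_5, exists C : R, 0 <= C /\ forall xi, Normc.normc
    (fourier (fun x => psi ((2 ^ (d%:Z - 2)) *: x) * psi x) xi) <= C * weight xi.
  by move=> d; have [C C0 CP] := fourier_decay (sPsi d); exists C.
have S0 : 0 <= \sum_d C d by apply: sumr_ge0 => d _; have [] := CP d.
exists (\sum_d C d) => // j; have [h0|[b [d hE]]] := localizedE j.
  exists 0 => y; rewrite (_ : localized j = fun=> 0); last exact/funext.
  rewrite /fourier (_ : (fun x => _) = fun=> 0); last by apply/funext => x; rewrite mulr0.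
  by rewrite cintegralE cint0 Normc.normc0 mulr_ge0// weight_ge0.
exists b => y; rewrite (_ : localized j = wave_packet
    (fun x => psi ((2 ^ (d%:Z - 2)) *: x) * psi x) b 0); last first.
  by apply/funext => x; rewrite hE /wave_packet !subr0.
rewrite fourier_wave_packet// Normc.normcM normc_expi mul1r.
apply: (le_trans ((CP d).2 _)); rewrite ler_wpM2r ?weight_ge0//.
by rewrite (bigD1 d)//= lerDl sumr_ge0// => k _; have [] := CP k.
Qed.

End lacunary_multiplier.

(** * A bump function and the modulation norms of the pieces *)

Section bump.
Context (R : realType) (n : nat) (phi : 'rV[R]_n -> R[i]).
Hypothesis hphi : unity_partition phi.

Lemma unity_partition_neq0 : exists x, phi x != 0.
Proof.
have [_ _ /(_ 0) sum1] := hphi; apply: contrapT => /forallNP h.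
have phi0 x : phi x = 0 by apply/eqP; move/negP: (h x); rewrite negbK.
move: sum1; under eq_fsbigr do rewrite phi0.
by rewrite fsbig1// => /eqP; rewrite eq_sym oner_eq0.
Qed.

Lemma unity_partition_supp x : phi x != 0 -> forall i, -1 <= x ord0 i <= 1.
Proof. by have [_ h _] := hphi; move=> px; apply: h; exact: subset_closure. Qed.

(** A bump is extracted from the given partition of unity: $e(x)=|\phi(x+x_0)|^2$ where
    $\phi(x_0)\ne 0$. The radius 2 arises because both $x+x_0$ and $x_0$ lie in $[-1,1]^n$. The same
    [e] serves as the kernel of the $L^2$ bound and as the envelope of the packets. *)
Lemma bump_exists : exists e : 'rV[R]_n -> R, [/\ schwartz (fun x => (e x)%:C),
  forall x, 0 <= e x, 0 < e 0 & forall x, e x != 0 -> forall i, `|x ord0 i| <= 2].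
Proof.
have [sphi _ _] := hphi; have [x0 px0] := unity_partition_neq0.
exists (fun x => Normc.normc (phi (x + x0)) ^+ 2); split.
- have sx : schwartz (fun x => phi (x + x0)).
    have := schwartz_affine x0 (oner_neq0 R) sphi.
    by under eq_fun do rewrite scale1r.
  have := schwartzM (schwartz_bsmooth sx) (schwartz_conj sx).
  by under eq_fun do rewrite mul_conj_normc.
- by move=> x; rewrite exprn_ge0// normc_ge0.
- rewrite exprn_gt0// add0r lt_def normc_ge0 andbT.
  by apply: contraNN px0 => /eqP/Normc.eq0_normc ->.
- move=> x; rewrite expf_eq0/= => px i.
  have px' : phi (x + x0) != 0 by apply: contraNN px => /eqP ->; rewrite Normc.normc0.
  have := unity_partition_supp px' i; have := unity_partition_supp px0 i.
  by rewrite !mxE ler_norml => /andP[? ?] /andP[? ?]; apply/andP; split; lra.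
Qed.

End bump.

Section modulation_norm_of_lacunary.
Context (R : realType) (n : nat) (i0 : 'I_n) (phi psi : 'rV[R]_n -> R[i]).
Hypotheses (hphi : unity_partition phi) (spsi : schwartz psi)
  (psi_supp : supp psi `<=` [set xi | 2^-1 <= enorm xi <= 2]).

(** On the support of [phi] translated by [k], the decay around [b] is comparable with [weight] at
    $k-b$, at the price of $3^n$. The blocks are thus dominated by a lattice sum whose bound does
    not involve [b], the only quantity that varies with [j]. *)
Lemma lacunary_modulation_norm : exists K : R, forall j : int,
  (modulation_norm phi 2%:E 1%:E 0 (mul_distr psi
    (dilate_distr (2 ^ j) (distr_of_fun (lacunary i0 psi)))) <= K%:E)%E.
Proof.
have [e [se e_ge0 e0 _]] := bump_exists hphi.
have [sphi _ _] := hphi.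
have [B B0 pB] : exists2 B : R, 0 <= B & forall x, Normc.normc (phi x) <= B.
  have [C C0 pC] := schwartz_weight sphi; exists C => // x.
  by rewrite (le_trans (pC x))// ler_piMr// weight_le1.
have [C C0 hC] := fourier_localized i0 spsi psi_supp.
pose D := (two_pi_n R n ^+ 2 * (fine (\int[lebesgue_rV]_z
  (Normc.normc (fourier (fun x => (e x)%:C) z))%:E) * 2 ^+ n / e 0)) `^ 2^-1.
have D0 : 0 <= D by exact: powR_ge0.
pose W := (\int[@lebesgue_rV R n]_x (weight x)%:E)%E.
have Wfin : W \is a fin_num.
  rewrite ge0_fin_numE ?integral_weight_lty//.
  by apply: integral_ge0 => x _; rewrite lee_fin weight_ge0.
pose E := D * (B * (C * 3 ^+ n)).
have E0 : 0 <= E by rewrite !mulr_ge0// exprn_ge0.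
exists (E * (3 ^+ n * fine W)) => j.
set u := mul_distr _ _; have [b hb] := hC j.
have block k : (Lp_norm 2%:E (fmultiplier (fun xi => phi (xi - intv R k)) u) <=
    (E * weight (intv R k - b))%:E)%E.
  have A0 : 0 <= B * (C * 3 ^+ n) * weight (intv R k - b).
    by rewrite !mulr_ge0 ?weight_ge0// exprn_ge0.
  rewrite /E -mulrA.
  apply: (Lp_norm_block (h := localized i0 psi j) (b := intv R k)) => //.
  - by apply: cmeas_shift; exact: schwartz_cmeas.
  - by exists B.
  - by move=> x; exact: unity_partition_supp.
  - exact: localized_cintegrable.
  - by move=> G mG GB; exact: dilated_lacunaryE.
  - move=> y; rewrite Normc.normcM.
    have [->|py] := eqVneq (phi (y - intv R k)) 0; first by rewrite Normc.normc0 mul0r.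
    rewrite -mulrA; apply: ler_pM; rewrite ?normc_ge0//.
    apply: (le_trans (hb y)); rewrite -mulrA ler_wpM2l// weight_shift// => i.
    have := unity_partition_supp hphi py i.
    by rewrite !mxE ler_norml => /andP[? ?]; apply/andP; split; lra.
rewrite /modulation_norm invr1.
under eq_esum => k _.
  rewrite mul0r powRr0 mul1e poweRe1; last first.
    apply/ereal_infP => _ [h _ <-]; exact: Lnorm_ge0.
  over.
rewrite poweRe1; last first.
  by apply: esum_ge0 => k _; apply/ereal_infP => _ [h _ <-]; exact: Lnorm_ge0.
apply: le_trans (esum_weight_le E0 block) _.
by rewrite -/W -(fineK Wfin) -!EFinM.
Qed.

End modulation_norm_of_lacunary.

(** * Wave packets and unboundedness *)

Section lacunary_frequencies.
Context (R : realType) (n : nat) (i0 : 'I_n).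
Implicit Types (x y xi : 'rV[R]_n) (t j k : nat).

Definition lam t : 'rV[R]_n := freq R t *: delta_mx ord0 i0.

Lemma rV_subE x y i : (x - y) ord0 i = x ord0 i - y ord0 i.
Proof. by rewrite !mxE. Qed.

Lemma lam_i0 t : lam t ord0 i0 = freq R t.
Proof. by rewrite !mxE !eqxx mulr1. Qed.

Lemma enorm_lam t : enorm (lam t) = freq R t.
Proof.
rewrite enormZ gtr0_norm ?freq_gt0// /enorm /dotv (bigD1 i0)//= big1 => [|i ii0].
  by rewrite !mxE !eqxx mulr1 addr0 sqrtr1 mulr1.
by rewrite !mxE (negbTE ii0) andbF mulr0.
Qed.

(** Interactions between frequencies are measured by $2^{-j-k}$, rather than by a function of
    $|j-k|$, so that their double sum stays bounded as the number of packets grows. *)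
Definition geo j k : R := (2 ^+ j)^-1 * (2 ^+ k)^-1.

Lemma geo_gt0 j k : 0 < geo j k.
Proof. by rewrite mulr_gt0// invr_gt0 exprn_gt0. Qed.

Lemma geo_ge0 j k : 0 <= geo j k. Proof. exact/ltW/geo_gt0. Qed.

Lemma sum_geo_le N : \sum_(j < N) \sum_(k < N) geo j k <= 4.
Proof.
have S : \sum_(j < N) (2 ^+ j)^-1 <= 2 :> R.
  suff -> : \sum_(j < N) (2 ^+ j)^-1 = 2 - 2 * (2 ^+ N)^-1 :> R.
    by rewrite gerBl mulr_ge0// invr_ge0 exprn_ge0.
  elim: N => [|N IH]; first by rewrite big_ord0 expr0 invr1 mulr1 subrr.
  by rewrite big_ord_recr/= IH exprS invfM; field; rewrite expf_neq0.
have S0 : 0 <= \sum_(j < N) (2 ^+ j)^-1 :> R.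
  by apply: sumr_ge0 => j _; rewrite invr_ge0 exprn_ge0.
under eq_bigr do rewrite -mulr_sumr.
rewrite -mulr_suml (_ : 4 = 2 * 2); last by ring.
exact: ler_pM.
Qed.

(** Since [freq R k / 4] is at least $2^k$, which is at least $2^j$, the square of [r] is at least
    $2^{j+k}$. *)
Lemma geo_freq (r : R) j k : freq R k / 4 <= r -> (j <= k)%N ->
  (1 + r ^+ 2)^-1 <= geo j k.
Proof.
move=> rk jk; rewrite /geo -invfM lef_pV2 ?posrE ?mulr_gt0 ?exprn_gt0 ?oneD_sqr_gt0//.
have k0 : 0 < freq R k := freq_gt0 R k.
have h2 : 2 ^+ k <= freq R k / 4.
  rewrite ler_pdivlMr// (_ : 4 = 2 ^+ 2); last by rewrite -natrX.
  by rewrite -exprD ler_weXn2l ?ler1n//; lia.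
have h1 : 2 ^+ j <= freq R k / 4 by apply: le_trans h2; rewrite ler_weXn2l ?ler1n.
have p1 : 0 < 2 ^+ j :> R by rewrite exprn_gt0.
have p2 : 0 < 2 ^+ k :> R by rewrite exprn_gt0.
apply: (@le_trans _ _ (r ^+ 2)); last by rewrite lerDr.
by rewrite expr2 ler_pM ?(ltW p1) ?(ltW p2)// (le_trans _ rk).
Qed.

Lemma freq_gap j k : (j < k)%N -> freq R j <= freq R k / 2.
Proof.
move=> jk; rewrite ler_pdivlMr// -exprSr ler_weXn2l ?ler1n//; lia.
Qed.

Lemma geoC j k : geo j k = geo k j. Proof. by rewrite /geo mulrC. Qed.

Lemma weight_gap j k : j != k -> weight (lam j - lam k) <= geo j k.
Proof.
wlog jk : j k / (j < k)%N => [H|].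
  rewrite neq_ltn => /orP[jk|kj]; first by apply: H => //; rewrite ltn_eqF.
  by rewrite -weightN opprB geoC; apply: H => //; rewrite ltn_eqF.
move=> _; rewrite -weightN opprB; apply: (le_trans (weight_le_coord _ i0)).
rewrite rV_subE !lam_i0; apply: geo_freq; last exact: ltnW.
have := freq_gap jk; have := freq_gt0 R k; lra.
Qed.

(** A point cannot be close to both centres: one of the two weights is at most [geo j k], and the
    other one is kept to ensure integrability in [xi]. *)
Lemma weight_mul_gap j k xi : j != k ->
  weight (xi - lam j) * weight (xi - lam k) <=
  geo j k * (weight (xi - lam j) + weight (xi - lam k)).
Proof.
wlog jk : j k / (j < k)%N => [H|].
  rewrite neq_ltn => /orP[jk|kj]; first by apply: H => //; rewrite ltn_eqF.
  have := H k j kj; rewrite ltn_eqF// geoC => /(_ isT).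
  by rewrite [weight _ * weight _]mulrC [weight _ + weight _]addrC.
move=> _.
have g0 := geo_ge0 j k; have Wj := weight_ge0 (xi - lam j).
have Wk := weight_ge0 (xi - lam k).
have cj : weight (xi - lam j) <= (1 + (xi ord0 i0 - freq R j) ^+ 2)^-1.
  by apply: (le_trans (weight_le_coord _ i0)); rewrite rV_subE lam_i0.
have ck : weight (xi - lam k) <= (1 + (xi ord0 i0 - freq R k) ^+ 2)^-1.
  by apply: (le_trans (weight_le_coord _ i0)); rewrite rV_subE lam_i0.
have := freq_gap jk; have k0 := freq_gt0 R k => gap.
have [h|h] := lerP (freq R k / 4) (xi ord0 i0 - freq R j).
  have hj := le_trans cj (geo_freq h (ltnW jk)).
  have := ler_wpM2r Wk hj; have := mulr_ge0 g0 Wj; rewrite mulrDr; lra.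
have h' : freq R k / 4 <= - (xi ord0 i0 - freq R k) by lra.
have hk : weight (xi - lam k) <= geo j k.
  by apply: (le_trans ck); rewrite -sqrrN; exact: geo_freq h' (ltnW jk).
have := ler_wpM2l Wj hk; have := mulr_ge0 g0 Wk; rewrite mulrDr; lra.
Qed.

Lemma enorm_ge_diff x y : enorm x - enorm y <= enorm (x - y).
Proof. by rewrite lerBlDr -{1}(subrK y x) enormD. Qed.

Lemma enormN x : enorm (- x) = enorm x.
Proof. by rewrite -scaleN1r enormZ normrN normr1 mul1r. Qed.

(** The outer bounds 2 and $1/2$ place the annulus where [psi] is bounded below inside its support
    annulus. The inner bounds $5/4$ and $3/4$ ensure that a point off the scaled annulus has
    $\bigl||\xi|-\mathrm{freq}\bigr|\ge \mathrm{freq}/4$, as [geo_freq] asks. *)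
Lemma sqrt2_bounds : 5 / 4 <= (2 : R) `^ 2^-1 <= 2 /\
  2^-1 <= (2 : R) `^ (- 2^-1) <= 3 / 4.
Proof.
have s0 : 0 < (2 : R) `^ 2^-1 by rewrite powR_gt0.
have ss : (2 : R) `^ 2^-1 * (2 : R) `^ 2^-1 = 2.
  by rewrite powR12_sqrt// -expr2 sqr_sqrtr.
have sN : (2 : R) `^ (- 2^-1) * (2 : R) `^ 2^-1 = 1.
  by rewrite powRN mulVf// gt_eqF.
move: s0 ss sN; set a := _ `^ _; set b := _ `^ (- _) => s0 ss sN.
have a1 : 5 / 4 <= a by nra.
have a2 : a <= 2 by nra.
split; first by rewrite a1 a2.
by apply/andP; split; nra.
Qed.

End lacunary_frequencies.

(** * The pairing of two packets through the multiplier *)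

Section pairing.
Context (R : realType) (n : nat) (i0 : 'I_n) (psi : 'rV[R]_n -> R[i])
  (e : 'rV[R]_n -> R) (c : R).
Hypotheses (spsi : schwartz psi) (c0 : 0 < c)
  (psi_ge : forall xi : 'rV[R]_n,
    2 `^ (- 2^-1) <= enorm xi <= 2 `^ 2^-1 -> c%:C <= psi xi)
  (psi_supp : supp psi `<=` [set xi | 2^-1 <= enorm xi <= 2])
  (se : schwartz (fun x => (e x)%:C)).
Implicit Types (x y xi : 'rV[R]_n) (t j k : nat).
Local Notation lam := (lam R i0).
Local Notation geo := (geo R).

Let eta x : R[i] := (e x)%:C.

(* On the annulus where [psi] is bounded below by [c], the phases of the
   packets cancel that of the multiplier; off the annulus the packet is
   exponentially small in [j]. *)
Lemma pairing_pointwise : exists2 K : R, 0 <= K & forall j k (b b' xi : 'rV[R]_n),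
  (j = k -> shift R i0 j - b + b' = 0) ->
  (j == k)%:R * (c * Normc.normc (fourier eta (xi - lam j)) ^+ 2) -
    K * geo j k * (weight (xi - lam j) + weight (xi - lam k)) <=
  complex.Re (lacunary i0 psi xi * ((expi (- dotv xi b) * fourier eta (xi - lam j)) *
    conjc (expi (- dotv xi b') * fourier eta (xi - lam k)))).
Proof.
have [B B0 MB] := lacunary_bounded i0 spsi psi_supp.
have [D D0 eD] := fourier_decay se.
(* [B] pays for the size of the integrand, and [c] for the diagonal main term, which is claimed also
   at points where [psi] gives no lower bound. *)
pose K := (B + c) * D ^+ 2.
have K0 : 0 <= K by rewrite mulr_ge0// ?sqr_ge0// addr_ge0// ltW.
exists K => // j k b b' xi phase.
set fj := fourier eta (xi - lam j); set fk := fourier eta (xi - lam k).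
have fjk : j = k -> fk = fj by move=> jk; rewrite /fk -jk.
have fjD : Normc.normc fj <= D * weight (xi - lam j) := eD _.
have fkD : Normc.normc fk <= D * weight (xi - lam k) := eD _.
clearbody fj fk.
have f0 := freq_gt0 R j.
have [[s1 s2] [s3 s4]] : (5 / 4 <= (2 : R) `^ 2^-1 /\ (2 : R) `^ 2^-1 <= 2) /\
  (2^-1 <= (2 : R) `^ (- 2^-1) /\ (2 : R) `^ (- 2^-1) <= 3 / 4).
  by have [/andP[? ?] /andP[? ?]] := sqrt2_bounds R.
have Mann : 2 `^ (- 2^-1) * freq R j <= enorm xi <= 2 `^ 2^-1 * freq R j ->
    lacunary i0 psi xi = lacunary_term i0 psi j xi.
  by move=> /andP[a1 a2]; apply: lacunaryE => //; apply/andP; split; nra.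
move: (MB xi) Mann; move: (lacunary i0 psi xi) => Mx MBx Mann.
set z := (X in complex.Re X).
have Wj := weight_ge0 (xi - lam j); have Wk := weight_ge0 (xi - lam k).
have zB : Normc.normc z <= B * (D ^+ 2 * (weight (xi - lam j) * weight (xi - lam k))).
  rewrite /z !Normc.normcM normc_conj !Normc.normcM !normc_expi !mul1r.
  apply: ler_pM; rewrite ?mulr_ge0 ?normc_ge0//.
  apply: (le_trans (ler_pM _ _ fjD fkD)); rewrite ?normc_ge0//.
  by rewrite le_eqVlt; apply/orP; left; apply/eqP; ring.
have zRe : - (B * (D ^+ 2 * (weight (xi - lam j) * weight (xi - lam k)))) <= complex.Re z.
  rewrite lerNl; apply: le_trans zB; apply: le_trans (abs_Re_le z).
  by rewrite -normrN ler_norm.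
have D2 := sqr_ge0 D.
have [jk|jk] := eqVneq j k; last first.
  rewrite mul0r sub0r; apply: le_trans zRe; rewrite lerN2.
  have h := weight_mul_gap i0 xi jk.
  have := ler_wpM2l (mulr_ge0 B0 D2) h.
  have WW : 0 <= geo j k * (weight (xi - lam j) + weight (xi - lam k)).
    by rewrite mulr_ge0 ?geo_ge0 ?addr_ge0.
  have := mulr_ge0 (mulr_ge0 (ltW c0) D2) WW.
  rewrite /K; lra.
rewrite mul1r; subst k; rewrite (fjk erefl) in z zB zRe *.
have WW : 0 <= K * geo j j * (weight (xi - lam j) + weight (xi - lam j)).
  by rewrite mulr_ge0 ?addr_ge0// mulr_ge0 ?geo_ge0.
have [/andP[a1 a2]|nann] := boolP (2 `^ (- 2^-1) * freq R j <= enorm xi <= 2 `^ 2^-1 * freq R j).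
  have Mxi := Mann (introT andP (conj a1 a2)).
  have : c%:C <= psi ((freq R j)^-1 *: xi).
    apply: psi_ge; rewrite enormZ gtr0_norm ?invr_gt0//.
    by rewrite ler_pdivlMl// ler_pdivrMl// [freq R j * _]mulrC a1 [freq R j * _]mulrC a2.
  (* The order on complex numbers requires equal imaginary parts, so [psi] is real at this point and
     the diagonal product is a real multiple of $|\widehat e|^2$. *)
  rewrite lecE => /andP[/eqP /= Im0 Rec].
  have -> : z = psi ((freq R j)^-1 *: xi) * (fj * conjc fj).
    rewrite /z Mxi /lacunary_term !conjcM conj_expi opprK.
    transitivity ((expi (dotv (shift R i0 j) xi) * expi (- dotv xi b) * expi (dotv xi b')) *
      (psi ((freq R j)^-1 *: xi) * (fj * conjc fj))); first by ring.
    rewrite -!expiD [dotv (shift _ _ _) _]dotvC -dotvBr -dotvDr phase//.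
    by rewrite linear0 expi0 mul1r.
  rewrite mul_conj_normc ReM /= mulr0 subr0.
  have : c * Normc.normc fj ^+ 2 <= complex.Re (psi ((freq R j)^-1 *: xi)) * Normc.normc fj ^+ 2.
    by rewrite ler_wpM2r// sqr_ge0.
  lra.
(* Off the annulus the distance from [xi] to the centre is at least a quarter of the frequency,
   whether [xi] is too short or too long. *)
have gj : weight (xi - lam j) <= geo j j.
  apply: (le_trans (weight_le_enorm _)); apply: geo_freq => //.
  have e1 := enorm_ge_diff xi (lam j); have e2 := enorm_ge_diff (lam j) xi.
  rewrite -[enorm (_ - _)]enormN opprB in e2; rewrite enorm_lam in e1 e2.
  move: nann; rewrite negb_and -!ltNge => /orP[a|a]; nra.
have nf : Normc.normc fj ^+ 2 <= (D * weight (xi - lam j)) ^+ 2.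
  by rewrite lerXn2r// nnegrE ?normc_ge0// mulr_ge0.
have := ler_wpM2l (ltW c0) nf.
have := ler_wpM2l K0 (ler_wpM2r Wj gj).
have := mulr_ge0 (mulr_ge0 K0 (geo_ge0 R j j)) Wj.
move: zRe WW; rewrite /K !expr2; lra.
Qed.

End pairing.

(** * Positivity of the diagonal term *)

Section positivity.
Context (R : realType) (n : nat).
Implicit Types (x xi : 'rV[R]_n).

Lemma centered_boxE (r : R) : [set x : 'rV[R]_n | forall i, `|x ord0 i| <= r] =
  [set x | forall i, (`[- r, r]%classic : set (measurableTypeR R)) (x ord0 i)].
Proof.
by apply/seteqP; split => x /= h i; have := h i; rewrite /= in_itv/= ler_norml.
Qed.

Lemma measurable_centered_box (r : R) :
  measurable [set x : 'rV[R]_n | forall i, `|x ord0 i| <= r].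
Proof.
rewrite centered_boxE.
exact: (@measurable_box R n (fun=> `[- r, r]%classic) (fun=> measurable_itv _)).
Qed.

Lemma lebesgue_centered_box (r : R) : 0 < r ->
  lebesgue_rV [set x : 'rV[R]_n | forall i, `|x ord0 i| <= r] = ((2 * r) ^+ n)%:E.
Proof.
move=> r0; rewrite centered_boxE.
rewrite (@lebesgue_rV_box R n (fun=> `[- r, r]%classic) (fun=> measurable_itv _)).
under eq_bigr => i _.
  rewrite lebesgue_measure_itv/= lte_fin gtrN// -EFinB opprK -mulr2n -mulr_natl.
  over.
by rewrite prodEFin prodr_const card_ord.
Qed.

Lemma Re_cint_le (f g : 'rV[R]_n -> R[i]) :
  cintegrable lebesgue_rV f -> cintegrable lebesgue_rV g ->
  (forall x, complex.Re (f x) <= complex.Re (g x)) ->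
  complex.Re (cintegral f) <= complex.Re (cintegral g).
Proof.
move=> fi gi fg; rewrite /cintegral /=; apply: le_Rintegral => //.
- exact: integrable_Re.
- exact: integrable_Re.
Qed.

Lemma Re_cint_gt0 (g : 'rV[R]_n -> R) (d r : R) : 0 < d -> 0 < r ->
  cintegrable lebesgue_rV (fun x => (g x)%:C) -> (forall x, 0 <= g x) ->
  (forall x, (forall i, `|x ord0 i| <= r) -> d <= g x) ->
  0 < complex.Re (cintegral (fun x => (g x)%:C)).
Proof.
move=> d0 r0 gi g0 gd; pose Q := [set x : 'rV[R]_n | forall i, `|x ord0 i| <= r].
have mQ : measurable Q := measurable_centered_box r.
have muQ : lebesgue_rV Q = ((2 * r) ^+ n)%:E := lebesgue_centered_box r0.
have mg : measurable_fun setT (fun x => (g x)%:E) by apply/measurable_EFinP; exact: gi.1.1.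
have fin : (\int[lebesgue_rV]_x (g x)%:E)%E \is a fin_num.
  exact: (integrable_fin_num measurableT (integrable_Re gi)).
rewrite /cintegral /= /Rintegral -lte_fin fineK//.
apply: (@lt_le_trans _ _ (d%:E * ((2 * r) ^+ n)%:E)%E).
  by rewrite -EFinM lte_fin mulr_gt0// exprn_gt0// mulr_gt0.
have -> : ((2 * r) ^+ n)%:E = (\int[lebesgue_rV]_x (\1_Q x : R)%:E)%E.
  by rewrite integral_indic// setIT.
have mI : measurable_fun setT (fun y : 'rV[R]_n => (\1_Q y : R)%:E).
  by apply/measurable_EFinP; exact: measurable_indic.
rewrite -ge0_integralZl//; last by rewrite lee_fin ltW.
apply: ge0_le_integral => //.
- by move=> x _; rewrite -EFinM lee_fin mulr_ge0// ltW.
- exact: emeasurable_funM.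
- move=> x _; rewrite -EFinM lee_fin indicE.
  by have [/set_mem xQ|_] := boolP (x \in Q); rewrite ?mulr1 ?mulr0// gd.
Qed.

Variable e : 'rV[R]_n -> R.
Hypotheses (se : schwartz (fun x => (e x)%:C)) (e_ge0 : forall x, 0 <= e x)
  (e0 : 0 < e 0) (esupp : forall x, e x != 0 -> forall i, `|x ord0 i| <= 2).

Lemma bump_mass_gt0 : 0 < complex.Re (cintegral (fun x => (e x)%:C)).
Proof.
have ce : {for 0, continuous e}.
  by have [/differentiable_continuous] := schwartz_cdiff se 0.
have e2 : 0 < e 0 / 2 by rewrite divr_gt0.
have /cvgrPdist_lt/(_ _ e2)/nbhs_normP[r /= r0 hr] := ce.
have r2 : 0 < r / 2 by rewrite divr_gt0.
apply: (Re_cint_gt0 e2 r2) => //; first exact: schwartz_cintegrable.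
move=> x xr; have : `|e 0 - e x| < e 0 / 2.
  apply: hr; rewrite /ball_ /= sub0r normrN (@le_lt_trans _ _ (r / 2))//.
    by apply: norm_rV_le => //; exact: ltW.
  by rewrite ltr_pdivrMr// ltr_pMr// ltr1n.
by rewrite ltr_norml => /andP[_]; lra.
Qed.

(** For small [xi] the phase $\xi\cdot x$ has cosine at least $1/2$ on the support of [e], so the
    real part of the transform is at least half the mass of [e] on a box. *)
Lemma fourier_bump_L2_gt0 :
  0 < complex.Re (cintegral (fun xi => (Normc.normc (fourier (fun x => (e x)%:C) xi) ^+ 2)%:C)).
Proof.
have ei := schwartz_cintegrable se.
have /cvgrPdist_lt/(_ 2^-1)[] := @continuous_cos R 0; first by rewrite invr_gt0.
move=> /= del del0 hdel.
have cosd t : `|t| < del -> 2^-1 <= cos t.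
  move=> td; have := hdel t; rewrite /ball_ /= sub0r normrN => /(_ td).
  by rewrite cos0 ltr_norml => /andP[_]; lra.
pose m := complex.Re (cintegral (fun x => (e x)%:C)).
have m0 : 0 < m := bump_mass_gt0.
(* With $|\xi_i|\le r$ and $|x_i|\le 2$ the phase is at most $2nr=\mathrm{del}\cdot n/(n+1)$,
   strictly below [del]. *)
pose r := del / (2 * n.+1%:R).
have n0 : 0 < 2 * n.+1%:R :> R by rewrite mulr_gt0// ltr0n.
have r0 : 0 < r by rewrite divr_gt0.
apply: (@Re_cint_gt0 _ ((m / 2) ^+ 2) r) => //.
- by rewrite exprn_gt0// divr_gt0.
- have [C C0 fC] := osc_bounded (-1) ei; rewrite -fourierE in fC.
  have fi := fourier_cintegrable se.
  have h x : Normc.normc (conjc (fourier (fun x => (e x)%:C) x)) <= C.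
    by rewrite normc_conj; exact: fC.
  have := cintegrableMbound (cmeas_conj fi.1) h fi.
  by under eq_fun do rewrite mulrC mul_conj_normc.
- by move=> x; rewrite sqr_ge0.
- move=> xi xir.
  have Rem : m / 2 <= complex.Re (fourier (fun x => (e x)%:C) xi).
    have -> : m / 2 = complex.Re (cintegral (fun x => (2^-1)%:C * (e x)%:C)).
      by rewrite cintegralE cintZ// ReM /= mul0r subr0 mulrC.
    apply: Re_cint_le; first exact: cintegrableZ.
      by under eq_fun do rewrite -mulN1r; exact: cintegrable_osc.
    move=> x; rewrite !ReM /= !mulr0 !subr0.
    have [->|ex] := eqVneq (e x) 0; first by rewrite !mulr0.
    rewrite ler_wpM2r// cosN; apply: cosd.
    apply: (@le_lt_trans _ _ (\sum_(i < n) r * 2)).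
      apply: le_trans (ler_norm_sum _ _ _) _; apply: ler_sum => i _.
      by rewrite normrM; apply: ler_pM => //; exact: esupp.
    rewrite sumr_const card_ord -[_ *+ n]mulr_natr /r.
    have -> : del / (2 * n.+1%:R) * 2 * n%:R = del * (n%:R / n.+1%:R).
      by field; rewrite ?nat1r ?natr1 pnatr_eq0.
    by rewrite gtr_pMr// ltr_pdivrMr ?ltr0n// mul1r ltr_nat.
  have mp : 0 <= m / 2 by rewrite divr_ge0// ltW.
  rewrite lerXn2r// ?nnegrE ?normc_ge0//.
  by rewrite (le_trans Rem)// (le_trans (ler_norm _))// abs_Re_le.
Qed.

End positivity.

(** * Lower bound for the pairing of two packet families *)

Section pairing_integral.
Context (R : realType) (n : nat) (i0 : 'I_n) (psi : 'rV[R]_n -> R[i])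
  (e : 'rV[R]_n -> R) (c : R).
Hypotheses (spsi : schwartz psi) (c0 : 0 < c)
  (psi_ge : forall xi : 'rV[R]_n,
    2 `^ (- 2^-1) <= enorm xi <= 2 `^ 2^-1 -> c%:C <= psi xi)
  (psi_supp : supp psi `<=` [set xi | 2^-1 <= enorm xi <= 2])
  (se : schwartz (fun x => (e x)%:C)) (e_ge0 : forall x, 0 <= e x)
  (e0 : 0 < e 0) (esupp : forall x, e x != 0 -> forall i, `|x ord0 i| <= 2).
Implicit Types (x y xi : 'rV[R]_n) (t j k : nat) (b : nat -> 'rV[R]_n).

Let eta x : R[i] := (e x)%:C.

Definition packets N b x : R[i] :=
  \sum_(t < N) wave_packet (fun x => (e x)%:C) (lam R i0 t) (b t) x.

Lemma schwartz_packets N b : schwartz (packets N b).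
Proof. by apply: schwartz_sum => t; exact: schwartz_wave_packet. Qed.

Lemma fourier_packets N b xi : fourier (packets N b) xi =
  \sum_(t < N) expi (- dotv xi (b t)) * fourier eta (xi - lam R i0 t).
Proof.
have wi t : cintegrable lebesgue_rV
    (fun x => expi (- dotv xi x) * wave_packet eta (lam R i0 t) (b t) x).
  under eq_fun do rewrite -mulN1r.
  exact/cintegrable_osc/schwartz_cintegrable/schwartz_wave_packet.
rewrite /fourier cintegralE /packets.
under eq_cint do rewrite mulr_sumr.
rewrite (cint_sum _ (fun t : 'I_N => wi t)); apply: eq_bigr => t _.
exact: fourier_wave_packet.
Qed.

Lemma inv_fourier_conj f xi : schwartz f ->
  inv_fourier (fun x => conjc (f x)) xi = (two_pi_n R n)%:C * conjc (fourier f xi).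
Proof.
move=> sf; rewrite inv_fourierE fourierE osc_conj ?opprK//.
exact: schwartz_cintegrable.
Qed.

Lemma Re_sum (I : Type) (s : seq I) (F : I -> R[i]) :
  complex.Re (\sum_(i <- s) F i) = \sum_(i <- s) complex.Re (F i).
Proof.
elim: s => [|i s IH]; first by rewrite !big_nil.
by rewrite !big_cons ReD IH.
Qed.

Lemma conjc_sum (I : Type) (s : seq I) (F : I -> R[i]) :
  conjc (\sum_(i <- s) F i) = \sum_(i <- s) conjc (F i).
Proof. exact: (raddf_sum (@conjc R)). Qed.

Lemma Re_realM (a : R) (z : R[i]) : complex.Re (a%:C * z) = a * complex.Re z.
Proof. by rewrite ReM /= mul0r subr0. Qed.

Lemma mulr_sum_sum N (z : R[i]) (A C : 'I_N -> R[i]) :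
  z * ((\sum_j A j) * (\sum_k C k)) = \sum_j \sum_k z * (A j * C k).
Proof.
rewrite mulr_suml mulr_sumr; apply: eq_bigr => j _.
by rewrite mulr_sumr mulr_sumr.
Qed.

(** Conjugating the test function turns its inverse transform into the conjugate of a transform, so
    the pairing is the integral of the multiplier against $\widehat f\,\overline{\widehat g}$. The
    condition on [b] and [b'] says that each output packet sits where the multiplier moves the input
    packet of the same frequency. Integrating [pairing_pointwise] and summing over all pairs leaves
    [N] main terms and an error independent of [N]. *)
Lemma pairing_lower : exists c1 K : R, [/\ 0 < c1, 0 <= K & forall N b b',
  (forall t, shift R i0 t - b t + b' t = 0) ->
  c1 * N%:R - K <= Normc.normc (multiplier (distr_of_fun (lacunary i0 psi))
    (packets N b) (fun x => conjc (packets N b' x)))].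
Proof.
have [K K0 hK] := pairing_pointwise i0 spsi c0 psi_ge psi_supp se.
have [B B0 MB] := lacunary_bounded i0 spsi psi_supp.
have mM := cmeas_lacunary i0 spsi psi_supp.
have fi := fourier_cintegrable se.
have [D D0 eD] := osc_bounded (-1) (schwartz_cintegrable se).
rewrite -fourierE in eD.
have I0 := fourier_bump_L2_gt0 se e_ge0 e0 esupp.
set f2 := fun xi => (Normc.normc (fourier eta xi) ^+ 2)%:C.
have f2i : cintegrable lebesgue_rV f2.
  have h x : Normc.normc (conjc (fourier eta x)) <= D.
    by rewrite normc_conj; exact: eD.
  have := cintegrableMbound (cmeas_conj fi.1) h fi.
  by under eq_fun do rewrite mulrC mul_conj_normc.
set I := complex.Re _ in I0.
pose W := complex.Re (cintegral (fun xi : 'rV[R]_n => (weight xi)%:C)).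
have Wi := weight_real_cintegrable R n.
have W0 : 0 <= W.
  rewrite /W /cintegral/=; apply: Rintegral_ge0 => x _; exact: weight_ge0.
pose tp := two_pi_n R n.
have tp0 : 0 < tp.
  by rewrite /tp /two_pi_n invr_gt0 exprn_gt0// mulr_gt0// pi_gt0.
(* [I] is the squared $L^2$ norm of the transform of the bump, [2 * W] the integral of the two
   weights, and 4 the bound of [sum_geo_le]. *)
exists (tp * (c * I)), (tp * (K * (2 * W) * 4)); split.
- by rewrite !mulr_gt0.
- by rewrite !mulr_ge0// ltW.
move=> N b b' bb'.
pose E j k xi := lacunary i0 psi xi * ((expi (- dotv xi (b j)) * fourier eta (xi - lam R i0 j)) *
  conjc (expi (- dotv xi (b' k)) * fourier eta (xi - lam R i0 k))).
have Ei j k : cintegrable lebesgue_rV (E j k).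
  have fs t := cintegrable_shift (- lam R i0 t) fi.
  have me (t : 'rV[R]_n) : cmeas (fun xi => expi (- dotv xi t)).
    have := cmeas_expi (-1) t.
    by under eq_fun do rewrite dotvC mulN1r.
  apply: (cintegrableMbound mM MB).
  have h1 : cmeas (fun xi => conjc (expi (- dotv xi (b' k)) * fourier eta (xi - lam R i0 k))).
    by apply/cmeas_conj/cmeasM; [exact: me|exact: (fs k).1].
  have h2 xi : Normc.normc (conjc (expi (- dotv xi (b' k)) * fourier eta (xi - lam R i0 k))) <= D.
    by rewrite normc_conj Normc.normcM normc_expi mul1r; exact: eD.
  under eq_fun do rewrite mulrC.
  apply: (cintegrableMbound h1 h2).
  have h3 xi : Normc.normc (expi (- dotv xi (b j))) <= 1 by rewrite normc_expi.
  exact: (cintegrableMbound (me (b j)) h3 (fs j)).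
pose S := cintegral (fun xi => \sum_(j < N) \sum_(k < N) E j k xi).
have -> : multiplier (distr_of_fun (lacunary i0 psi)) (packets N b)
    (fun x => conjc (packets N b' x)) = tp%:C * S.
  rewrite /multiplier /inv_fourier_distr /mul_distr /distr_of_fun /S !cintegralE.
  rewrite -cintZ; last by apply: cintegrable_sum => j; exact: cintegrable_sum.
  apply: eq_cint => xi.
  rewrite (inv_fourier_conj _ (schwartz_packets N b')) !fourier_packets conjc_sum.
  set P := (X in _ * (X * _)); set Q := (X in _ * (_ * (_ * X))).
  transitivity (tp%:C * (lacunary i0 psi xi * (P * Q))); first by ring.
  by congr (_ * _); exact: mulr_sum_sum.
rewrite Normc.normcM normcR gtr0_norm// -!mulrA -mulrBr ler_pM2l//.
apply: le_trans (abs_Re_le S); apply: le_trans (ler_norm _).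
rewrite /S cintegralE (cint_sum _ (fun j : 'I_N => cintegrable_sum _ (fun k : 'I_N => Ei j k))).
rewrite Re_sum; under eq_bigr => j _ do rewrite (cint_sum _ (fun k : 'I_N => Ei j k)) Re_sum.
have low j k : (j == k)%:R * (c * I) - K * geo R j k * (2 * W) <= complex.Re (cint lebesgue_rV (E j k)).
  pose a := (j == k)%:R * c; pose d := - (K * geo R j k).
  have h1 := cintegrable_shift (- lam R i0 j) f2i.
  have h2 t := cintegrable_shift (- lam R i0 t) Wi.
  have -> : (j == k)%:R * (c * I) - K * geo R j k * (2 * W) = complex.Re (cintegral (fun xi =>
      a%:C * f2 (xi - lam R i0 j) + d%:C * ((weight (xi - lam R i0 j))%:C + (weight (xi - lam R i0 k))%:C))).
    rewrite cintegralE cintD; [|exact: cintegrableZ|exact/cintegrableZ/cintegrableD].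
    rewrite cintZ// cintZ; last exact: cintegrableD.
    rewrite cintD// -!cintegralE.
    rewrite (cintegral_shift _ f2i) (cintegral_shift (- lam R i0 j) Wi) (cintegral_shift (- lam R i0 k) Wi).
    by rewrite ReD !Re_realM ReD -/I -/W /a /d; ring.
  apply: Re_cint_le => //.
    apply: cintegrableD; [exact: cintegrableZ|exact/cintegrableZ/cintegrableD].
  move=> xi; have := hK j k (b j) (b' k) xi; rewrite -/(E j k xi).
  have phase : j = k -> shift R i0 j - b j + b' k = 0 by move=> <-.
  move=> /(_ phase); apply: le_trans.
  rewrite ReD !Re_realM ReD /= /a /d le_eqVlt; apply/orP; left; apply/eqP; ring.
apply: (@le_trans _ _ (\sum_(j < N) \sum_(k < N) ((j == k)%:R * (c * I) - K * geo R j k * (2 * W)))).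
  rewrite (eq_bigr (fun j : 'I_N => c * I - K * (2 * W) * \sum_(k < N) geo R j k)); last first.
    move=> j _; rewrite sumrB; congr (_ - _).
      rewrite (bigD1 j)//= eqxx mul1r big1 ?addr0// => k kj.
      by rewrite eq_sym (negbTE kj) mul0r.
    by rewrite mulr_sumr; apply: eq_bigr => k _; ring.
  rewrite sumrB sumr_const card_ord -mulr_sumr; apply: lerB.
    by rewrite -[leRHS]mulr_natr mulrA.
  by rewrite !mulrA -[K * 2 * W]mulrA; apply: ler_wpM2l; rewrite ?sum_geo_le// !mulr_ge0.
by apply: ler_sum => j _; apply: ler_sum => k _; exact: low.
Qed.

End pairing_integral.

Lemma powR_mono (R : realType) (q a b : R) : 0 <= q -> 0 <= a -> a <= b ->
  a `^ q <= b `^ q.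
Proof.
by move=> q0 a0 ab; apply: ge0_ler_powR; rewrite ?nnegrE// (le_trans a0).
Qed.

(** * $L^r$ norms of separated and of coinciding packets *)

Section packets_Lp.
Context (R : realType) (n : nat) (i0 : 'I_n) (e : 'rV[R]_n -> R).
Hypotheses (se : schwartz (fun x => (e x)%:C)) (e_ge0 : forall x, 0 <= e x)
  (esupp : forall x, e x != 0 -> forall i, `|x ord0 i| <= 2).
Implicit Types (x y z xi : 'rV[R]_n) (t j k : nat) (b : nat -> 'rV[R]_n).

Local Notation packets := (packets i0 e).
Local Notation Q := [set x : 'rV[R]_n | forall i, `|x ord0 i| <= 2].

Lemma bump_bounded : exists2 B : R, 0 <= B & forall x, e x <= B.
Proof.
have [C C0 eC] := schwartz_weight se; exists C => // x.
apply: le_trans (ler_norm _) _; rewrite -normcR (le_trans (eC x))//.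
by rewrite ler_piMr// weight_le1.
Qed.

Lemma integral_indic_shift z :
  (\int[lebesgue_rV]_x (\1_Q (x - z) : R)%:E = (4 ^+ n)%:E)%E.
Proof.
have mQ := @measurable_centered_box R n 2.
rewrite (@ge0_integral_shift_rV R n (- z) (fun x => (\1_Q x)%:E)); first last.
- by move=> x; rewrite lee_fin.
- by apply/measurable_EFinP; exact: measurable_indic.
rewrite integral_indic// setIT.
apply: (etrans (@lebesgue_centered_box R n 2 _)) => //.
by congr (_ ^+ _)%:E; ring.
Qed.

Lemma measurable_indic_shift z : measurable_fun setT (fun x => (\1_Q (x - z) : R)).
Proof.
have mQ := @measurable_centered_box R n 2.
have := measurable_affine_rV 1 (- z).
under eq_fun do rewrite scale1r.
exact: (measurableT_comp (measurable_indic mQ)).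
Qed.

Lemma normc_wave_packet_bump l z x :
  Normc.normc (wave_packet (fun x => (e x)%:C) l z x) = e (x - z).
Proof. by rewrite Normc.normcM normc_expi mul1r normcR ger0_norm. Qed.

(** The envelopes have support in boxes of side 4 whose centres differ by more than 4 in one
    coordinate, so at every point at most one packet is nonzero. *)
Lemma packets_separated (q : R) b : 0 < q ->
  (forall j k, j != k -> 4 < `|b j ord0 i0 - b k ord0 i0|) ->
  exists2 E : R, 0 <= E & forall N,
    (\int[lebesgue_rV]_x (Normc.normc (packets N b x) `^ q)%:E <= (E * N%:R)%:E)%E.
Proof.
move=> q0 sep; have [B B0 eB] := bump_bounded.
exists (B `^ q * 4 ^+ n) => [|N]; first by rewrite mulr_ge0 ?powR_ge0// exprn_ge0.
pose g t x := (B `^ q * \1_Q (x - b t))%:E.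
have mg t : measurable_fun setT (g t).
  by apply/measurable_EFinP; apply: measurable_funM => //; exact: measurable_indic_shift.
have g0 t x : (0 <= g t x)%E by rewrite lee_fin mulr_ge0// powR_ge0.
have Eg t : (\int[lebesgue_rV]_x g t x = (B `^ q * 4 ^+ n)%:E)%E.
  rewrite /g; under eq_integral do rewrite EFinM.
  rewrite ge0_integralZl//; first by rewrite integral_indic_shift.
  - by apply/measurable_EFinP; exact: measurable_indic_shift.
  - by rewrite lee_fin powR_ge0.
have mP := schwartz_cmeas (schwartz_packets i0 se N b).
apply: (@le_trans _ _ (\int[lebesgue_rV]_x (\sum_(t < N) g t x))%E); last first.
  rewrite (ge0_integral_sum _ measurableT (fun t : 'I_N => mg t))//.
  under eq_bigr do rewrite Eg.
  by rewrite sumEFin lee_fin sumr_const card_ord -[leLHS]mulr_natr.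
apply: ge0_le_integral => //.
- by move=> x _; rewrite lee_fin powR_ge0.
- apply/measurable_EFinP; apply: (measurableT_comp (measurable_powR q)).
  exact: measurable_normc.
- by apply: emeasurable_sum => t; exact: mg.
- move=> x _; rewrite sumEFin lee_fin.
  have [/existsP[t et]|/existsPn h] := boolP [exists t : 'I_N, e (x - b t) != 0]; last first.
    rewrite /packets big1 => [|t _].
      rewrite Normc.normc0 powR0 ?gt_eqF// sumr_ge0// => t _.
      by rewrite mulr_ge0// powR_ge0.
    by rewrite /wave_packet; have := h t; rewrite negbK => /eqP ->; rewrite mulr0.
  have uniq (s : 'I_N) : s != t -> e (x - b s) = 0.
    move=> st; apply/eqP; apply: contraTT (sep s t st) => es.
    have := esupp es i0; have := esupp et i0.
    rewrite !rV_subE -leNgt !ler_norml => /andP[? ?] /andP[? ?].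
    by apply/andP; split; lra.
  rewrite /packets (bigD1 t)//= big1 => [|s st]; last first.
    by rewrite /wave_packet uniq// mulr0.
  rewrite addr0 normc_wave_packet_bump (bigD1 t)//=.
  apply: (@le_trans _ _ (B `^ q)).
    by apply: powR_mono => //; exact: ltW.
  rewrite indicE mem_set ?mulr1; last exact: esupp.
  by rewrite lerDl sumr_ge0// => s _; rewrite mulr_ge0// powR_ge0.
Qed.

(** The inner product of two packets is the transform of $e^2$ at the difference of their
    frequencies, which [weight_gap] makes at most a multiple of [geo]. *)
Lemma packets_aligned_L2 : exists2 D : R, 0 <= D & forall N, (0 < N)%N ->
  (\int[lebesgue_rV]_x (Normc.normc (packets N (fun=> 0%R) x) ^+ 2)%:E <= (D * N%:R)%:E)%E.
Proof.
pose e2 x : R[i] := (e x)%:C * (e x)%:C.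
have se2 : schwartz e2 by apply: schwartzM => //; exact: schwartz_bsmooth.
have [D D0 eD] := fourier_decay se2.
(* The diagonal contributes $DN$ and the [geo] terms at most $4D$, which is at most $4DN$ since
   $N\ge 1$. *)
exists (D * 5) => [|N N0]; first by rewrite mulr_ge0.
pose P := packets N (fun=> 0).
have sP : schwartz P := schwartz_packets i0 se N _.
have PPi : cintegrable lebesgue_rV (fun x => P x * conjc (P x)).
  exact/schwartz_cintegrable/(schwartzM (schwartz_bsmooth sP))/schwartz_conj.
have fin : (\int[lebesgue_rV]_x (Normc.normc (P x) ^+ 2)%:E)%E \is a fin_num.
  have := integrable_fin_num measurableT (integrable_Re PPi).
  congr (_ \is a fin_num); apply: eq_integral => x _ /=; congr EFin.
  by rewrite mul_conj_normc.
rewrite -(fineK fin) lee_fin.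
have -> : fine (\int[lebesgue_rV]_x (Normc.normc (P x) ^+ 2)%:E) =
    complex.Re (cintegral (fun x => P x * conjc (P x))).
  rewrite /cintegral /= /Rintegral; congr fine; apply: eq_integral => x _.
  by rewrite mul_conj_normc.
pose F j k x : R[i] := expi (- dotv (lam R i0 k - lam R i0 j) x) * e2 x.
have Fi j k : cintegrable lebesgue_rV (F j k).
  rewrite /F; under eq_fun do rewrite -mulN1r.
  exact/cintegrable_osc/schwartz_cintegrable.
have -> : cintegral (fun x => P x * conjc (P x)) =
    \sum_(j < N) \sum_(k < N) fourier e2 (lam R i0 k - lam R i0 j).
  rewrite cintegralE.
  transitivity (cint lebesgue_rV (fun x => \sum_(j < N) \sum_(k < N) F j k x)).
    apply: eq_cint => x; rewrite /P /packets conjc_sum.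
    rewrite -[LHS]mul1r mulr_sum_sum; apply: eq_bigr => j _; apply: eq_bigr => k _.
    rewrite mul1r /wave_packet subr0 conjcM conj_expi /F dotvBl opprB expiD.
    by rewrite (_ : conjc (e x)%:C = (e x)%:C) /e2; [ring|rewrite /= oppr0].
  rewrite (cint_sum _ (fun j : 'I_N => cintegrable_sum _ (fun k : 'I_N => Fi j k))).
  apply: eq_bigr => j _; rewrite (cint_sum _ (fun k : 'I_N => Fi j k)).
  by apply: eq_bigr.
apply: le_trans (ler_norm _) _; apply: le_trans (abs_Re_le _) _.
apply: le_trans (normc_sum _ _) _.
apply: (@le_trans _ _ (\sum_(j < N) \sum_(k < N) ((j == k)%:R * D + D * geo R j k))).
  apply: ler_sum => j _; apply: le_trans (normc_sum _ _) _; apply: ler_sum => k _.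
  apply: (le_trans (eD _)); have [->|jk] := eqVneq j k.
    rewrite mul1r subrr -[leLHS]addr0 lerD ?mulr_ge0 ?geo_ge0//.
    by rewrite ler_piMr// weight_le1.
  by rewrite mul0r add0r ler_wpM2l// geoC; apply: weight_gap; rewrite eq_sym.
rewrite (eq_bigr (fun j : 'I_N => D + D * \sum_(k < N) geo R j k)); last first.
  move=> j _; rewrite big_split/= mulr_sumr; congr (_ + _).
  rewrite (bigD1 j)//= eqxx mul1r big1 ?addr0// => k kj.
  by rewrite eq_sym (negbTE kj) mul0r.
rewrite big_split/= sumr_const card_ord -mulr_sumr -[_ *+ N]mulr_natr -mulrDr -mulrA.
rewrite ler_wpM2l//; have := sum_geo_le R N.
have : 1 <= N%:R :> R by rewrite ler1n.
lra.
Qed.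

(** Hölder's inequality on the common support in pointwise form: split at the typical size $\sqrt
    N$. Values below it contribute at most $N^{q/2}$ on a box of volume $4^n$; above it, $r^q\le
    N^{q/2-1}r^2$ and the $L^2$ bound applies. *)
Lemma packets_aligned (q : R) : 0 < q <= 2 ->
  exists2 D : R, 0 <= D & forall N, (0 < N)%N ->
  (\int[lebesgue_rV]_x (Normc.normc (packets N (fun=> 0%R) x) `^ q)%:E <=
   (D * N%:R `^ (q / 2))%:E)%E.
Proof.
move=> /andP[q0 q2]; have [D D0 PD] := packets_aligned_L2.
exists (D + 4 ^+ n) => [|N N0]; first by rewrite addr_ge0// exprn_ge0.
pose P := packets N (fun=> 0).
have mP : cmeas P := schwartz_cmeas (schwartz_packets i0 se N _).
have NR : 0 < N%:R :> R by rewrite ltr0n.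
pose s : R := N%:R `^ 2^-1.
have s0 : 0 < s by rewrite powR_gt0.
pose a : R := N%:R `^ (q / 2 - 1).
have a0 : 0 <= a := powR_ge0 _ _.
have aN : a * N%:R = N%:R `^ (q / 2).
  rewrite /a -[X in _ * X]powRr1 ?ltW// -powRD; last by apply/implyP => _; rewrite gt_eqF.
  by congr (_ `^ _); ring.
have sq : s `^ q = N%:R `^ (q / 2) by rewrite /s -powRrM; congr (_ `^ _); ring.
have pw (r : R) : 0 <= r -> r `^ q <= a * r ^+ 2 + N%:R `^ (q / 2).
  move=> r0; have [rs|sr] := lerP r s.
    rewrite -sq; apply: (@le_trans _ _ (s `^ q)); last by rewrite lerDr mulr_ge0// sqr_ge0.
    by apply: powR_mono => //; exact: ltW.
  have r_gt0 := lt_trans s0 sr.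
  have h : s `^ (2 - q) <= r `^ (2 - q).
    by apply: powR_mono; rewrite ?subr_ge0// ltW.
  have sa : a * s `^ (2 - q) = 1.
    rewrite /a /s -powRrM -powRD; last by apply/implyP => _; rewrite gt_eqF.
    by rewrite (_ : q / 2 - 1 + 2^-1 * (2 - q) = 0) ?powRr0//; field.
  have rr : r `^ q * r `^ (2 - q) = r ^+ 2.
    rewrite -powRD; last by apply/implyP => _; rewrite gt_eqF.
    by rewrite addrC subrK powR_mulrn// ltW.
  apply: (@le_trans _ _ (a * r ^+ 2)); last by rewrite lerDl powR_ge0.
  rewrite -rr mulrCA -[leLHS]mulr1 ler_wpM2l ?powR_ge0//.
  by apply: (le_trans _ (ler_wpM2l a0 h)); rewrite sa.
have mP2 : measurable_fun setT (fun x => (Normc.normc (P x) ^+ 2)%:E).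
  by apply/measurable_EFinP; apply: measurable_funX; exact: measurable_normc.
have mI : measurable_fun setT (fun x => (\1_Q (x - 0) : R)%:E).
  by apply/measurable_EFinP; exact: measurable_indic_shift.
have P20 x : (0 <= (Normc.normc (P x) ^+ 2)%:E)%E by rewrite lee_fin sqr_ge0.
have m1 : measurable_fun setT (fun x => a%:E * (Normc.normc (P x) ^+ 2)%:E)%E.
  exact: emeasurable_funM.
have m2 : measurable_fun setT (fun x => (N%:R `^ (q / 2))%:E * (\1_Q (x - 0) : R)%:E)%E.
  exact: emeasurable_funM.
have g1 x : setT x -> (0 <= a%:E * (Normc.normc (P x) ^+ 2)%:E)%E.
  by move=> _; rewrite mule_ge0.
have g2 x : setT x -> (0 <= (N%:R `^ (q / 2))%:E * (\1_Q (x - 0) : R)%:E)%E.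
  by move=> _; rewrite mule_ge0// lee_fin powR_ge0.
apply: (@le_trans _ _ (\int[lebesgue_rV]_x (a%:E * (Normc.normc (P x) ^+ 2)%:E +
    (N%:R `^ (q / 2))%:E * (\1_Q (x - 0))%:E))%E); last first.
  rewrite (ge0_integralD _ measurableT g1 m1 g2 m2).
  rewrite ge0_integralZl// ge0_integralZl//.
  rewrite integral_indic_shift.
  apply: (@le_trans _ _ (a%:E * (D * N%:R)%:E + (N%:R `^ (q / 2))%:E * (4 ^+ n)%:E)%E).
    by apply: leeD => //; apply: lee_wpmul2l => //; exact: PD.
  by rewrite -!EFinM -EFinD lee_fin mulrCA aN mulrDl [_ * 4 ^+ n]mulrC.
apply: ge0_le_integral => //.
- by move=> x _; rewrite lee_fin powR_ge0.
- apply/measurable_EFinP; apply: (measurableT_comp (measurable_powR q)).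
  exact: measurable_normc.
- exact: emeasurable_funD.
- move=> x _; rewrite -!EFinM -EFinD lee_fin -/P indicE.
  have [xQ|xQ] := boolP (x - 0 \in Q); first by rewrite mulr1 pw// normc_ge0.
  rewrite (_ : P x = 0); last first.
    apply: big1 => t _; rewrite /wave_packet.
    suff -> : e (x - 0) = 0 by rewrite mulr0.
    by apply/eqP; apply: contraNT xQ => /esupp ?; rewrite inE.
  by rewrite Normc.normc0 powR0 ?gt_eqF// expr0n !mulr0 addr0.
Qed.

End packets_Lp.

(** * Duality between $L^p$ and $L^q$ *)

Section duality.
Context (R : realType) (n : nat).
Implicit Types (h g : 'rV[R]_n -> R[i]) (p q : R).

Lemma Lp_norm_fun_ge0 p h : (0 <= Lp_norm_fun p%:E h)%E.
Proof. exact: Lnorm_ge0. Qed.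

Lemma hoelder_cintegral h g p q : cmeas h -> cmeas g -> 0 < p -> 0 < q ->
  p^-1 + q^-1 = 1 -> (Lp_norm_fun p%:E h < +oo)%E -> (Lp_norm_fun q%:E g < +oo)%E ->
  ((Normc.normc (cintegral (fun x => h x * g x)))%:E <=
    Lp_norm_fun p%:E h * Lp_norm_fun q%:E g)%E.
Proof.
move=> mh mg p0 q0 pq hoo goo.
have H : (\int[lebesgue_rV]_x (Normc.normc (h x * g x)%R)%:E <=
    Lp_norm_fun p%:E h * Lp_norm_fun q%:E g)%E.
  have := @hoelder _ _ _ (@lebesgue_rV R n) (fun x => Normc.normc (h x))
    (fun x => Normc.normc (g x)) p q (measurable_normc mh) (measurable_normc mg) p0 q0 pq.
  rewrite Lnorm1; apply: le_trans; apply: ge0_le_integral => //.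
  - by move=> x _; rewrite lee_fin normc_ge0.
  - by apply: measurable_enormc; exact: cmeasM.
  - apply: measurableT_comp => //; apply/measurable_EFinP.
    by apply: measurable_funM; exact: measurable_normc.
  - by move=> x _ /=; rewrite lee_fin Normc.normcM ler_norm.
apply: (le_trans _ H); apply: normc_cint_le; split; first exact: cmeasM.
apply: (le_lt_trans H); apply: lte_mul_pinfty => //; first exact: Lp_norm_fun_ge0.
by rewrite ge0_fin_numE// Lp_norm_fun_ge0.
Qed.

Lemma Lp_norm_distr_of_fun_le h p : cmeas h -> (Lp_norm_fun p%:E h < +oo)%E ->
  (Lp_norm p%:E (distr_of_fun h) <= Lp_norm_fun p%:E h)%E.
Proof.
by move=> [m1 m2] hoo; apply: ereal_inf_lbound; exists h.
Qed.

(** [Lp_norm] is an infimum over representatives; the slack 1 selects one that nearly attains it,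
    and Hölder's inequality applies to that function. *)
Lemma pairing_upper (u : distr R n) g p q (A : R) : schwartz g -> 0 < p -> 0 < q ->
  p^-1 + q^-1 = 1 -> (Lp_norm_fun q%:E g < +oo)%E -> (Lp_norm p%:E u <= A%:E)%E ->
  ((Normc.normc (u g))%:E <= (A + 1)%:E * Lp_norm_fun q%:E g)%E.
Proof.
move=> sg p0 q0 pq goo uA.
have : (Lp_norm p%:E u < (A + 1)%:E)%E.
  by apply: (le_lt_trans uA); rewrite lte_fin ltrDl.
move=> /ereal_inf_lt [_ [h [m1 m2 hoo hu] <-] hA].
rewrite (hu g sg) /distr_of_fun.
apply: le_trans (hoelder_cintegral _ _ p0 q0 pq hoo goo) _ => //.
  exact: schwartz_cmeas.
by apply: lee_wpmul2r; [exact: Lp_norm_fun_ge0|exact: ltW].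
Qed.

End duality.

(** Replacing [gam] by its maximum [d] with 0 makes $N^d\ge 1$, so the constant [A] is absorbed and
    $N^{1-d}$ would be bounded. *)
Lemma sublinear_powR (R : realType) (c A B gam : R) : 0 < c -> gam < 1 ->
  0 <= B -> ~ (forall N : nat, (0 < N)%N -> c * N%:R - A <= B * N%:R `^ gam).
Proof.
move=> c0 gam1 B0 h.
pose D := (B + `|A|) / c; have D0 : 0 <= D by rewrite divr_ge0 ?addr_ge0// ltW.
pose d := Num.max gam 0.
have d1 : d < 1 by rewrite gt_max gam1 ltr01.
have d0 : 0 <= d by rewrite le_max lexx orbT.
have key N : (0 < N)%N -> N%:R `^ (1 - d) <= D.
  move=> N0; have NR : 0 < N%:R :> R by rewrite ltr0n.
  have N1 : 1 <= N%:R :> R by rewrite ler1n.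
  have Nd : 1 <= N%:R `^ d by rewrite -[leLHS](powRr0 N%:R) ler_powR.
  have Ng : N%:R `^ gam <= N%:R `^ d by rewrite ler_powR// le_max lexx.
  rewrite -(ler_pM2r (lt_le_trans ltr01 Nd)) -powRD; last first.
    by apply/implyP => _; rewrite gt_eqF.
  rewrite subrK powRr1 ?(ltW NR)//.
  have -> : D * N%:R `^ d = (B + `|A|) * N%:R `^ d / c by rewrite /D mulrAC.
  rewrite ler_pdivlMr// mulrC mulrDl.
  have := h N N0; have := ler_wpM2l B0 Ng.
  have := ler_wpM2l (normr_ge0 A) Nd; have := ler_norm A; lra.
have e0 : 0 < 1 - d by rewrite subr_gt0.
(* Chosen so that $N^{1-d}\ge D+1$, against the bound $D$. *)
pose N := (Num.truncn ((D + 1) `^ (1 - d)^-1)).+1.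
have D1 : 0 <= D + 1 by rewrite addr_ge0.
have NB : (D + 1) `^ (1 - d)^-1 <= N%:R by exact/ltW/truncnS_gt.
have := le_trans (powR_mono (ltW e0) (powR_ge0 _ _) NB) (key N isT).
by rewrite -powRrM mulVf ?gt_eqF// powRr1//; lra.
Qed.

(** * Failure of boundedness on $L^p$ *)

Section unboundedness.
Context (R : realType) (n : nat) (i0 : 'I_n) (phi psi : 'rV[R]_n -> R[i]) (c p : R).
Hypotheses (hphi : unity_partition phi) (p1 : 1 < p) (p2 : p != 2)
  (spsi : schwartz psi) (c0 : 0 < c)
  (psi_ge : forall xi : 'rV[R]_n,
    2 `^ (- 2^-1) <= enorm xi <= 2 `^ 2^-1 -> c%:C <= psi xi)
  (psi_supp : supp psi `<=` [set xi | 2^-1 <= enorm xi <= 2]).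

Lemma shift_gap j k : j != k -> 4 < `|shift R i0 j ord0 i0 - shift R i0 k ord0 i0|.
Proof.
move=> jk; rewrite !mxE !eqxx !mulr1.
have gap (a b : nat) : (a < b)%N -> 4 < (5 * b)%:R - (5 * a)%:R :> R.
  move=> ab; have ba : (5 * a + 5)%:R <= (5 * b)%:R :> R by rewrite ler_nat; lia.
  rewrite natrD in ba; apply: (@lt_le_trans _ _ 5%:R); first by rewrite ltr_nat.
  by rewrite lerBrDl.
move: jk; rewrite neq_ltn => /orP[/gap h|/gap h].
  by rewrite distrC; apply: (lt_le_trans h); exact: ler_norm.
by apply: (lt_le_trans h); exact: ler_norm.
Qed.

(* For [p > 2] the packets of the input are pulled apart and those of the
   output coincide; for [p < 2] it is the opposite. *)
Lemma lacunary_unbounded :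
  ~ bounded_multiplier (Lp_norm p%:E) (distr_of_fun (lacunary i0 psi)).
Proof.
move=> [C HC]; have [e [se e_ge0 e0 esupp]] := bump_exists hphi.
have [c1 [K [c1_gt0 K0 low]]] := pairing_lower i0 spsi c0 psi_ge psi_supp se e_ge0 e0 esupp.
have p0 : 0 < p by exact: lt_trans p1.
pose q := p / (p - 1).
have pm : 0 < p - 1 by rewrite subr_gt0.
have q0 : 0 < q by rewrite divr_gt0.
have pq : p^-1 + q^-1 = 1.
  by rewrite /q; field; rewrite !gt_eqF.
(* Common to both ranges of [p]: norms of order $N^{al}$ in $L^p$ and $N^{be}$ in $L^q$ bound a
   pairing of order $N$. The hypothesis [0 <= al] lets $N^{al}$ absorb the slack 1 of
   [pairing_upper]. *)
have main (b b' : nat -> 'rV[R]_n) (E E' al be : R) : al + be < 1 -> 0 <= al ->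
  0 <= E -> 0 <= E' -> (forall t, shift R i0 t - b t + b' t = 0) ->
  (forall N, (0 < N)%N -> Lp_norm_fun p%:E (packets i0 e N b) <= (E * N%:R `^ al)%:E)%E ->
  (forall N, (0 < N)%N -> Lp_norm_fun q%:E (packets i0 e N b') <= (E' * N%:R `^ be)%:E)%E ->
  False.
  move=> albe al0 E0 E'0 bb' Hb Hb'.
  apply: (@sublinear_powR R c1 K ((`|C| * E + 1) * E') (al + be) c1_gt0 albe) => [|N N0].
    by rewrite mulr_ge0// addr_ge0// mulr_ge0.
  apply: (le_trans (low N b b' bb')).
  have sf := schwartz_packets i0 se N b.
  have sg := schwartz_conj (schwartz_packets i0 se N b').
  have foo := le_lt_trans (Hb N N0) (ltry _).
  have gE : Lp_norm_fun q%:E (fun x => conjc (packets i0 e N b' x)) =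
      Lp_norm_fun q%:E (packets i0 e N b').
    by apply: eq_Lnorm => x; rewrite normc_conj.
  have goo : (Lp_norm_fun q%:E (fun x => conjc (packets i0 e N b' x)) < +oo)%E.
    by rewrite gE (le_lt_trans (Hb' N N0))// ltry.
  have Xf := Lp_norm_distr_of_fun_le (schwartz_cmeas sf) foo.
  have := HC _ sf (le_lt_trans Xf foo).
  set u := multiplier _ _ => uX.
  have X0 : (0 <= Lp_norm p%:E (distr_of_fun (packets i0 e N b)))%E.
    by apply/ereal_infP => _ [h _ <-]; exact: Lp_norm_fun_ge0.
  have uA : (Lp_norm p%:E u <= (`|C| * (E * N%:R `^ al))%:E)%E.
    have XE := le_trans Xf (Hb N N0).
    have Xfin : Lp_norm p%:E (distr_of_fun (packets i0 e N b)) \is a fin_num.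
      by rewrite ge0_fin_numE// (le_lt_trans XE)// ltry.
    apply: (le_trans uX); rewrite -(fineK Xfin) -EFinM lee_fin.
    rewrite -(fineK Xfin) lee_fin in XE.
    apply: (le_trans (ler_wpM2r (fine_ge0 X0) (ler_norm C))).
    by rewrite ler_wpM2l.
  have NR1 : 1 <= N%:R `^ al.
    by rewrite -[leLHS](powRr0 N%:R) ler_powR// ler1n.
  rewrite -lee_fin; apply: le_trans (pairing_upper sg p0 q0 pq goo uA) _.
  rewrite gE; apply: le_trans (lee_wpmul2l _ (Hb' N N0)) _.
    by rewrite lee_fin addr_ge0// !mulr_ge0// powR_ge0.
  rewrite -EFinM lee_fin.
  have -> : N%:R `^ (al + be) = N%:R `^ al * N%:R `^ be.
    by rewrite powRD//; apply/implyP => _; rewrite gt_eqF// ltr0n.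
  have -> : (`|C| * E + 1) * E' * (N%:R `^ al * N%:R `^ be) =
    ((`|C| * (E * N%:R `^ al)) + N%:R `^ al) * (E' * N%:R `^ be) by ring.
  by rewrite ler_wpM2r ?mulr_ge0 ?powR_ge0// lerD2l.
have root (r s : R) (D : R) b N : 0 < r -> 0 <= D ->
   (\int[lebesgue_rV]_x (Normc.normc (packets i0 e N b x) `^ r)%:E <= (D * N%:R `^ s)%:E)%E ->
   (Lp_norm_fun r%:E (packets i0 e N b) <= (D `^ r^-1 * N%:R `^ (s / r))%:E)%E.
  move=> r0 D0 /(Lp_norm_fun_le r0) /le_trans; apply; rewrite lee_fin.
  by rewrite powRM ?powR_ge0// powRrM.
have sepN (b : nat -> 'rV[R]_n) (r : R) : 0 < r ->
    (forall j k, j != k -> 4 < `|b j ord0 i0 - b k ord0 i0|) ->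
    exists2 E : R, 0 <= E & forall N, (0 < N)%N ->
      (Lp_norm_fun r%:E (packets i0 e N b) <= (E * N%:R `^ r^-1)%:E)%E.
  move=> r0 sep; have [E E0 EP] := packets_separated se e_ge0 esupp r0 sep.
  exists (E `^ r^-1); first exact: powR_ge0.
  move=> N N0; rewrite -[r^-1 in X in (_ <= (_ * X)%:E)%E]mul1r; apply: root => //.
  by rewrite powRr1.
have alN (r : R) : 0 < r <= 2 -> exists2 E : R, 0 <= E & forall N, (0 < N)%N ->
      (Lp_norm_fun r%:E (packets i0 e N (fun=> 0%R)) <= (E * N%:R `^ 2^-1)%:E)%E.
  move=> r2; have /andP[r0 _] := r2.
  have [E E0 EP] := packets_aligned i0 se esupp r2.
  exists (E `^ r^-1); first exact: powR_ge0.
  move=> N N0; rewrite (_ : 2^-1 = r / 2 / r); last by field; rewrite gt_eqF.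
  by apply: root => //; exact: EP.
have pV1 : p^-1 < 1 by rewrite invf_lt1.
have qE : q^-1 = 1 - p^-1 by rewrite -pq [p^-1 + _]addrC addrK.
(* The coinciding family must be measured with an exponent at most 2: [p] itself if [p < 2],
   otherwise the conjugate exponent [q]. The other family then grows with exponent $1/q$,
   respectively $1/p$, which is below $1/2$. *)
have [p_lt2|p_ge2] := ltP p 2.
  have [E E0 HE] := alN p (introT andP (conj p0 (ltW p_lt2))).
  have [|E' E'0 HE'] := sepN (fun t => - shift R i0 t) q q0.
    move=> j k jk; rewrite !mxE -opprD normrN; have := shift_gap jk.
    by rewrite !mxE.
  apply: (main (fun=> 0) (fun t => - shift R i0 t) E E' 2^-1 q^-1) => //.
  - rewrite qE; have : 2^-1 < p^-1 by rewrite ltf_pV2 ?posrE.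
    lra.
  - by move=> t; rewrite subr0 subrr.
have p_gt2 : 2 < p by rewrite lt_def p2.
have [E E0 HE] := sepN (fun t => shift R i0 t) p p0 shift_gap.
have q2 : 0 < q <= 2.
  by rewrite q0/= /q ler_pdivrMr//; lra.
have [E' E'0 HE'] := alN q q2.
apply: (main (fun t => shift R i0 t) (fun=> 0) E E' p^-1 2^-1) => //.
- have : p^-1 < 2^-1 by rewrite ltf_pV2 ?posrE.
  lra.
- by rewrite invr_ge0 ltW.
- by move=> t; rewrite subrr addr0.
Qed.

End unboundedness.

Theorem proposition1p4 (R : realType) (n : nat) (hn : (0 < n)%N)
  (phi : 'rV[R]_n -> R[i]) (hphi : unity_partition phi)
  (p : R) (p1 : 1 < p) (p2 : p != 2)
  (psi : 'rV[R]_n -> R[i]) (hpsi : schwartz psi)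
  (psi_ge : exists2 c : R, 0 < c &
    forall xi, 2 `^ (- 2^-1) <= enorm xi <= 2 `^ 2^-1 -> c%:C <= psi xi)
  (psi_supp : supp psi `<=` [set xi | 2^-1 <= enorm xi <= 2]) :
  exists m : distr R n, [/\ tempered m,
    (ereal_sup [set modulation_norm phi 2%:E 1%:E 0
        (mul_distr psi (dilate_distr (2 ^ j) m)) | j in [set: int]] < +oo)%E &
    ~ bounded_multiplier (Lp_norm p%:E) m].
Proof.
(* Positivity of [n] supplies the axis along which both the frequencies and the translations are
   laid. *)
have [c c0 psi_c] := psi_ge; pose i0 : 'I_n := Ordinal hn.
have [B _ MB] := lacunary_bounded i0 hpsi psi_supp.
exists (distr_of_fun (lacunary i0 psi)); split.
- exact: tempered_bounded (cmeas_lacunary i0 hpsi psi_supp) MB.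
- have [K HK] := lacunary_modulation_norm i0 hphi hpsi psi_supp.
  apply: (@le_lt_trans _ _ K%:E); last exact: ltry.
  by apply: ge_ereal_sup => _ [j _ <-]; exact: HK.
- exact: lacunary_unbounded hphi p1 p2 hpsi c0 psi_c psi_supp.
Qed.
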